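(* In the $\beta$-model, assume $b_n^3/c_n=o\big(n^{1/6}/\log n\big)$ and let $r$ be a fixed positive integer. Let $\widehat{\boldsymbol\beta}=\arg\max_{\mathbb R^n}\ell$ be the MLE and $\widehat{\boldsymbol\beta}^0=\arg\max_{\Theta_0}\ell$ the restricted MLE. (a) Under the null $H_0:\beta_i=\beta_i^0$, $i=1,\dots,r$ (known numbers $\beta_i^0$; $\Theta_0=\{\boldsymbol\beta\in\mathbb R^n:(\beta_1,\dots,\beta_r)=(\beta_1^0,\dots,\beta_r^0)\}$), $2\{\ell(\widehat{\boldsymbol\beta})-\ell(\widehat{\boldsymbol\beta}^0)\}$ converges in distribution to the chi-square distribution with $r$ degrees of freedom as $n\to\infty$. (b) Under the homogeneous null $H_0:\beta_1=\cdots=\beta_r$ ($\Theta_0=\{\boldsymbol\beta\in\mathbb R^n:\beta_1=\cdots=\beta_r\}$), $2\{\ell(\widehat{\boldsymbol\beta})-\ell(\widehat{\boldsymbol\beta}^0)\}$ converges in distribution to the chi-square distribution with $r-1$ degrees of freedom as $n\to\infty$.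
   Context: $\beta$-model: for $n$ nodes, the adjacency entries $a_{ij}=a_{ji}\in\{0,1\}$, $1\le i<j\le n$, are mutually independent with $P(a_{ij}=1)=e^{\beta_i+\beta_j}/(1+e^{\beta_i+\beta_j})$ where $\boldsymbol\beta$ is the true parameter (depending on $n$, satisfying the null), and $a_{ii}=0$. Degrees $d_i=\sum_{j\ne i}a_{ij}$. Log-likelihood $\ell(\boldsymbol\beta)=\sum_i\beta_id_i-\sum_{i<j}\log(1+e^{\beta_i+\beta_j})$. $b_n=\max_{i\neq j}(1+e^{\beta_i+\beta_j})^2/e^{\beta_i+\beta_j}$, $c_n=\min_{i\ne j}(1+e^{\beta_i+\beta_j})^2/e^{\beta_i+\beta_j}$ at the true parameter. *)

(* Defs.v *)
From HB Require Import structures.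
From mathcomp Require Import all_boot all_order all_algebra.
From mathcomp Require Import all_classical all_reals all_analysis.
Set Implicit Arguments. Unset Strict Implicit. Unset Printing Implicit Defensive.
Import Order.TTheory GRing.Theory Num.Theory.
Import numFieldNormedType.Exports.
Local Open Scope classical_set_scope.
Local Open Scope ring_scope.

Section BetaModel.
Variable R : realType.

Definition is_adj (n : nat) (a : {ffun 'I_n * 'I_n -> bool}) : bool :=
  [forall i : 'I_n, ~~ a (i, i)] &&
  [forall i : 'I_n, forall j : 'I_n, a (i, j) == a (j, i)].

Definition degree (n : nat) (a : {ffun 'I_n * 'I_n -> bool}) (i : 'I_n) : nat :=
  \sum_(j < n | j != i) (a (i, j) : nat).

Definition loglik (n : nat) (a : {ffun 'I_n * 'I_n -> bool}) (b : 'I_n -> R) : R :=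
  \sum_(i < n) b i * (degree a i)%:R
  - \sum_(i < n) \sum_(j < n | (i < j)%N) ln (1 + expR (b i + b j)).

Definition edge_prob (n : nat) (beta : 'I_n -> R) (i j : 'I_n) : R :=
  expR (beta i + beta j) / (1 + expR (beta i + beta j)).

(* Probability of the graph a under the beta-model with parameter beta:
   the a_ij, i<j, are independent Bernoulli(edge_prob). *)
Definition graph_prob (n : nat) (beta : 'I_n -> R) (a : {ffun 'I_n * 'I_n -> bool}) : R :=
  \prod_(i < n) \prod_(j < n | (i < j)%N)
     (if a (i, j) then edge_prob beta i j else 1 - edge_prob beta i j).

Definition prob_le (n : nat) (beta : 'I_n -> R)
  (T : {ffun 'I_n * 'I_n -> bool} -> R) (x : R) : R :=
  \sum_(a : {ffun 'I_n * 'I_n -> bool} | is_adj a && (T a <= x)) graph_prob beta a.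

(* sup of the log-likelihood over a parameter set Theta (= l at the
   (restricted) MLE whenever the maximum is attained). *)
Definition max_loglik (n : nat) (Theta : set ('I_n -> R))
  (a : {ffun 'I_n * 'I_n -> bool}) : R :=
  sup [set loglik a b | b in Theta].

Definition LRT (n : nat) (Theta0 : set ('I_n -> R))
  (a : {ffun 'I_n * 'I_n -> bool}) : R :=
  2 * (max_loglik setT a - max_loglik Theta0 a).

Definition vfun (x : R) : R := (1 + expR x) ^+ 2 / expR x.

Definition b_n (n : nat) (beta : 'I_n -> R) : R :=
  \big[Num.max/0]_(i < n) \big[Num.max/0]_(j < n | j != i) vfun (beta i + beta j).

(* (for n <= 1 the index set is empty; the value is then irrelevant) *)
Definition c_n (n : nat) (beta : 'I_n -> R) : R :=
  \big[Num.min/b_n beta]_(i < n) \big[Num.min/b_n beta]_(j < n | j != i)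
     vfun (beta i + beta j).

(* chi-square distribution with k degrees of freedom:
   density proportional to t^{k/2-1} e^{-t/2} on t > 0; for k = 0 the
   point mass at 0. *)
Definition chisq_dens (k : nat) (t : R) : R :=
  if 0 < t then t `^ (k%:R / 2 - 1) * expR (- (t / 2)) else 0.

Definition chisq_cdf (k : nat) (x : R) : R :=
  if k == 0%N then (if 0 <= x then 1 else 0)
  else fine (\int[@lebesgue_measure R]_(t in `]-oo, x]) (chisq_dens k t)%:E)
     / fine (\int[@lebesgue_measure R]_(t in [set: R]) (chisq_dens k t)%:E).

Definition conv_in_dist (beta : forall n, 'I_n -> R)
  (T : forall n, {ffun 'I_n * 'I_n -> bool} -> R) (F : R -> R) : Prop :=
  forall x : R, {for x, continuous F} ->
    (fun n => prob_le (beta n) (T n) x) @ \oo --> F x.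

Definition Theta0_simple (r n : nat) (beta0 : 'I_r -> R) : set ('I_n -> R) :=
  [set b | forall (i : 'I_n) (Hi : (i < r)%N), b i = beta0 (Ordinal Hi)].

Definition Theta0_homog (r n : nat) : set ('I_n -> R) :=
  [set b | forall i j : 'I_n, (i < r)%N -> (j < r)%N -> b i = b j].

End BetaModel.

(* Main.v *)
(** On an event of probability [1 - O(1/n)] all centred degrees are
[O(sqrt (n log n))], and the maximizer of the likelihood over a box around the
true parameter, free or restricted, is interior and within
[M = O((b_n^2 / c_n) sqrt (log n / n))] of it: a sup-norm bound for the matrices
[y |-> (sum_(j != i) w_ij (y_i + y_j))_i] replaces the inversion of the Fisher
information. By concavity this maximizer is the MLE.

The two maximized likelihoods are not expanded. Moving only the first [r]
coordinates, by one Newton step from the restricted MLE and back to the null set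
from the free one, squeezes twice their difference between
[(1 - o(1)) sum F_i^2 / v_i] and [(1 + o(1)) sum G_i^2 / v_i], where [F] and [G] are
the first [r] centred degrees (minus their mean under the homogeneous null) up to
a negligible error. The likelihood ratio is thus close to a quadratic form of
rank [r] or [r - 1] in [r] normalized sums of independent centred Bernoulli
variables.

Replacing the summands one by one, the Laplace transform of that form follows the
explicit solution [(1 + 2 s tau)^(-k/2) exp (- s q / (1 + 2 s tau))] of the heat
equation, so it tends to [(1 + 2 s)^(-k/2)], the transform of the chi-square law.
Laplace transforms at integer points suffice, since [1 - (1 - exp (- m t))^N] is a
polynomial in [exp (- t)] that approximates the indicator of [[0, x]]. *)

Require Import Defs.
From HB Require Import structures.
From mathcomp Require Import all_boot all_order all_algebra.
From mathcomp Require Import all_classical all_reals all_analysis.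
From mathcomp Require Import measurable_realfun.
From mathcomp Require Import ring lra zify.
Import Order.TTheory GRing.Theory Num.Theory.
Import numFieldNormedType.Exports.
Local Open Scope classical_set_scope.
Local Open Scope ring_scope.
Set Implicit Arguments.
Unset Strict Implicit.

(** * The logistic function *)

(** Expanding the two maximized likelihoods separately would leave remainders summed over all [n]
    coordinates, to be cancelled down to [o(1)]. A move confined to [r] coordinates has only
    relative errors, factors [expR (O(M))] on a sum of [r] terms, so [M -> 0] suffices. The sup-norm
    bound is delicate because the diagonal weight of a row only equals the sum of the others: one
    row alone bounds nothing, and a second row, where [y] is close to minus its maximum, must
    contradict it. The bound is applied again to expand the scores, now with averaged scores of
    order [(b_n / c_n) sqrt (log n)] on the right. Only the simple null calls for this: between tied
    nodes a difference of scores does not depend on the parameter. Entries between two of the first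
    [r] nodes are dropped at bounded cost, so that the remaining rows share no edge. Every
    deterministic error, some after squaring, is a constant times a monomial in [b_n], [1 / c_n] and
    [log n] divided by [n], hence at most a constant times [rate], the sixth power of the ratio
    assumed small. *)

Lemma le_of_eq (d : Order.disp_t) (T : porderType d) (x y : T) : x = y -> (x <= y)%O.
Proof. by move->. Qed.

Section Logistic.
Variable R : realType.
Implicit Types x y h t : R.

Definition logistic x : R := expR x / (1 + expR x).
Definition softplus x : R := ln (1 + expR x).
Definition logistic_var x : R := expR x / (1 + expR x) ^+ 2.

Lemma expR_add1_gt0 x : 0 < 1 + expR x.
Proof. by rewrite addr_gt0// expR_gt0. Qed.

Lemma logistic_gt0 x : 0 < logistic x.
Proof. by rewrite divr_gt0 ?expR_gt0 ?expR_add1_gt0. Qed.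

Lemma logistic_lt1 x : logistic x < 1.
Proof. by rewrite /logistic ltr_pdivrMr ?expR_add1_gt0// mul1r ltrDr. Qed.

Lemma logistic_varE x : logistic_var x = logistic x * (1 - logistic x).
Proof.
have := expR_add1_gt0 x => h; rewrite /logistic_var /logistic.
by field; rewrite gt_eqF.
Qed.

Lemma logistic_var_gt0 x : 0 < logistic_var x.
Proof. by rewrite divr_gt0 ?expR_gt0// exprn_gt0// expR_add1_gt0. Qed.

Lemma logistic_var_ge0 x : 0 <= logistic_var x.
Proof. exact/ltW/logistic_var_gt0. Qed.

Lemma logistic_var_vfun x : logistic_var x = (vfun x)^-1.
Proof. by rewrite /vfun invf_div. Qed.

Lemma vfun_ge4 x : 4 <= vfun x.
Proof.
rewrite /vfun ler_pdivlMr ?expR_gt0//.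
have := sqr_ge0 (1 - expR x); nra.
Qed.

Lemma logisticN x : logistic (- x) = 1 - logistic x.
Proof.
rewrite /logistic expRN; have h := expR_add1_gt0 x; have h' := expR_gt0 x.
by field; rewrite !gt_eqF//= addrC.
Qed.

Lemma logistic_varN x : logistic_var (- x) = logistic_var x.
Proof. by rewrite !logistic_varE logisticN; ring. Qed.

Lemma softplusN x : softplus (- x) = softplus x - x.
Proof.
rewrite /softplus; have h := expR_add1_gt0 x; have h' := expR_gt0 x.
rewrite -{3}(expRK x) -ln_div ?posrE//; congr ln.
by rewrite expRN; field; rewrite gt_eqF.
Qed.

Lemma expR_sub1_bounds h : 0 <= h -> h <= expR h - 1 <= h * expR h.
Proof.
move=> h0; apply/andP; split; first by rewrite lerBrDl expR_ge1Dx.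
have := expR_ge1Dx (- h); rewrite expRN => H.
have e0 := expR_gt0 h.
have : (1 - h) * expR h <= (expR h)^-1 * expR h by rewrite ler_pM2r.
rewrite mulVf ?gt_eqF//; nra.
Qed.

Lemma logistic_diff_ge0 x h : 0 <= h ->
  logistic_var x * expR (- h) * h <= logistic (x + h) - logistic x
    <= logistic_var x * expR h * h.
Proof.
move=> h0.
have hx := expR_add1_gt0 x; have hxh := expR_add1_gt0 (x + h).
have /andP[B1 B2] := expR_sub1_bounds h0.
have e1 : 1 <= expR h by have := expR_ge1Dx h; lra.
have ex := expR_gt0 x; have eh := expR_gt0 h.
(* Exact factorization: [expR h - 1] lies between [h] and [h * expR h], and the last quotient
   between [expR (- h)] and 1; this gives both bounds. *)
have -> : logistic (x + h) - logistic x =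
  logistic_var x * ((expR h - 1) * ((1 + expR x) / (1 + expR (x + h)))).
  rewrite /logistic /logistic_var; move: hx hxh; rewrite expRD => hx hxh.
  by field; rewrite !gt_eqF.
rewrite -!mulrA !ler_pM2l ?logistic_var_gt0//.
have q1 : (1 + expR x) / (1 + expR (x + h)) <= 1.
  rewrite ler_pdivrMr// mul1r lerD2l ler_expR; lra.
have q2 : expR (- h) <= (1 + expR x) / (1 + expR (x + h)).
  rewrite ler_pdivlMr// mulrDr mulr1 -expRD (addrC x) addKr lerD2r.
  by rewrite expR_le1; lra.
have q0 := expR_gt0 (- h).
apply/andP; split; nra.
Qed.

Lemma logistic_diff_le0 x h : 0 <= h ->
  logistic_var x * expR (- h) * h <= logistic x - logistic (x - h)
    <= logistic_var x * expR h * h.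
Proof.
move=> h0; have := logistic_diff_ge0 (- x) h0.
rewrite logistic_varN (_ : - x + h = - (x - h)); last by ring.
rewrite !logisticN; set a := logistic x; set b := logistic (x - h).
by rewrite (_ : 1 - b - (1 - a) = a - b) //; ring.
Qed.

(** A divided difference replaces the mean value theorem: it stays within a factor [expR |h|] of the
    variance at [x], so that linearization errors are relative. At [h = 0] the variance itself is
    chosen. *)
Lemma logistic_slope x h : exists w,
  [/\ logistic (x + h) - logistic x = w * h,
      logistic_var x * expR (- `|h|) <= w & w <= logistic_var x * expR `|h|].
Proof.
have v0 := logistic_var_gt0 x.
have [->|hn0] := eqVneq h 0.
  exists (logistic_var x); rewrite normr0 oppr0 expR0 !mulr1 addr0 subrr mulr0.
  by split.
exists ((logistic (x + h) - logistic x) / h); rewrite divfK//.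
case: (ltgtP h 0) hn0 => // hs _; split => //.
- rewrite ler_ndivlMr// ltr0_norm// opprK.
  have hN : 0 <= - h by lra.
  have /andP[] := logistic_diff_le0 x hN.
  rewrite opprK; set p := logistic _; set q := logistic _; nra.
- rewrite ler_ndivrMr// ltr0_norm//.
  have hN : 0 <= - h by lra.
  have /andP[] := logistic_diff_le0 x hN.
  rewrite opprK; set p := logistic _; set q := logistic _; nra.
- rewrite ler_pdivlMr// gtr0_norm//.
  by have /andP[] := @logistic_diff_ge0 x h (ltW hs).
- rewrite ler_pdivrMr// gtr0_norm//.
  by have /andP[] := @logistic_diff_ge0 x h (ltW hs).
Qed.

Lemma is_derive_softplus x : is_derive x 1 softplus (logistic x).
Proof.
rewrite (_ : softplus = @ln R \o (cst 1 + expR)) //.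
have d1 : is_derive x 1 (cst 1 + expR : R -> R) (expR x).
  by rewrite -[X in is_derive _ _ _ X]add0r; apply: is_deriveD.
have d2 := is_derive1_ln (expR_add1_gt0 x).
rewrite /logistic mulrC; exact: is_derive1_comp.
Qed.

(** Each bound is the monotonicity on [[0, h]] of a function with known derivative: [F] for the
    convexity, and the quadratic minus [F], called [G], for the upper bound. *)
Lemma softplus_bregman_pos x h : 0 <= h ->
  0 <= softplus (x + h) - softplus x - logistic x * h
    <= 2^-1 * (logistic_var x * expR h) * h ^+ 2.
Proof.
move=> h0.
have dsp t : is_derive t 1 (fun t => softplus (x + t)) (logistic (x + t)).
  have := @is_derive1_comp _ softplus (cst x + id) t (logistic (x + t)) 1.
  rewrite mulr1; apply; first exact: is_derive_softplus.
  by rewrite -[X in is_derive _ _ _ X]add0r; apply: is_deriveD.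
have dlin c t : is_derive t 1 (fun t : R => c * t) c.
  have := @is_deriveZ _ _ _ id c t 1 1 (is_derive_id _ _).
  by rewrite /GRing.scale/= mulr1.
have cont (f : R -> R) (df : R -> R) : (forall t, is_derive t 1 f (df t)) ->
    {within `[0, h], continuous f}.
  move=> fd; apply: derivable_within_continuous => t _.
  exact: (@ex_derive _ _ _ _ _ _ _ (fd t)).
pose F (t : R) := softplus (x + t) - logistic x * t.
have dF t : is_derive t 1 F (logistic (x + t) - logistic x).
  exact: is_deriveB.
have F0 : F 0 = softplus x by rewrite /F addr0 mulr0 subr0.
apply/andP; split.
  have : F 0 <= F h.
    apply: (@ger0_derive1_ndecr _ F 0 h) => //.
    - move=> t; rewrite in_itv/= => /andP[t0 _].
      case: (dF t) => _; rewrite derive1E => ->.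
      have /andP[+ _] := @logistic_diff_ge0 x t (ltW t0).
      apply: le_trans; rewrite !mulr_ge0 ?expR_ge0 ?(ltW t0)//.
    - exact: cont dF.
  by rewrite F0 /F; lra.
pose c := logistic_var x * expR h.
pose G (t : R) := 2^-1 * c * t ^+ 2 - F t.
have dG t : is_derive t 1 G (c * t - (logistic (x + t) - logistic x)).
  apply: is_deriveB.
  have d2 := @is_deriveX _ _ id 2%N t 1 1 (is_derive_id _ _).
  have := @is_deriveZ _ _ _ _ (2^-1 * c) t 1 _ d2.
  rewrite (_ : (2^-1 * c) *: _ = c * t) //.
  by rewrite /GRing.scale/= expr1; field.
have : G 0 <= G h.
  apply: (@ger0_derive1_ndecr _ G 0 h) => //.
  - move=> t; rewrite in_itv/= => /andP[t0 th].
    case: (dG t) => _; rewrite derive1E => ->.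
    have /andP[_ B] := @logistic_diff_ge0 x t (ltW t0).
    rewrite subr_ge0 (le_trans B)// ler_pM2r// ler_pM2l ?logistic_var_gt0//.
    by rewrite ler_expR ltW.
  - exact: cont dG.
rewrite /G F0 expr0n/= mulr0 /F /c; lra.
Qed.

(** Negative increments reduce to positive ones by the reflection [softplusN]. The lower bound
    becomes concavity of the likelihood, the upper one its quadratic minorant with a slightly
    inflated curvature. *)
Lemma softplus_bregman x h :
  0 <= softplus (x + h) - softplus x - logistic x * h
    <= 2^-1 * (logistic_var x * expR `|h|) * h ^+ 2.
Proof.
have [h0|h0] := leP 0 h; first by rewrite ger0_norm// softplus_bregman_pos.
have := @softplus_bregman_pos (- x) (- h) _; rewrite -opprD !softplusN logisticN.
rewrite logistic_varN sqrrN ltr0_norm//.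
have -> : softplus (x + h) - (x + h) - (softplus x - x) - (1 - logistic x) * - h
  = softplus (x + h) - softplus x - logistic x * h by ring.
by apply; lra.
Qed.

Lemma logistic_var_diff x h :
  logistic_var (x + h) <= logistic_var x * expR `|h|.
Proof.
rewrite /logistic_var.
have hx := expR_add1_gt0 x; have hxh := expR_add1_gt0 (x + h).
have ex := expR_gt0 x.
suff [w [w0 ->]] : exists w, w <= 1 /\ expR (x + h) / (1 + expR (x + h)) ^+ 2
   = expR x / (1 + expR x) ^+ 2 * expR `|h| * w.
  by rewrite ler_piMr// mulr_ge0 ?expR_ge0// ltW// logistic_var_gt0.
have [h0|h0] := leP 0 h.
  exists (((1 + expR x) / (1 + expR (x + h))) ^+ 2); split.
    apply: exprn_ile1; first by rewrite divr_ge0 ?ltW.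
    by rewrite ler_pdivrMr// mul1r lerD2l ler_expR; lra.
  rewrite ger0_norm//; move: hxh; rewrite expRD => hxh.
  by field; rewrite !gt_eqF.
exists ((expR h * (1 + expR x) / (1 + expR (x + h))) ^+ 2); split.
  have eh : expR h < 1 by rewrite expR_lt1.
  apply: exprn_ile1; first by rewrite divr_ge0 ?mulr_ge0 ?expR_ge0 ?ltW.
  rewrite ler_pdivrMr// mul1r expRD; nra.
rewrite ltr0_norm// expRN; move: hxh; rewrite expRD => hxh.
by have := expR_gt0 h => eh; field; rewrite !gt_eqF.
Qed.

End Logistic.

(** * Products of Bernoulli laws *)

Section BernoulliProduct.
Variables (R : realType) (I : finType) (p : I -> R).
Implicit Types (f g : {ffun I -> bool} -> R) (a : {ffun I -> bool}).

(** Random graphs are handled by finite weighted sums; measure theory enters only with the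
    chi-square density. *)
Definition bernoulli_wt (e : I) (b : bool) : R := if b then p e else 1 - p e.
Definition prod_wt a : R := \prod_e bernoulli_wt e (a e).
Definition expect f : R := \sum_a prod_wt a * f a.

Definition centered (e : I) a : R := (a e)%:R - p e.
Definition ffun_merge (A : pred I) a a' : {ffun I -> bool} :=
  [ffun e => if A e then a e else a' e].
Definition depends_on (A : pred I) f :=
  forall a a', (forall e, A e -> a e = a' e) -> f a = f a'.

Lemma expect_prod (g : I -> bool -> R) :
  expect (fun a => \prod_e g e (a e)) =
  \prod_e (p e * g e true + (1 - p e) * g e false).
Proof.
rewrite (eq_bigr (fun e => \sum_(b : bool) bernoulli_wt e b * g e b)); last first.
  by move=> e _; rewrite big_bool.
rewrite bigA_distr_bigA; apply: eq_bigr => a _.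
by rewrite /prod_wt -big_split.
Qed.

Lemma expect_cst c : expect (fun=> c) = c.
Proof.
rewrite /expect -mulr_suml.
have := expect_prod (fun _ _ => 1); rewrite /expect.
rewrite (eq_bigr prod_wt) => [->|a _]; last by rewrite big1_eq mulr1.
by rewrite big1 ?mul1r// => e _; ring.
Qed.

Lemma eq_expect f g : f =1 g -> expect f = expect g.
Proof. by move=> fg; apply: eq_bigr => a _; rewrite fg. Qed.

Lemma expectD f g : expect (fun a => f a + g a) = expect f + expect g.
Proof. by rewrite /expect -big_split; apply: eq_bigr => a _; rewrite mulrDr. Qed.

Lemma expectZl c f : expect (fun a => c * f a) = c * expect f.
Proof. by rewrite /expect mulr_sumr; apply: eq_bigr => a _; rewrite mulrCA. Qed.

Lemma expectN f : expect (fun a => - f a) = - expect f.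
Proof. by rewrite -mulN1r -expectZl; apply: eq_expect => a; rewrite mulN1r. Qed.

Lemma expectB f g : expect (fun a => f a - g a) = expect f - expect g.
Proof. by rewrite expectD expectN. Qed.

Lemma expect_sum (J : Type) (s : seq J) (P : pred J) (F : J -> {ffun I -> bool} -> R) :
  expect (fun a => \sum_(j <- s | P j) F j a) = \sum_(j <- s | P j) expect (F j).
Proof.
rewrite /expect exchange_big; apply: eq_bigr => a _ /=.
by rewrite mulr_sumr.
Qed.

(** Fubini by resampling: exchanging the coordinates outside [A] between two independent copies is
    an involution on pairs that preserves the product weight. *)
Lemma expect_merge (A : pred I) f :
  expect f = expect (fun a => expect (fun a' => f (ffun_merge A a a'))).
Proof.
rewrite /expect.
under [RHS]eq_bigr do rewrite mulr_sumr.
rewrite pair_bigA /=.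
pose h (u : {ffun I -> bool} * {ffun I -> bool}) :=
  (ffun_merge A u.1 u.2, ffun_merge A u.2 u.1).
have hK : involutive h.
  move=> [u v]; rewrite /h /=; congr pair; apply/ffunP => e; rewrite !ffunE;
  by case: (A e).
rewrite (reindex_inj (inv_inj hK)) /=.
rewrite -(pair_bigA _ (fun a a' => prod_wt (ffun_merge A a a') *
   (prod_wt (ffun_merge A a' a) *
     f (ffun_merge A (ffun_merge A a a') (ffun_merge A a' a))))) /=.
apply: eq_bigr => a _.
rewrite -[in LHS](mul1r (prod_wt a * f a)).
rewrite -[in LHS](expect_cst 1) /expect mulr_suml; apply: eq_bigr => a' _.
rewrite mulr1 !mulrA.
have -> : ffun_merge A (ffun_merge A a a') (ffun_merge A a' a) = a.
  by apply/ffunP => e; rewrite !ffunE; case: (A e).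
congr (_ * _); rewrite /prod_wt -!big_split; apply: eq_bigr => e _ /=.
by rewrite !ffunE; case: (A e); rewrite 1?mulrC.
Qed.

Lemma expect_indep (A : pred I) f g :
  depends_on A f -> depends_on (predC A) g ->
  expect (fun a => f a * g a) = expect f * expect g.
Proof.
move=> fA gA; rewrite (expect_merge A).
rewrite mulrC -expectZl; apply: eq_expect => a.
rewrite mulrC -expectZl; apply: eq_expect => a'.
congr (_ * _); [apply: fA|apply: gA] => e /=; rewrite ffunE.
  by move=> ->.
by move=> /negbTE ->.
Qed.

Lemma expect_coord e (g : bool -> R) :
  expect (fun a => g (a e)) = p e * g true + (1 - p e) * g false.
Proof.
have := expect_prod (fun e' b => if e' == e then g b else 1).
rewrite (eq_expect (g := fun a => g (a e))) => [->|a]; last first.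
  by rewrite (bigD1 e)//= eqxx big1 ?mulr1// => i /negbTE ->.
rewrite (bigD1 e)//= eqxx big1 ?mulr1// => i /negbTE ->; ring.
Qed.

Lemma expect_centered e : expect (centered e) = 0.
Proof. rewrite (expect_coord e (fun b => b%:R - p e)) /=; ring. Qed.

Lemma expect_centered_sqr e :
  expect (fun a => centered e a ^+ 2) = p e * (1 - p e).
Proof. rewrite (expect_coord e (fun b => (b%:R - p e) ^+ 2)) /=; ring. Qed.

Lemma depends_on_centered e (A : pred I) : A e -> depends_on A (centered e).
Proof. by move=> Ae a a' aa'; rewrite /centered aa'. Qed.

Lemma expect_centeredM e e' : e != e' ->
  expect (fun a => centered e a * centered e' a) = 0.
Proof.
move=> ee'; rewrite (expect_indep (A := pred1 e)) ?expect_centered ?mul0r//.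
  by apply: depends_on_centered; rewrite /= eqxx.
by apply: depends_on_centered; rewrite /= eq_sym.
Qed.

Lemma expect_indep_prod (J : eqType) (s : seq J) (A : J -> pred I)
    (F : J -> {ffun I -> bool} -> R) :
  uniq s -> (forall j, depends_on (A j) (F j)) ->
  (forall j j' e, A j e -> A j' e -> j = j') ->
  expect (fun a => \prod_(j <- s) F j a) = \prod_(j <- s) expect (F j).
Proof.
move=> + FA Adisj; elim: s => [|j s IH] /=.
  by move=> _; rewrite big_nil (eq_expect (g := fun=> 1)) ?expect_cst// => a;
     rewrite big_nil.
move=> /andP[js /IH {}IH]; rewrite big_cons -IH.
rewrite -(expect_indep (A := A j)) //; first by apply: eq_expect => a; rewrite big_cons.
move=> a a' aa'; apply: eq_big_seq => i si; apply: FA => e Aie; apply: aa' => /=.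
apply/negP => Aje; have ij := Adisj _ _ _ Aie Aje.
by rewrite -ij si in js.
Qed.

Hypothesis p01 : forall e, 0 <= p e <= 1.

Lemma prod_wt_ge0 a : 0 <= prod_wt a.
Proof.
apply: prodr_ge0 => e _; have := p01 e; rewrite /bernoulli_wt.
by case: (a e); lra.
Qed.

Lemma ler_expect f g : (forall a, f a <= g a) -> expect f <= expect g.
Proof.
by move=> fg; apply: ler_sum => a _; rewrite ler_wpM2l// prod_wt_ge0.
Qed.

Lemma expect_ge0 f : (forall a, 0 <= f a) -> 0 <= expect f.
Proof. by move=> f0; rewrite -(expect_cst 0) ler_expect. Qed.

Lemma ler_norm_expect f : `|expect f| <= expect (fun a => `|f a|).
Proof.
rewrite (le_trans (ler_norm_sum _ _ _))//; apply: ler_sum => a _.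
by rewrite normrM ger0_norm ?prod_wt_ge0.
Qed.

Lemma centered_bound e a : `|centered e a| <= 1.
Proof.
by rewrite /centered ler_norml; have := p01 e; case: (a e) => /=; lra.
Qed.


Lemma expR_le_sqr (x : R) : `|x| <= 2^-1 -> expR x <= 1 + x + 2 * x ^+ 2.
Proof.
rewrite ler_norml => /andP[x1 x2].
have := expR_ge1Dx (- x); rewrite expRN => H.
have e0 := expR_gt0 x.
have : (1 - x) * expR x <= 1.
  by rewrite -ler_pdivlMr// mul1r.
have h1 : 1 <= (1 + x + 2 * x ^+ 2) * (1 - x).
  have : 0 <= x ^+ 2 * (1 - 2 * x) by rewrite mulr_ge0 ?sqr_ge0//; lra.
  lra.
move=> h2; rewrite -(@ler_pM2r _ (1 - x)); last by lra.
lra.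
Qed.

(** Two regimes. For [|s| <= 1/2] the quadratic bound on [expR] is averaged, and [p (1 - p) <= 1];
    for larger [s] the exponent is already at most [|s| <= 2 s^2] pointwise. *)
Lemma expect_mgf_centered e (s : R) :
  expect (fun a => expR (s * centered e a)) <= expR (2 * s ^+ 2).
Proof.
have [s1|s1] := leP `|s| 2^-1.
  apply: (@le_trans _ _ (1 + 2 * s ^+ 2)); last exact: expR_ge1Dx.
  apply: (@le_trans _ _ (expect (fun a => 1 + (s * centered e a +
     2 * s ^+ 2 * centered e a ^+ 2)))).
    apply: ler_expect => a; rewrite addrA -[_ * _ ^+ 2 * _]mulrA -exprMn.
    apply: expR_le_sqr; rewrite normrM (le_trans _ s1)// ler_piMr//.
    exact: centered_bound.
  rewrite expectD expect_cst expectD !expectZl expect_centered mulr0 add0r.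
  rewrite expect_centered_sqr lerD2l ler_piMr//.
    by rewrite mulr_ge0 ?sqr_ge0.
  by have := p01 e; nra.
rewrite -[leRHS](expect_cst) ler_expect// => a; rewrite ler_expR.
have := centered_bound e a; have : `|s| ^+ 2 = s ^+ 2 by rewrite real_normK ?num_real.
move: s1 (ler_norm (s * centered e a)); rewrite normrM.
move: `|s| `|centered e a| (normr_ge0 s) (normr_ge0 (centered e a)) => u v; nra.
Qed.

Lemma expect_mgf (c : I -> R) :
  expect (fun a => expR (\sum_e c e * centered e a)) <= expR (2 * \sum_e c e ^+ 2).
Proof.
rewrite mulr_sumr expR_sum.
rewrite (eq_expect (g := fun a => \prod_e expR (c e * ((a e)%:R - p e)))); last first.
  by move=> a; rewrite expR_sum.
rewrite (expect_prod (fun e b => expR (c e * (b%:R - p e)))).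
apply: ler_prod => e _; have := expect_mgf_centered e (c e).
rewrite (expect_coord e (fun b => expR (c e * (b%:R - p e)))) => ->.
have := p01 e => ?.
by rewrite andbT addr_ge0 ?mulr_ge0 ?expR_ge0//; lra.
Qed.

Lemma expect_tail1 (c : I -> R) (s2 lam : R) : 0 < s2 -> 0 <= lam ->
  \sum_e c e ^+ 2 <= s2 ->
  expect (fun a => (lam < \sum_e c e * centered e a)%R%:R)
    <= expR (- (lam ^+ 2 / (8 * s2))).
Proof.
move=> s20 lam0 cs.
(* The minimizer of the Chernoff exponent [2 * t ^+ 2 * s2 - t * lam]. *)
pose t := lam / (4 * s2).
have t0 : 0 <= t by rewrite divr_ge0//; lra.
apply: (@le_trans _ _ (expR (- (t * lam)) *
   expect (fun a => expR (\sum_e (t * c e) * centered e a)))).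
  rewrite -expectZl; apply: ler_expect => a.
  have -> : \sum_e t * c e * centered e a = t * \sum_e c e * centered e a.
    by rewrite mulr_sumr; apply: eq_bigr => e _; rewrite mulrA.
  rewrite -expRD; case: ltP => h; last exact: expR_ge0.
  rewrite -[leLHS]expR0 ler_expR addrC -mulrBr mulr_ge0//; lra.
apply: (@le_trans _ _ (expR (- (t * lam)) * expR (2 * (t ^+ 2 * s2)))).
  rewrite ler_pM2l ?expR_gt0// (le_trans (expect_mgf _))// ler_expR.
  rewrite ler_pM2l//; under eq_bigr do rewrite exprMn.
  by rewrite -mulr_sumr ler_wpM2l// sqr_ge0.
rewrite -expRD ler_expR le_eqVlt; apply/orP; left; apply/eqP.
by rewrite /t; field; rewrite gt_eqF.
Qed.

Lemma expect_tail (c : I -> R) (s2 lam : R) : 0 < s2 -> 0 <= lam ->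
  \sum_e c e ^+ 2 <= s2 ->
  expect (fun a => (lam < `|\sum_e c e * centered e a|)%R%:R)
    <= 2 * expR (- (lam ^+ 2 / (8 * s2))).
Proof.
move=> s20 lam0 cs.
rewrite (_ : 2 * expR _ = expR (- (lam ^+ 2 / (8 * s2))) +
  expR (- (lam ^+ 2 / (8 * s2)))); last by ring.
have B1 := expect_tail1 s20 lam0 cs.
have cs' : \sum_e (- c e) ^+ 2 <= s2 by under eq_bigr do rewrite sqrrN.
have B2 := expect_tail1 s20 lam0 cs'.
apply: le_trans (lerD B1 B2); rewrite -expectD; apply: ler_expect => a.
have -> : \sum_e - c e * centered e a = - \sum_e c e * centered e a.
  by rewrite -sumrN; apply: eq_bigr => e _; rewrite mulNr.
rewrite lter_normr; case: (lam < _); case: (lam < _); rewrite /= ?addr0 ?add0r//.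
by rewrite lerDl.
Qed.

End BernoulliProduct.

(** * Scores and log-likelihood *)

Section Graph.
Variables (R : realType) (n : nat).
Implicit Types (g a : {ffun 'I_n * 'I_n -> bool}) (b beta t : 'I_n -> R) (i j : 'I_n).

(** Coordinates are all ordered pairs; those not above the diagonal get probability 0, so that the
    model is a product law on the whole index type and [sym_graph] recovers the graph. *)
Definition edge_p beta (e : 'I_n * 'I_n) : R :=
  if (e.1 < e.2)%N then edge_prob beta e.1 e.2 else 0.
Definition sym_graph a : {ffun 'I_n * 'I_n -> bool} :=
  [ffun e : 'I_n * 'I_n => if (e.1 < e.2)%N then a e
             else if (e.2 < e.1)%N then a (e.2, e.1) else false].
Definition upper_graph a : {ffun 'I_n * 'I_n -> bool} :=
  [ffun e : 'I_n * 'I_n => (e.1 < e.2)%N && a e].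

Definition graph_expect beta (f : {ffun 'I_n * 'I_n -> bool} -> R) : R :=
  \sum_(a | is_adj a) graph_prob beta a * f a.

Definition score g b i : R :=
  (degree g i)%:R - \sum_(j < n | j != i) logistic (b i + b j).

Lemma is_adj_irrefl g i : is_adj g -> g (i, i) = false.
Proof. by move=> /andP[/forallP/(_ i)/negbTE]. Qed.

Lemma is_adj_sym g i j : is_adj g -> g (i, j) = g (j, i).
Proof. by move=> /andP[_ /forallP/(_ i)/forallP/(_ j)/eqP]. Qed.

Lemma sym_graph_adj a : is_adj (sym_graph a).
Proof.
apply/andP; split; first by apply/forallP => i; rewrite ffunE/= ltnn.
apply/forallP => i; apply/forallP => j; rewrite !ffunE/=.
by case: ltngtP.
Qed.

Lemma sum_pairE (F : 'I_n -> 'I_n -> R) :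
  \sum_(i < n) \sum_(j < n | (i < j)%N) F i j =
  \sum_(e : 'I_n * 'I_n) (if (e.1 < e.2)%N then F e.1 e.2 else 0).
Proof.
rewrite -(pair_bigA _ (fun i j => if (i < j)%N then F i j else 0)) /=.
by apply: eq_bigr => i _; rewrite big_mkcond.
Qed.

Lemma prod_pairE (F : 'I_n -> 'I_n -> R) :
  \prod_(i < n) \prod_(j < n | (i < j)%N) F i j =
  \prod_(e : 'I_n * 'I_n) (if (e.1 < e.2)%N then F e.1 e.2 else 1).
Proof.
rewrite -(pair_bigA _ (fun i j => if (i < j)%N then F i j else 1)) /=.
by apply: eq_bigr => i _; rewrite big_mkcond.
Qed.

Lemma sum_sym_pairs (z : 'I_n -> R) (F : 'I_n -> 'I_n -> R) :
  (forall i j, F i j = F j i) ->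
  \sum_i z i * (\sum_(j < n | j != i) F i j) =
  \sum_(i < n) \sum_(j < n | (i < j)%N) (z i + z j) * F i j.
Proof.
move=> Fsym.
have -> : \sum_(i < n) \sum_(j < n | (i < j)%N) (z i + z j) * F i j =
    \sum_(i < n) \sum_(j < n | (i < j)%N) z i * F i j + \sum_(i < n) \sum_(j < n | (j < i)%N) z i * F i j.
  rewrite [X in _ = _ + X](exchange_big_dep xpredT)//= -big_split; apply: eq_bigr => i _ /=.
  rewrite -big_split; apply: eq_bigr => j _ /=.
  by rewrite mulrDl (Fsym j i).
rewrite -big_split; apply: eq_bigr => i _ /=.
rewrite mulr_sumr (bigID (fun j : 'I_n => (i < j)%N)) /=; congr (_ + _).
  by apply: eq_bigl => j; rewrite -val_eqE /=; case: ltngtP.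
by apply: eq_bigl => j; rewrite -val_eqE /=; case: ltngtP.
Qed.

(** A configuration with an edge on or below the diagonal has weight zero; on the others
    [upper_graph] and [sym_graph] are mutually inverse and match the weights. *)
Lemma graph_expectE beta f :
  graph_expect beta f = expect (edge_p beta) (f \o sym_graph).
Proof.
have wt0 a : upper_graph a != a -> prod_wt (edge_p beta) a = 0.
  move=> H; have /existsP[e He] : [exists e : 'I_n * 'I_n, ~~ (e.1 < e.2)%N && a e].
    apply: contraR H; rewrite negb_exists => /forallP H.
    apply/eqP/ffunP => e; rewrite ffunE; have := H e.
    by case: (_ < _)%N; case: (a e).
  rewrite /prod_wt (bigD1 e)//= /bernoulli_wt /edge_p.
  by case/andP: He => /negbTE -> ->; rewrite mul0r.
have wtE a : prod_wt (edge_p beta) (upper_graph a) = graph_prob beta a.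
  rewrite /prod_wt /graph_prob prod_pairE; apply: eq_bigr => -[i j] _ /=.
  by rewrite /bernoulli_wt /edge_p ffunE /=; case: (_ < _)%N; rewrite //= subr0.
rewrite /graph_expect /expect [RHS](bigID (fun a => upper_graph a == a)) /=.
rewrite [X in _ = _ + X]big1 ?addr0; last by move=> a H; rewrite wt0 ?mul0r.
rewrite [RHS](reindex_onto upper_graph sym_graph)/=; last first.
  move=> a /eqP ua; rewrite -[RHS]ua; apply/ffunP => -[i j]; rewrite !ffunE /=.
  by case: (_ < _)%N.
have symE a : is_adj a -> sym_graph (upper_graph a) = a.
  move=> aa; apply/ffunP => -[i j]; rewrite !ffunE/=; case: ltngtP => //= ij.
    by rewrite is_adj_sym.
  by rewrite (val_inj ij) is_adj_irrefl.
apply: eq_big => [a|a aa]; last by rewrite wtE symE.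
apply/idP/andP => [aa|[_ /eqP <-]]; last exact: sym_graph_adj.
by split; apply/eqP; [apply/ffunP => e; rewrite !ffunE; case: (_ < _)%N|rewrite symE].
Qed.

Lemma prob_leE beta T x :
  prob_le beta T x = graph_expect beta (fun a => (T a <= x)%R%:R).
Proof.
rewrite /prob_le /graph_expect big_mkcondr; apply: eq_bigr => a _.
by case: (_ <= _); rewrite ?mulr1 ?mulr0.
Qed.

Lemma edge_probE beta i j : edge_prob beta i j = logistic (beta i + beta j).
Proof. by []. Qed.

Lemma edge_p01 beta e : 0 <= edge_p beta e <= 1.
Proof.
rewrite /edge_p; case: (_ < _)%N; rewrite ?lexx ?ler01//.
by rewrite edge_probE (ltW (logistic_gt0 _)) ltW// logistic_lt1.
Qed.

Lemma degreeE g i : (degree g i)%:R = \sum_(j < n | j != i) (g (i, j))%:R :> R.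
Proof. by rewrite /degree natr_sum. Qed.

Lemma scoreE g b i :
  score g b i = \sum_(j < n | j != i) ((g (i, j))%:R - logistic (b i + b j)).
Proof. by rewrite /score degreeE -sumrB. Qed.

Lemma sum_score g b (z : 'I_n -> R) : is_adj g ->
  \sum_i z i * score g b i =
  \sum_(i < n) \sum_(j < n | (i < j)%N) (z i + z j) * ((g (i, j))%:R - logistic (b i + b j)).
Proof.
move=> ga; rewrite -sum_sym_pairs => [|i j].
  by apply: eq_bigr => i _; rewrite scoreE.
by rewrite is_adj_sym// addrC [b i + _]addrC [in RHS]addrC.
Qed.

Lemma loglikE g b : is_adj g ->
  loglik g b = \sum_(i < n) \sum_(j < n | (i < j)%N)
    ((b i + b j) * (g (i, j))%:R - softplus (b i + b j)).
Proof.
move=> ga; rewrite /loglik.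
under eq_bigr do rewrite degreeE.
rewrite (sum_sym_pairs b) => [|i j]; last by rewrite is_adj_sym.
by rewrite -sumrB; apply: eq_bigr => i _; rewrite -sumrB.
Qed.

(** The log-likelihood is a linear form minus a sum of [softplus], so the remainder after the linear
    term is exactly a sum of Bregman divergences. Dropping them gives the tangent bound, bounding
    them the quadratic minorant. *)
Lemma loglik_bregman g b t : is_adj g ->
  loglik g (b \+ t) = loglik g b + \sum_i t i * score g b i
   - \sum_(i < n) \sum_(j < n | (i < j)%N) (softplus (b i + b j + (t i + t j))
        - softplus (b i + b j) - logistic (b i + b j) * (t i + t j)).
Proof.
move=> ga; rewrite !loglikE// sum_score// -big_split -sumrB; apply: eq_bigr => i _.
rewrite /= -big_split -sumrB; apply: eq_bigr => j _ /=.
by rewrite [b i + t i + _]addrACA; ring.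
Qed.

Lemma loglik_tangent g b b' : is_adj g ->
  loglik g b' <= loglik g b + \sum_i (b' i - b i) * score g b i.
Proof.
move=> ga; pose t i := b' i - b i.
have E : b' = b \+ t by apply/funext => i; rewrite /t /= addrC subrK.
rewrite [in leLHS]E loglik_bregman//.
rewrite lerBlDr lerDl sumr_ge0// => i _; rewrite sumr_ge0// => j _.
by have /andP[] := softplus_bregman (b i + b j) (t i + t j).
Qed.

Lemma loglik_lower g b t : is_adj g ->
  loglik g b + \sum_i t i * score g b i
   - \sum_(i < n) \sum_(j < n | (i < j)%N) 2^-1 * (logistic_var (b i + b j) * expR `|t i + t j|) * (t i + t j) ^+ 2
   <= loglik g (b \+ t).
Proof.
move=> ga; rewrite loglik_bregman// lerB// ler_sum// => i _.
rewrite ler_sum// => j _.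
by have /andP[] := softplus_bregman (b i + b j) (t i + t j).
Qed.

Lemma loglik_le0 g b : is_adj g -> loglik g b <= 0.
Proof.
move=> ga; rewrite loglikE//; apply: sumr_le0 => i _; apply: sumr_le0 => j _.
rewrite subr_le0; case: (g _); rewrite ?mulr1 ?mulr0.
  rewrite -[leLHS]expRK ler_ln ?posrE ?expR_gt0 ?expR_add1_gt0// lerDr//.
by rewrite -[leLHS]ln1 ler_ln ?posrE ?expR_add1_gt0// lerDl expR_ge0.
Qed.

(** The edge between [i] and [j] enters both scores, hence carries the coefficient [z i + z j] in
    the Hoeffding bound. *)
Lemma score_tail beta (z : 'I_n -> R) (s2 lam : R) : 0 < s2 -> 0 <= lam ->
  \sum_(i < n) \sum_(j < n | (i < j)%N) (z i + z j) ^+ 2 <= s2 ->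
  graph_expect beta (fun g => (lam < `|\sum_i z i * score g beta i|)%R%:R)
    <= 2 * expR (- (lam ^+ 2 / (8 * s2))).
Proof.
move=> s20 lam0 hs; rewrite graph_expectE.
pose c (e : 'I_n * 'I_n) := if (e.1 < e.2)%N then z e.1 + z e.2 else 0.
have hc : \sum_e c e ^+ 2 <= s2.
  rewrite (le_trans _ hs)// sum_pairE ler_sum// => e _; rewrite /c.
  by case: ifP; rewrite ?expr0n.
apply: le_trans (expect_tail (edge_p01 beta) s20 lam0 hc).
apply: ler_expect => [e|a]; first exact: edge_p01.
rewrite /=; suff -> : \sum_i z i * score (sym_graph a) beta i = \sum_e c e * centered (edge_p beta) e a.
  by [].
rewrite sum_score ?sym_graph_adj// sum_pairE; apply: eq_bigr => -[i j] _ /=.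
rewrite /c /centered /edge_p ffunE /=; case: ifP => ij; last by rewrite mul0r.
by rewrite ij.
Qed.

End Graph.

(** * Sup-norm bounds and constrained maximizers *)

Lemma card_lt_ord (n r : nat) : (#|[pred i : 'I_n | (i < r)%N]| <= r)%N.
Proof.
rewrite cardE size_filter -enumT.
rewrite (eq_count (a2 := preim val (fun k => (k < r)%N))) => [|i]; last by rewrite !inE.
rewrite -count_map val_enum_ord -size_filter -[leqRHS](size_iota 0 r).
apply: uniq_leq_size; first by rewrite filter_uniq// iota_uniq.
by move=> x; rewrite mem_filter => /andP[xr _]; rewrite mem_iota leq0n add0n.
Qed.

Section SupBound.
Variables (R : realType) (n r : nat) (w : 'I_n -> 'I_n -> R) (m W T : R).
Hypotheses (m0 : 0 < m) (T0 : 0 <= T) (rn : (4 * r.+2 <= n)%N).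
Hypothesis wb : forall i j, j != i -> m <= w i j <= W.

(** With [M = y i] the maximum, row [i] has nonnegative terms only, so its bound forces most [y j]
    to be near [- M]. At such a [k] with [r <= k], either [y k >= 0] and [M] is small at once, or
    row [k] is a sum of terms near [- 2 M], which its lower bound [- T] allows only for small
    [M]. *)
Lemma max_coord_bound (y : 'I_n -> R) (i : 'I_n) :
  (forall j, `|y j| <= y i) ->
  \sum_(j | j != i) w i j * (y i + y j) <= T ->
  (forall k : 'I_n, (r <= k)%N -> y k < 0 -> - T <= \sum_(j | j != k) w k j * (y k + y j)) ->
  y i * (m ^+ 2 * n%:R) <= 4 * W * T.
Proof.
move=> ymax rowi rowk.
have M0 : 0 <= y i by rewrite (le_trans _ (ymax i)).
set M := y i in ymax rowi M0 *.
have z0 j : 0 <= M + y j by have := ymax j; rewrite ler_norml => /andP[]; lra.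
have n8 : (8 <= n)%N by clear -rn; lia.
have nR : (8 : R) <= n%:R by rewrite ler_nat.
have [i' i'i] : exists i' : 'I_n, i' != i.
  have n1 : (1 < n)%N by rewrite (leq_trans _ n8).
  have n0' : (0 < n)%N by rewrite (leq_trans _ n8).
  case: (eqVneq i (Ordinal n0')) => [->|]; first by exists (Ordinal n1).
  by exists (Ordinal n0'); rewrite eq_sym.
have mW : m <= W by have /andP[h1 h2] := wb i'i; exact: le_trans h1 h2.
have sz : m * (\sum_(j | j != i) (M + y j)) <= T.
  rewrite mulr_sumr (le_trans _ rowi)// ler_sum// => j ji.
  by have /andP[h _] := wb ji; rewrite ler_wpM2r.
(* Averaging over the indices other than [i] and those below [r]: they make up at least half of all,
   whence the factor 2. *)
have [k [rk ki zk]] : exists k : 'I_n, [/\ (r <= k)%N, k != i & (M + y k) * (m * n%:R) <= 2 * T].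
  apply: contrapT => H.
  have H' (k : 'I_n) : (r <= k)%N && (k != i) -> 2 * T / (m * n%:R) < M + y k.
    move=> /andP[rk ki]; rewrite ltNge; apply/negP => h; apply: H; exists k; split => //.
    by rewrite -ler_pdivlMr ?mulr_gt0//; lra.
  pose A := [pred k : 'I_n | (r <= k)%N && (k != i)].
  have cardA : (n <= 2 * #|A|)%N.
    have cC : (#|[predC A]| <= r.+1)%N.
      apply: (@leq_trans #|[predU pred1 i & [pred k : 'I_n | (k < r)%N]]|).
        apply/subset_leq_card/fintype.subsetP => k; rewrite !inE negb_and -ltnNge negbK.
        by rewrite orbC.
      apply: leq_trans (leq_addr #|[predI pred1 i & [pred k : 'I_n | (k < r)%N]]| _) _.
      by rewrite cardUI card1 add1n ltnS card_lt_ord.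
    have := cardC A; rewrite card_ord => e.
    move: rn cC e; set a := #|A|; set b := #|_|; rewrite !mulnS; clear; lia.
  have A0 : (0 < #|A|)%N by move: cardA n8; case: #|A| => //; lia.
  have : T < m * (\sum_(j | j != i) (M + y j)).
    apply: (@lt_le_trans _ _ (m * (\sum_(j in A) (M + y j)))); last first.
      rewrite ler_pM2l// [leRHS](bigID (fun j : 'I_n => (r <= j)%N))/=.
      rewrite (eq_bigl (fun j : 'I_n => (j != i) && (r <= j)%N)); last first.
        by move=> j; rewrite !inE andbC.
      by rewrite lerDl sumr_ge0.
    apply: (@le_lt_trans _ _ (m * (\sum_(j in A) 2 * T / (m * n%:R)))).
      rewrite sumr_const -mulr_natl.
      rewrite (_ : m * _ = T * ((2 * #|A|)%:R / n%:R)); last first.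
        by rewrite natrM; field; rewrite !gt_eqF//; lra.
      by rewrite ler_peMr// ler_pdivlMr ?mul1r ?ler_nat//; lra.
    rewrite ltr_pM2l//; case/card_gt0P: A0 => k0 k0A.
    rewrite [ltLHS](bigD1 k0)//= [ltRHS](bigD1 k0)//= ltr_leD//.
      by apply: H'; exact: k0A.
    by rewrite ler_sum// => j /andP[jA _]; apply/ltW/H'; exact: jA.
  by rewrite ltNge sz.
have W0 : 0 < W by apply: lt_le_trans m0 mW.
have n0 : 0 < n%:R :> R by lra.
have [yk|yk] := leP 0 (y k).
  have h1 : M * (m * n%:R) <= 2 * T.
    by rewrite (le_trans _ zk)// ler_wpM2r ?lerDl// ltW// mulr_gt0.
  have h2 : m * (M * (m * n%:R)) <= m * (2 * T) by rewrite ler_pM2l.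
  have h3 : m * (2 * T) <= W * (2 * T) by rewrite ler_wpM2r// mulr_ge0.
  have h4 : 0 <= W * T by rewrite mulr_ge0// ltW.
  by rewrite expr2; lra.
have := rowk k rk yk.
(* For [j != i] the summand is split as [y k + y j = (M + y k) + (M + y j) - 2 M]; for [j = i],
   where [y i = M], the last two terms are both replaced by 0. *)
pose z' j := if j == i then 0 else M + y j.
have z'0 j : 0 <= z' j by rewrite /z'; case: eqP.
have -> : \sum_(j | j != k) w k j * (y k + y j) =
    \sum_(j | j != k) w k j * ((M + y k) + z' j)
    - \sum_(j | j != k) w k j * (2 * M * (j != i)%:R).
  rewrite -sumrB; apply: eq_bigr => j _; rewrite /z'.
  by case: eqP => [->|_] /=; rewrite -mulrBr; congr (_ * _); rewrite /M; ring.
have up : \sum_(j | j != k) w k j * ((M + y k) + z' j) <=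
   W * ((M + y k) * n%:R + \sum_(j | j != i) (M + y j)).
  apply: (@le_trans _ _ (\sum_(j | j != k) W * ((M + y k) + z' j))).
    rewrite ler_sum// => j jk; have /andP[_ h] := wb jk.
    by rewrite ler_wpM2r// addr_ge0.
  rewrite -mulr_sumr ler_pM2l//.
  apply: (@le_trans _ _ (\sum_j ((M + y k) + z' j))).
    by rewrite [leRHS](bigD1 k)//= lerDr addr_ge0.
  rewrite big_split /= sumr_const card_ord -[_ *+ n]mulr_natr lerD2l.
  rewrite (bigD1 i)//= {1}/z' eqxx add0r ler_sum// => j /negbTE ji.
  by rewrite /z' ji.
have lo : 2 * M * m * (n%:R - 2) <= \sum_(j | j != k) w k j * (2 * M * (j != i)%:R).
  apply: (@le_trans _ _ (\sum_(j | j != k) m * (2 * M * (j != i)%:R))); last first.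
    rewrite ler_sum// => j jk; have /andP[h _] := wb jk.
    by rewrite ler_wpM2r// !mulr_ge0.
  rewrite -mulr_sumr -mulr_sumr.
  have -> : \sum_(j < n | j != k) (j != i)%:R = n%:R - 2 :> R.
    have : \sum_(j < n) 1 = n%:R :> R by rewrite sumr_const card_ord.
    rewrite (bigD1 k)//= (bigD1 i)/=; last by rewrite eq_sym.
    rewrite [X in _ -> X = _](bigD1 i)/=; last by rewrite eq_sym.
    rewrite eqxx /= mulr0n [X in _ -> _ + X = _](eq_bigr (fun=> 1)); last by move=> j /andP[_ ->].
    lra.
  by apply: le_of_eq; ring.
have h1 : m * (W * ((M + y k) * n%:R)) <= W * (2 * T).
  by rewrite (_ : m * _ = W * ((M + y k) * (m * n%:R))) ?ler_pM2l//; ring.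
have h2 : m * (W * \sum_(j | j != i) (M + y j)) <= W * T.
  by rewrite mulrCA ler_pM2l.
have h3 : m * T <= W * T by rewrite ler_wpM2r.
have n4 : 0 <= n%:R - 4 :> R by lra.
have h4 := mulr_ge0 (mulr_ge0 M0 (sqr_ge0 m)) n4.
move=> h5.
set S1 := \sum_(j | _) _ * (_ + z' _) in up h5.
set S2 := \sum_(j | _) _ * (2 * _ * _) in lo h5.
set S3 := \sum_(j | _) _ in up h2.
have h6 : m * (2 * M * m * (n%:R - 2)) <= m * (T + W * ((M + y k) * n%:R + S3)).
  by rewrite ler_pM2l//; lra.
rewrite expr2 in h4 *; lra.
Qed.

(** The rows are one-sided because a maximizer over a box satisfies only inequalities at its active
    faces. Rows below [r] are used only when they carry the largest coordinate, which leaves room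
    for fixed or tied coordinates. *)
Lemma sup_norm_bound (y : 'I_n -> R) :
  (forall i, (forall j, `|y j| <= y i) -> 0 < y i ->
    \sum_(j | j != i) w i j * (y i + y j) <= T) ->
  (forall i, (forall j, `|y j| <= - y i) -> y i < 0 ->
    - T <= \sum_(j | j != i) w i j * (y i + y j)) ->
  (forall k : 'I_n, (r <= k)%N -> y k < 0 ->
    - T <= \sum_(j | j != k) w k j * (y k + y j)) ->
  (forall k : 'I_n, (r <= k)%N -> 0 < y k ->
    \sum_(j | j != k) w k j * (y k + y j) <= T) ->
  forall j, `|y j| * (m ^+ 2 * n%:R) <= 4 * W * T.
Proof.
move=> maxp maxn rown rowp j.
case: (@arg_maxP _ _ _ j xpredT (fun i => `|y i|) isT) => i _ ymax.
have {}ymax k : `|y k| <= `|y i| by exact: ymax.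
have K0 : 0 <= m ^+ 2 * n%:R by rewrite mulr_ge0 ?sqr_ge0.
apply: (@le_trans _ _ (`|y i| * (m ^+ 2 * n%:R))); first by rewrite ler_wpM2r.
case: (ltgtP (y i) 0) => yi.
- rewrite ltr0_norm//.
  have sN k : \sum_(j | j != k) w k j * (- y k + - y j) =
      - \sum_(j | j != k) w k j * (y k + y j).
    by rewrite -sumrN; apply: eq_bigr => l _; rewrite -mulrN opprD.
  apply: (@max_coord_bound (fun k => - y k)).
  + by move=> k; rewrite normrN (le_trans (ymax k))// ltr0_norm.
  + rewrite sN lerNl maxn// => k; rewrite (le_trans (ymax k))// ltr0_norm//.
  + by move=> k rk yk; rewrite sN lerN2 rowp//; lra.
- rewrite gtr0_norm//; apply: max_coord_bound => //.
  + by move=> k; rewrite (le_trans (ymax k))// gtr0_norm.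
  + by apply: maxp => // k; rewrite (le_trans (ymax k))// gtr0_norm.
- rewrite yi normr0.
  apply: (@max_coord_bound (fun=> 0) i).
  + by move=> k; rewrite normr0.
  + by rewrite big1// => k _; rewrite addr0 mulr0.
  + by move=> k _; rewrite ltxx.
Qed.

End SupBound.

Section ContinuousSums.
Variables (R : realType) (T : topologicalType).
Implicit Types f g : T -> R.

Lemma continuous_add f g :
  continuous f -> continuous g -> continuous (fun x => f x + g x).
Proof. by move=> cf cg x; apply: cvgD; [exact: cf|exact: cg]. Qed.

Lemma continuous_sub f g :
  continuous f -> continuous g -> continuous (fun x => f x - g x).
Proof. by move=> cf cg x; apply: cvgB; [exact: cf|exact: cg]. Qed.

Lemma continuous_cst_add (c : R) f : continuous f -> continuous (fun x => c + f x).
Proof. by move=> cf; apply: continuous_add => // x; exact: cvg_cst. Qed.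

Lemma continuous_mul_cst (c : R) f : continuous f -> continuous (fun x => f x * c).
Proof. by move=> cf x; apply: cvgM; [exact: cf|exact: cvg_cst]. Qed.

Lemma continuous_sumr (I : Type) (s : seq I) (P : pred I) (F : I -> T -> R) :
  (forall i, continuous (F i)) -> continuous (fun x => \sum_(i <- s | P i) F i x).
Proof.
by move=> cF; apply: continuous_big => //; exact: add_continuous.
Qed.

End ContinuousSums.

(** * Maximizers over a compact box around the true parameter *)

Section MLE.
Variables (R : realType) (n : nat).
Implicit Types (g : {ffun 'I_n * 'I_n -> bool}) (b beta d : 'I_n -> R).

(** The tangent space of either null set. With [tied = false] and [r = 0] it is the whole space, so
    that the free estimator is a special case of the restricted one. *)
Definition dirs (tied : bool) (r : nat) : set ('I_n -> R) :=
  [set t | if tied then forall i j : 'I_n, (i < r)%N -> (j < r)%N -> t i = t j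
           else forall i : 'I_n, (i < r)%N -> t i = 0].

(** If the slope were positive, the quadratic minorant of the likelihood would exceed [loglik g b]
    for a short enough step. *)
Lemma score_dir_le0 g b d (h0 : R) : is_adj g -> 0 < h0 ->
  (forall h, 0 < h -> h <= h0 -> loglik g (b \+ (fun i => h * d i)) <= loglik g b) ->
  \sum_i d i * score g b i <= 0.
Proof.
move=> ga h00 H; rewrite leNgt; apply/negP => s0.
set s := \sum_i _ in s0.
pose S := \sum_(i < n) \sum_(j < n | (i < j)%N)
  2^-1 * (logistic_var (b i + b j) * expR `|d i + d j|) * (d i + d j) ^+ 2.
have S0 : 0 <= S.
  rewrite sumr_ge0// => i _; rewrite sumr_ge0// => j _.
  by rewrite mulr_ge0 ?sqr_ge0// mulr_ge0// mulr_ge0 ?expR_ge0 ?logistic_var_ge0.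
(* [h <= 1] bounds the curvature by [S] uniformly, and [h * (S + 1) < s] makes the linear gain
   win. *)
pose h := Num.min (Num.min h0 1) (s / (S + 1) / 2).
have h_gt0 : 0 < h by rewrite !lt_min h00 ltr01 !divr_gt0//; lra.
have hh0 : h <= h0 by rewrite !ge_min lexx.
have h1 : h <= 1 by rewrite !ge_min lexx orbT.
have hs : h * (S + 1) < s.
  rewrite -ltr_pdivlMr; last by lra.
  apply: (@le_lt_trans _ _ (s / (S + 1) / 2)); first by rewrite !ge_min lexx orbT.
  have : 0 < s / (S + 1) by rewrite divr_gt0//; lra.
  lra.
have := H h h_gt0 hh0.
have := loglik_lower b (fun i => h * d i) ga.
have -> : \sum_i h * d i * score g b i = h * s.
  by rewrite mulr_sumr; apply: eq_bigr => i _; rewrite mulrA.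
set Q := \sum_(i < n) _.
have QS : Q <= h ^+ 2 * S.
  rewrite mulr_sumr ler_sum// => i _; rewrite mulr_sumr ler_sum// => j _.
  rewrite -mulrDr exprMn mulrCA.
  rewrite ler_wpM2l ?sqr_ge0// ler_wpM2r ?sqr_ge0// ler_wpM2l//.
  rewrite ler_wpM2l ?logistic_var_ge0//.
  rewrite ler_expR normrM gtr0_norm// ler_piMl//.
move=> B1 B2.
have : h * s <= h ^+ 2 * S by lra.
have : h * (h * (S + 1)) < h * s by rewrite ltr_pM2l.
rewrite expr2; have := mulr_gt0 h_gt0 h_gt0; lra.
Qed.

Lemma continuous_softplus : continuous (@softplus R).
Proof.
move=> x; apply: differentiable_continuous; apply/derivable1_diffP.
by case: (is_derive_softplus x).
Qed.

(** For some graphs, such as the empty one, the likelihood has no maximizer on the whole space;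
    compactness of the box always provides one, to be shown interior for typical graphs. *)
Lemma exists_box_max g beta tied r : exists b,
  [/\ dirs tied r (fun i => b i - beta i), (forall i, `|b i - beta i| <= 2^-1) &
    forall b', dirs tied r (fun i => b' i - beta i) ->
      (forall i, `|b' i - beta i| <= 2^-1) -> loglik g b' <= loglik g b].
Proof.
pose box := [set v : 'rV[R]_n | forall i, `[- 2^-1, 2^-1]%classic (v ord0 i)].
have cbox : compact box by apply: (@rV_compact R n (fun=> `[- 2^-1, 2^-1]%classic)) => i; exact: segment_compact.
pose V := [set v : 'rV[R]_n | dirs tied r (fun i => v ord0 i)].
have cV : closed V.
  have cc i : continuous (fun v : 'rV[R]_n => v ord0 i) by exact: coord_continuous.
  rewrite /V /dirs; clear V; case: tied.
    rewrite (_ : mkset _ = \bigcap_(p in [set p : 'I_n * 'I_n | (p.1 < r)%N /\ (p.2 < r)%N])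
       [set v : 'rV[R]_n | v ord0 p.1 = v ord0 p.2]); last first.
      apply/seteqP; split => v /= H; first by move=> [i j] /= [ir jr]; exact: H.
      by move=> i j ir jr; exact: (H (i, j)).
    apply: closed_bigI => -[i j] _ /=.
    rewrite (_ : mkset _ = (fun v : 'rV[R]_n => v ord0 i - v ord0 j) @^-1` [set 0]); last first.
      apply/seteqP; split => v /=; first by move=> ->; rewrite subrr.
      by move/eqP; rewrite subr_eq0 => /eqP.
    apply: preimage_closed => [v _|]; last exact: closed_eq.
    by apply: continuous_sub; exact: cc.
  rewrite (_ : mkset _ = \bigcap_(i in [set i : 'I_n | (i < r)%N])
       [set v : 'rV[R]_n | v ord0 i = 0]); last first.
    by apply/seteqP; split => v /= H i ir; exact: H.
  apply: closed_bigI => i _.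
  apply: (@preimage_closed _ _ (fun v : 'rV[R]_n => v ord0 i) [set 0]); last exact: closed_eq.
  by move=> v _; exact: cc.
have cA : compact (V `&` box).
  by apply: (subclosed_compact _ cbox) => [|v []//]; apply: closedI => //; exact: compact_closed.
pose L (v : 'rV[R]_n) := loglik g (fun i => beta i + v ord0 i).
have cL : continuous L.
  have cc i : continuous (fun v : 'rV[R]_n => beta i + v ord0 i).
    by apply: continuous_cst_add; exact: coord_continuous.
  apply: continuous_sub; first by apply: continuous_sumr => i; apply: continuous_mul_cst.
  apply: continuous_sumr => i; apply: continuous_sumr => j v.
  apply: (@continuous_comp _ _ _ (fun v : 'rV[R]_n => beta i + v ord0 i + (beta j + v ord0 j)) (@softplus R)).
    by apply: continuous_add; exact: cc.
  exact: continuous_softplus.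
have A0 : (V `&` box) !=set0.
  exists 0; split; last by move=> i /=; rewrite mxE in_itv/=; apply/andP; split; lra.
  by rewrite /V /dirs /=; case: (tied) => *; rewrite !mxE.
have [v vA vmax] := EVT_max_rV A0 cA (continuous_subspaceT cL).
have vE i : beta i + v ord0 i - beta i = v ord0 i by rewrite addrC addKr.
move: vA; rewrite inE => -[vV vbox].
exists (fun i => beta i + v ord0 i); split.
- by rewrite (_ : (fun i => _) = (fun i => v ord0 i)) //; apply/funext.
- by move=> i; rewrite vE ler_norml; have := vbox i; rewrite /= in_itv.
move=> b' Vb' bb'; have := vmax (\row_i (b' i - beta i)).
rewrite /L (_ : (fun i => beta i + _) = b'); last first.
  by apply/funext => i; rewrite mxE addrC subrK.
apply; rewrite inE; split.
  rewrite /V /= (_ : (fun i => _) = (fun i => b' i - beta i)) //.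
  by apply/funext => i; rewrite mxE.
by move=> i; rewrite /= mxE in_itv/= -ler_norml.
Qed.

End MLE.

(** * Consistency of the maximum likelihood estimators *)

Section Consistency.
Variables (R : realType) (n : nat).
Implicit Types (g : {ffun 'I_n * 'I_n -> bool}) (b beta d : 'I_n -> R).

(** Slopes chosen pair by pair make the score equations exactly linear in [b - beta], with weights
    comparable to the variances: this is the system fed to [sup_norm_bound]. *)
Lemma score_slopes g b beta (m : R) : (forall i, `|b i - beta i| <= m) ->
  exists w : 'I_n -> 'I_n -> R,
   [/\ forall i j, logistic (b i + b j) - logistic (beta i + beta j) =
         w i j * ((b i - beta i) + (b j - beta j)),
      forall i j, logistic_var (beta i + beta j) * expR (- (2 * m)) <= w i j
         <= logistic_var (beta i + beta j) * expR (2 * m) &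
      forall i, score g b i = score g beta i
         - \sum_(j | j != i) w i j * ((b i - beta i) + (b j - beta j))].
Proof.
move=> bm.
have H (p : 'I_n * 'I_n) : exists w : R,
    logistic (b p.1 + b p.2) - logistic (beta p.1 + beta p.2) =
         w * ((b p.1 - beta p.1) + (b p.2 - beta p.2)) /\
    logistic_var (beta p.1 + beta p.2) * expR (- (2 * m)) <= w
         <= logistic_var (beta p.1 + beta p.2) * expR (2 * m).
  have [w [w1 w2 w3]] := logistic_slope (beta p.1 + beta p.2)
    ((b p.1 - beta p.1) + (b p.2 - beta p.2)).
  have hm : `|b p.1 - beta p.1 + (b p.2 - beta p.2)| <= 2 * m.
    by rewrite (le_trans (ler_normD _ _))// mulr_natl mulr2n lerD.
  exists w; split; first by rewrite -w1; congr (logistic _ - _); ring.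
  apply/andP; split.
    by rewrite (le_trans _ w2)// ler_wpM2l ?logistic_var_ge0// ler_expR lerN2.
  by rewrite (le_trans w3)// ler_wpM2l ?logistic_var_ge0// ler_expR.
have [w Hw] := choice H.
exists (fun i j => w (i, j)); split.
- by move=> i j; have [] := Hw (i, j).
- by move=> i j; have [] := Hw (i, j).
move=> i; rewrite !scoreE -sumrB; apply: eq_bigr => j _.
by have [/= <- _] := Hw (i, j); ring.
Qed.

Variables (tied : bool) (r : nat) (g : {ffun 'I_n * 'I_n -> bool}) (beta : 'I_n -> R).
Variables (B C D : R).
Hypotheses (ga : is_adj g) (B0 : 0 < B) (C0 : 0 < C) (D0 : 0 <= D).
Hypothesis rn : (4 * r.+2 <= n)%N.
Hypothesis vb : forall i j, j != i ->
  B^-1 <= logistic_var (beta i + beta j) <= C^-1.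
Hypothesis sD : forall i, `|score g beta i| <= D.

(** The value of [4 W T / (m^2 n)] from [sup_norm_bound] at [m = expR (-1) / B], [W = expR 1 / C]
    and [T = r.+1%:R * D]. *)
Definition mle_radius : R := 4 * expR 1 ^+ 3 * r.+1%:R * B ^+ 2 * D / (C * n%:R).

Definition is_mle (b : 'I_n -> R) : Prop :=
  [/\ dirs tied r (fun i => b i - beta i),
    forall i, `|b i - beta i| <= mle_radius,
    forall k : 'I_n, (r <= k)%N -> score g b k = 0,
    tied -> \sum_(i < n | (i < r)%N) score g b i = 0 &
    forall b', dirs tied r (fun i => b' i - beta i) -> loglik g b' <= loglik g b].

Lemma dirs_add t d (h : R) :
  dirs tied r t -> dirs tied r d -> dirs tied r (fun i : 'I_n => t i + h * d i).
Proof.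
rewrite /dirs /=; case: (tied) => Ht Hd.
  by move=> i j ir jr; rewrite (Ht _ _ ir jr) (Hd _ _ ir jr).
by move=> i ir; rewrite Ht// Hd// mulr0 addr0.
Qed.

(** The coordinate of [b - beta] of largest modulus can always be moved towards 0 inside the box,
    which yields just the one-sided row inequalities of [sup_norm_bound]. The resulting radius is
    below the half-width of the box, so no face is active, the first-order conditions are
    equalities, and concavity makes the box maximizer global. *)
Lemma exists_mle : mle_radius < 2^-1 -> exists b, is_mle b.
Proof.
move=> rad2.
have n0 : 0 < n%:R :> R by rewrite ltr0n; clear -rn; lia.
have [b [bd b2 bmax]] := exists_box_max g beta tied r.
pose y i := b i - beta i.
(* b + h d stays in the box when d only pushes away from the active faces *)
have kkt d : dirs tied r d -> (forall i, -1 <= d i <= 1) ->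
    (exists2 e : R, 0 < e & forall i, (d i != 0 -> - 2^-1 <= y i + e * d i <= 2^-1)) ->
    \sum_i d i * score g b i <= 0.
  move=> Hd d1 [e e0 He]; apply: (score_dir_le0 (h0 := e)) => // h h0 he.
  apply: bmax.
    rewrite (_ : (fun i => _) = (fun i => y i + h * d i)); first exact: dirs_add.
    by apply/funext => i /=; rewrite /y addrAC.
  move=> i /=; have [di0|di0] := eqVneq (d i) 0.
    by rewrite di0 mulr0 addr0.
  have /andP[H1 H2] := He i di0; have := b2 i; rewrite !ler_norml => /andP[H3 H4].
  rewrite [b i + _ - _]addrAC -/(y i) in H3 H4 *.
  have [ds|ds] := leP 0 (d i).
    have := ler_wpM2r ds he; have := mulr_ge0 (ltW h0) ds; lra.
  have ds' : 0 <= - d i by lra.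
  have := ler_wpM2r ds' he; have := mulr_ge0 (ltW h0) ds'; lra.
have ytied : tied -> forall i j : 'I_n, (i < r)%N -> (j < r)%N -> y i = y j.
  by move=> t; move: bd; rewrite /dirs /= t.
(* [c] is a class of coordinates moved together, a single free index or the tied block; [s] is the
   sign of the move, and [s * y k < 2^-1] says that the face met in that direction is inactive. *)
have push (c : pred 'I_n) k (s : R) : dirs tied r (fun i => (c i)%:R : R) -> c k ->
    (forall i, c i -> y i = y k) -> s = 1 \/ s = -1 -> s * y k < 2^-1 ->
    s * \sum_(i | c i) score g b i <= 0.
  move=> dc ck yc s1 yk.
  rewrite mulr_sumr big_mkcond (eq_bigr (fun i => s * (c i)%:R * score g b i)) => [|i _]; last first.
    by case: (c i); rewrite ?mulr1 ?mulr0 ?mul0r.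
  apply: kkt.
  - move: dc; rewrite /dirs /=; case: (tied) => H => [i j ir jr|i ir]; first by rewrite (H i j).
    by rewrite H// mulr0.
  - by move=> i; case: (c i); case: s1 => ->; rewrite ?mulr1 ?mulr0; lra.
  - exists (2^-1 - s * y k) => [|i]; first by lra.
    case ci: (c i); rewrite ?mulr1 ?mulr0 ?eqxx// yc// => _.
    by have := b2 k; rewrite -/(y k) ler_norml; case: s1 yk => ->; lra.
have single (k : 'I_n) s : (r <= k)%N -> s = 1 \/ s = -1 -> s * y k < 2^-1 ->
    s * score g b k <= 0.
  move=> rk; have := @push (pred1 k) k s; rewrite big_pred1_eq /= eqxx; apply=> // [|i /eqP -> //].
  have ne (i : 'I_n) : (i < r)%N -> (i == k) = false.
    by move=> ir; apply/negbTE; rewrite -val_eqE /= neq_ltn (leq_trans ir rk).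
  by rewrite /dirs /=; case: (tied) => [i j ir jr|i ir]; rewrite !ne.
have block (k : 'I_n) s : tied -> (k < r)%N -> s = 1 \/ s = -1 -> s * y k < 2^-1 ->
    s * \sum_(i < n | (i < r)%N) score g b i <= 0.
  move=> t kr; apply: (push (fun i : 'I_n => (i < r)%N)) => // [|i ir]; last exact: ytied.
  by rewrite /dirs /= t => i j -> ->.
have [w [w1 w2 w3]] := score_slopes g b2.
have wb i j : j != i -> expR (-1) * B^-1 <= w i j <= expR 1 * C^-1.
  move=> ji; have /andP[v1 v2] := vb ji; have /andP[u1 u2] := w2 i j.
  rewrite (_ : 2 * 2^-1 = 1) in u1 u2; last by field.
  apply/andP; split; [apply: le_trans u1|apply: (le_trans u2)].
    by rewrite mulrC ler_wpM2r ?expR_ge0.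
  by rewrite mulrC ler_wpM2l ?expR_ge0.
have w0 i j : 0 <= w i j.
  by have /andP[+ _] := w2 i j; apply: le_trans; rewrite mulr_ge0 ?expR_ge0 ?logistic_var_ge0.
have m0 : 0 < expR (-1) * B^-1 by rewrite mulr_gt0 ?invr_gt0 ?expR_gt0.
(* Large enough both for one score, at most [D], and for the sum over the tied block, at most
   [r%:R * D]. *)
pose T := r.+1%:R * D.
have TE : T = r%:R * D + D by rewrite /T -[r.+1]addn1 natrD mulrDl mul1r.
have DT : D <= T by rewrite ler_peMl// ler1n.
have T0 : 0 <= T by apply: le_trans DT.
have sD1 i : score g beta i <= D by have := sD i; rewrite ler_norml => /andP[].
have sD2 i : - D <= score g beta i by have := sD i; rewrite ler_norml => /andP[].
have cardr : (#|[pred i : 'I_n | (i < r)%N]|%:R * D <= r%:R * D).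
  by rewrite ler_wpM2r// ler_nat card_lt_ord.
have w3' k : score g b k = score g beta k - \sum_(j | j != k) w k j * (y k + y j) by exact: w3.
have sco s k : s = 1 \/ s = -1 -> s * score g beta k <= D.
  by case=> ->; have := sD1 k; have := sD2 k; lra.
have rowmax s i : s = 1 \/ s = -1 -> (forall j, `|y j| <= s * y i) -> 0 < s * y i ->
    s * (\sum_(j | j != i) w i j * (y i + y j)) <= T.
  move=> s1 imax yi.
  have s1' : - s = 1 \/ - s = -1 by case: s1 => ->; [right|left]; rewrite ?opprK.
  have yi2 : - s * y i < 2^-1 by rewrite mulNr; lra.
  case: (ltnP i r) => ir; last first.
    have := sco s i s1; have := single i _ ir s1' yi2.
    by rewrite w3' mulNr mulrBr oppr_le0; lra.
  case: (boolP tied) => t; last first.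
    by move: bd yi; rewrite /dirs /= (negbTE t) => H; rewrite /y H// mulr0 ltxx.
  have := block i _ t ir s1' yi2.
  rewrite (eq_bigr _ (fun k _ => w3' k)) sumrB mulNr mulrBr oppr_le0.
  have : s * \sum_(k < n | (k < r)%N) score g beta k <= r%:R * D.
    rewrite (le_trans _ cardr)// mulr_natl -sumr_const mulr_sumr ler_sum// => k _.
    exact: sco.
  (* The first-order condition concerns only the summed rows of the block. Their common coordinate
     is extremal, so every term has the sign of [s] and one row is bounded by the sum. *)
  have : s * (\sum_(j | j != i) w i j * (y i + y j)) <=
      s * \sum_(k < n | (k < r)%N) \sum_(j | j != k) w k j * (y k + y j).
    rewrite [in leRHS](bigD1 i)//= [leRHS]mulrDr lerDl mulr_sumr sumr_ge0// => k /andP[kr _].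
    rewrite mulr_sumr sumr_ge0// => j _; rewrite mulrCA mulr_ge0// (ytied t k i)// mulrDr.
    have : - `|y j| <= s * y j.
      by have := ler_norm (y j); have := ler_norm (- y j); rewrite normrN; case: s1 => ->; lra.
    by have := imax j; lra.
  by rewrite TE; move: D0; lra.
have pos : (1 : R) = 1 \/ (1 : R) = -1 by left.
have neg : (-1 : R) = 1 \/ (-1 : R) = -1 by right.
have yb : forall j, `|y j| * ((expR (-1) * B^-1) ^+ 2 * n%:R) <= 4 * (expR 1 * C^-1) * T.
  apply: (sup_norm_bound m0 T0 rn wb).
  - by move=> i imax yi; have := rowmax 1 i pos; rewrite !mul1r; apply.
  - by move=> i imax yi; have := rowmax (-1) i neg; rewrite !mulN1r oppr_gt0 lerNl; apply.
  - move=> k rk yk; have := single k 1 rk pos; rewrite !mul1r w3'; have := sD2 k; lra.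
  - move=> k rk yk; have := single k (-1) rk neg; rewrite !mulN1r w3'; have := sD1 k; lra.
have yM i : `|y i| <= mle_radius.
  have K0 : 0 < (expR (-1) / B) ^+ 2 * n%:R by rewrite mulr_gt0// exprn_gt0.
  have := yb i; rewrite -ler_pdivlMr//.
  suff -> : 4 * (expR 1 / C) * T / ((expR (-1) / B) ^+ 2 * n%:R) = mle_radius by [].
  rewrite /mle_radius /T expRN; field.
  by rewrite !gt_eqF ?expR_gt0.
(* All coordinates are interior, so [single] and [block] apply with both signs and the scores
   vanish. *)
have yi2 i : - 2^-1 < y i < 2^-1.
  by have := le_lt_trans (yM i) rad2; rewrite ltr_norml.
have sc0 (k : 'I_n) : (r <= k)%N -> score g b k = 0.
  move=> rk; have /andP[h1 h2] := yi2 k.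
  by have := single k 1 rk pos; have := single k (-1) rk neg; rewrite !mul1r !mulN1r; lra.
have scT : tied -> \sum_(i < n | (i < r)%N) score g b i = 0.
  move=> t; have [i0 i0r|] := pickP (fun i : 'I_n => (i < r)%N); last first.
    by move=> H; rewrite big_pred0.
  have /andP[h1 h2] := yi2 i0.
  by have := block i0 1 t i0r pos; have := block i0 (-1) t i0r neg; rewrite !mul1r !mulN1r; lra.
exists b; split => // b' b'd.
rewrite (le_trans (loglik_tangent b b' ga))//.
rewrite (bigID (fun i : 'I_n => (i < r)%N))/= [X in _ + (_ + X)]big1 ?addr0; last first.
  by move=> i; rewrite -leqNgt => ri; rewrite sc0// mulr0.
suff -> : \sum_(i < n | (i < r)%N) (b' i - b i) * score g b i = 0 by rewrite addr0.
case: (boolP tied) => t; last first.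
  rewrite big1// => i ir; move: b'd bd; rewrite /dirs /= (negbTE t) => H1 H2.
  have := H1 i ir; have := H2 i ir => e1 e2.
  by rewrite (_ : b' i - b i = 0) ?mul0r//; lra.
have [i0|] := pickP (fun i : 'I_n => (i < r)%N); last first.
  by move=> H; rewrite big_pred0.
move=> i0r; rewrite (eq_bigr (fun i => (b' i0 - b i0) * score g b i)).
  by rewrite -mulr_sumr scT// mulr0.
move=> i ir; congr (_ * _); move: b'd; rewrite /dirs /= t => H.
have := H i i0 ir i0r; have := ytied t i i0 ir i0r; rewrite /y; lra.
Qed.

End Consistency.

(** * Expansion of the scores *)

Section Expansion.
Variables (R : realType) (n r : nat).
Variables (g : {ffun 'I_n * 'I_n -> bool}) (beta : 'I_n -> R).
Implicit Types (b t : 'I_n -> R).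

(** A diagonal entry of the Fisher information. The variant [v_tail] keeps only the edges towards
    nodes [j >= r], the part for which distinct rows below [r] have no edge in common. *)
Definition v_row (i : 'I_n) : R := \sum_(j < n | j != i) logistic_var (beta i + beta j).
Definition v_tail (i : 'I_n) : R := \sum_(j < n | (r <= j)%N) logistic_var (beta i + beta j).

Lemma sum_offdiag (G : 'I_n -> 'I_n -> R) :
  \sum_(i < n) \sum_(j < n | j != i) G i j =
  \sum_(i < n) \sum_(j < n | (i < j)%N) (G i j + G j i).
Proof.
have -> : \sum_(i < n) \sum_(j < n | (i < j)%N) (G i j + G j i) =
    \sum_(i < n) \sum_(j < n | (i < j)%N) G i j + \sum_(i < n) \sum_(j < n | (j < i)%N) G i j.
  rewrite [X in _ = _ + X](exchange_big_dep xpredT)//= -big_split; apply: eq_bigr => i _ /=.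
  by rewrite -big_split.
rewrite -big_split; apply: eq_bigr => i _ /=.
rewrite (bigID (fun j : 'I_n => (i < j)%N)) /=; congr (_ + _).
  by apply: eq_bigl => j; rewrite -val_eqE /=; case: ltngtP.
by apply: eq_bigl => j; rewrite -val_eqE /=; case: ltngtP.
Qed.

Variables (B C : R).
Hypotheses (ga : is_adj g) (B0 : 0 < B) (C0 : 0 < C).
Hypothesis rn : (4 * r.+2 <= n)%N.
Hypothesis vb : forall i j, j != i ->
  B^-1 <= logistic_var (beta i + beta j) <= C^-1.

Lemma v_row_ge i : (n%:R / 2) / B <= v_row i.
Proof.
apply: (@le_trans _ _ (\sum_(j < n | j != i) B^-1)); last first.
  by rewrite ler_sum// => j ji; have /andP[] := vb ji.
rewrite sumr_const -[leRHS]mulr_natl ler_wpM2r ?invr_ge0 ?(ltW B0)//.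
rewrite cardC1 card_ord; have n0 : (2 <= n)%N by clear -rn; lia.
have : (n <= 2 * n.-1)%N by move: n0; clear; lia.
by rewrite ler_pdivrMr// -natrM ler_nat mulnC.
Qed.

Lemma v_row_gt0 i : 0 < v_row i.
Proof.
by rewrite (lt_le_trans _ (v_row_ge i))// !divr_gt0// ltr0n; clear -rn; lia.
Qed.

Lemma v_row_le i : v_row i <= n%:R / C.
Proof.
apply: (@le_trans _ _ (\sum_(j < n | j != i) C^-1)).
  by rewrite ler_sum// => j ji; have /andP[] := vb ji.
rewrite sumr_const -[leLHS]mulr_natl ler_wpM2r ?invr_ge0 ?(ltW C0)//.
by rewrite ler_nat (leq_trans (max_card _))// card_ord.
Qed.

Lemma v_tail_ge (i : 'I_n) : (i < r)%N -> (n%:R / 2) / B <= v_tail i.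
Proof.
move=> ir; apply: (@le_trans _ _ (\sum_(j < n | (r <= j)%N) B^-1)); last first.
  rewrite ler_sum// => j rj; have ji : j != i.
    by rewrite -val_eqE /= neq_ltn (leq_trans ir rj) orbT.
  by have /andP[] := vb ji.
rewrite sumr_const -[leRHS]mulr_natl ler_wpM2r ?invr_ge0 ?(ltW B0)//.
have := cardC [pred j : 'I_n | (j < r)%N]; rewrite card_ord.
rewrite [X in (_ + X)%N](eq_card (B := [pred j : 'I_n | (r <= j)%N])) => [cE|j]; last first.
  by rewrite !inE -leqNgt.
have cr := card_lt_ord n r.
have : (n <= 2 * #|[pred j : 'I_n | (r <= j)%N]|)%N.
  move: cE cr rn; move: #|_| #|_| => c1 c2; clear; lia.
by rewrite ler_pdivrMr// -natrM ler_nat mulnC.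
Qed.

Lemma v_tail_le_row (i : 'I_n) : (i < r)%N -> v_tail i <= v_row i.
Proof.
move=> ir; rewrite /v_row (bigID (fun j : 'I_n => (r <= j)%N))/=.
rewrite (eq_bigl (fun j : 'I_n => (r <= j)%N)) => [|j].
  by rewrite lerDl sumr_ge0// => j _; exact: logistic_var_ge0.
case: (leqP r j) => rj; rewrite ?andbF ?andbT//.
by rewrite -val_eqE /= neq_ltn (leq_trans ir rj) orbT.
Qed.

(* V y = T for y_j = u_j / v_jj, u the off-diagonal part of V delta: substituting
   delta_j = (s_j - u_j - R_j) / v_jj into u turns the score equations into a
   system with the right-hand side averaged over a whole row. *)
Lemma score_expansion b (M T0 : R) : 0 <= M -> M <= 2^-1 -> 0 <= T0 ->
  (forall i, `|b i - beta i| <= M) ->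
  (forall k : 'I_n, (k < r)%N -> b k = beta k) ->
  (forall k : 'I_n, (r <= k)%N -> score g b k = 0) ->
  (forall i, `|\sum_(j < n | (j != i) && (r <= j)%N)
      logistic_var (beta i + beta j) * (score g beta j / v_row j)| <= T0) ->
  forall i, `|score g beta i - score g b i - v_row i * (b i - beta i)| <=
    (2 + 4 * B ^+ 2 / C ^+ 2) * (T0 + 4 * expR 1 * M ^+ 2 * n%:R / C).
Proof.
move=> M0 M2 T00 bM bfix bscore hT0.
have n0 : 0 < n%:R :> R by rewrite ltr0n; clear -rn; lia.
pose d i := b i - beta i.
pose v i j := logistic_var (beta i + beta j).
have [w [_ w2 w3]] := score_slopes g bM.
pose rho i := \sum_(j < n | j != i) (w i j - v i j) * (d i + d j).
pose u i := \sum_(j < n | j != i) v i j * d j.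
pose T := T0 + 4 * expR 1 * M ^+ 2 * n%:R / C.
have eM : expR (2 * M) - 1 <= 2 * M * expR 1.
  have M20 : 0 <= 2 * M by lra.
  have /andP[_ h] := expR_sub1_bounds M20.
  by rewrite (le_trans h)// ler_wpM2l// ler_expR; lra.
have e1 : 1 <= expR 1 :> R by have := expR_ge1Dx (1 : R); lra.
(* [rho] is quadratic in [M]: slopes and variances differ by a relative [2 * M * expR 1], and the
   increments are at most [2 * M]. *)
have rhoB i : `|rho i| <= 4 * expR 1 * M ^+ 2 * v_row i.
  rewrite mulr_sumr (le_trans (ler_norm_sum _ _ _))// ler_sum// => j ji.
  rewrite normrM.
  have h1 : `|w i j - v i j| <= v i j * (2 * M * expR 1).
    have /andP[u1 u2] := w2 i j; rewrite -/(v i j) in u1 u2.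
    have v0 : 0 <= v i j by exact: logistic_var_ge0.
    have x1 := expR_ge1Dx (- (2 * M)).
    have y1 := ler_wpM2l v0 eM; have y2 := ler_wpM2l v0 x1.
    have z1 : 0 <= 2 * M * (expR 1 - 1) by rewrite mulr_ge0; lra.
    have y3 := mulr_ge0 v0 z1.
    rewrite ler_norml; apply/andP; split; lra.
  have h2 : `|d i + d j| <= 2 * M.
    by rewrite (le_trans (ler_normD _ _))// mulr_natl mulr2n lerD ?bM.
  apply: (@le_trans _ _ (v i j * (2 * M * expR 1) * (2 * M))).
    by rewrite ler_pM.
  by rewrite -/(v i j) le_eqVlt; apply/orP; left; apply/eqP; ring.
have key i : score g beta i - score g b i = v_row i * d i + u i + rho i.
  rewrite w3 opprB addrC subrK mulr_suml -!big_split; apply: eq_bigr => j _.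
  by rewrite /= -/(d i) -/(d j) -/(v i j); ring.
have dE (j : 'I_n) : (r <= j)%N -> d j = (score g beta j - rho j) / v_row j - u j / v_row j.
  move=> rj; have := key j; rewrite bscore// subr0 => ->.
  by have vj := v_row_gt0 j; field; rewrite gt_eqF.
have d0 (j : 'I_n) : (j < r)%N -> d j = 0 by move=> jr; rewrite /d bfix// subrr.
pose y (j : 'I_n) := if (r <= j)%N then u j / v_row j else 0.
pose Ti i := \sum_(j < n | (j != i) && (r <= j)%N) v i j * ((score g beta j - rho j) / v_row j).
have TiB i : `|Ti i| <= T.
  rewrite /Ti (eq_bigr (fun j => v i j * (score g beta j / v_row j) - v i j * (rho j / v_row j))); last first.
    by move=> j _; rewrite mulrBl mulrBr.
  rewrite sumrB (le_trans (ler_normB _ _))// lerD//.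
  rewrite (le_trans (ler_norm_sum _ _ _))//.
  apply: (@le_trans _ _ (4 * expR 1 * M ^+ 2 * v_row i)); last first.
    by rewrite -[leRHS]mulrA ler_wpM2l ?v_row_le// mulr_ge0 ?sqr_ge0// mulr_ge0// expR_ge0.
  rewrite /v_row mulr_sumr [leRHS](bigID (fun j : 'I_n => (r <= j)%N))/=.
  rewrite ler_wpDr//; last first.
    apply: ler_sum => j _; rewrite normrM ger0_norm ?logistic_var_ge0//.
    rewrite [leRHS]mulrC ler_wpM2l ?logistic_var_ge0// normrM normfV.
    by rewrite (gtr0_norm (v_row_gt0 j)) ler_pdivrMr ?v_row_gt0.
  rewrite sumr_ge0// => j _; rewrite mulr_ge0 ?logistic_var_ge0//.
  by rewrite mulr_ge0 ?sqr_ge0// mulr_ge0// expR_ge0.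
have uE i : u i = Ti i - \sum_(j < n | j != i) v i j * y j.
  rewrite /u /Ti (bigID (fun j : 'I_n => (r <= j)%N))/= [X in _ + X]big1 ?addr0; last first.
    by move=> j; rewrite -ltnNge => /andP[_ jr]; rewrite d0// mulr0.
  rewrite [X in _ = _ - X](bigID (fun j : 'I_n => (r <= j)%N))/= [X in _ - (_ + X)]big1 ?addr0; last first.
    by move=> j /andP[_ jr]; rewrite /y (negbTE jr) mulr0.
  rewrite -sumrB; apply: eq_bigr => j /andP[_ rj].
  by rewrite dE// /y rj mulrBr.
have rowE (i : 'I_n) : (r <= i)%N -> \sum_(j < n | j != i) v i j * (y i + y j) = Ti i.
  move=> ri; rewrite (eq_bigr (fun j => v i j * y i + v i j * y j)) => [|j _]; last by rewrite mulrDr.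
  rewrite big_split /= -mulr_suml -/(v_row i) {1}/y ri mulrCA mulfV ?gt_eqF ?v_row_gt0// mulr1.
  by rewrite [in LHS]uE subrK.
have T0' : 0 <= T by rewrite (le_trans _ (TiB (Ordinal (_ : 0 < n)%N)))//; clear -rn; lia.
have yB : forall j, `|y j| * (B^-1 ^+ 2 * n%:R) <= 4 * C^-1 * T.
  have TiB' i : - T <= Ti i <= T by rewrite -ler_norml.
  (* A nonzero [y i] forces [r <= i], so an extremal coordinate always lies in a row where [rowE]
     holds. *)
  have yr (i : 'I_n) : y i != 0 -> (r <= i)%N by rewrite /y; case: ifP; rewrite ?eqxx.
  apply: (@sup_norm_bound R n r v B^-1 C^-1 T _ T0' rn vb); first by rewrite invr_gt0.
  - by move=> i _ yi; rewrite rowE ?yr ?gt_eqF//; have /andP[] := TiB' i.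
  - by move=> i _ yi; rewrite rowE ?yr ?lt_eqF//; have /andP[] := TiB' i.
  - by move=> i ri yi; rewrite rowE//; have /andP[] := TiB' i.
  - by move=> i ri yi; rewrite rowE//; have /andP[] := TiB' i.
have yB2 j : `|y j| <= 4 * B ^+ 2 / (C * n%:R) * T.
  have K0 : 0 < B^-1 ^+ 2 * n%:R by rewrite mulr_gt0// exprn_gt0// invr_gt0.
  have := yB j; rewrite -ler_pdivlMr//.
  suff -> : 4 / C * T / (B^-1 ^+ 2 * n%:R) = 4 * B ^+ 2 / (C * n%:R) * T by [].
  by field; rewrite !gt_eqF.
move=> i; have := key i; rewrite -/(d i) => ->.
rewrite (_ : _ - _ = u i + rho i); last by ring.
rewrite (le_trans (ler_normD _ _))//.
have u_le : `|u i| <= T + 4 * B ^+ 2 / C ^+ 2 * T.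
  rewrite uE (le_trans (ler_normB _ _))// lerD//.
  rewrite (le_trans (ler_norm_sum _ _ _))//.
  apply: (@le_trans _ _ (v_row i * (4 * B ^+ 2 / (C * n%:R) * T))).
    rewrite mulr_suml ler_sum// => j _.
    by rewrite normrM ger0_norm ?logistic_var_ge0// ler_wpM2l ?logistic_var_ge0.
  have P0 : 0 <= 4 * B ^+ 2 / (C * n%:R) * T.
    by rewrite mulr_ge0// divr_ge0// ?mulr_ge0 ?sqr_ge0// ltW.
  apply: (le_trans (ler_wpM2r P0 (v_row_le i))).
  by apply: le_of_eq; field; rewrite !gt_eqF.
have rho_le : `|rho i| <= T.
  apply: (le_trans (rhoB i)); apply: (@le_trans _ _ (4 * expR 1 * M ^+ 2 * n%:R / C)).
    by rewrite -[leRHS]mulrA ler_wpM2l ?v_row_le// mulr_ge0 ?sqr_ge0// mulr_ge0// expR_ge0.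
  by rewrite /T lerDr.
rewrite -/T; lra.
Qed.

(** The quadratic form is made diagonal: [(t i + t j)^2] is a single square unless both indices are
    below [r], where it costs a factor 2. There are at most [r] such [j] per row, a contribution
    absorbed by [eta]. *)
Lemma loglik_lower_block b t (M eta : R) : 
  (forall i, `|b i - beta i| <= M) -> (forall i, `|t i| <= M) ->
  (forall i : 'I_n, (r <= i)%N -> t i = 0) ->
  (forall i : 'I_n, (i < r)%N -> 2 * r%:R / C <= eta * v_tail i) ->
  loglik g b + \sum_(i < n | (i < r)%N) t i * score g b i
   - 2^-1 * (expR (4 * M) * (1 + eta)) * \sum_(i < n | (i < r)%N) v_tail i * t i ^+ 2
   <= loglik g (b \+ t).
Proof.
move=> bM tM t0 heta; apply: le_trans (loglik_lower b t ga).
pose v i j := logistic_var (beta i + beta j).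
have -> : \sum_i t i * score g b i = \sum_(i < n | (i < r)%N) t i * score g b i.
  rewrite (bigID (fun i : 'I_n => (i < r)%N))/= [X in _ + X]big1 ?addr0// => i.
  by rewrite -leqNgt => ri; rewrite t0// mul0r.
rewrite lerB//.
pose G i j := v i j * (t i ^+ 2 * (1 + (j < r)%N%:R)).
apply: (@le_trans _ _ (\sum_(i < n) \sum_(j < n | (i < j)%N)
    2^-1 * expR (4 * M) * (G i j + G j i))).
  rewrite ler_sum// => i _; rewrite ler_sum// => j _.
  (* One factor [expR (2 * M)] moves the variance from [b] to [beta], the other bounds the curvature
     inflation along [t]. *)
  have h1 : logistic_var (b i + b j) * expR `|t i + t j| <= v i j * expR (4 * M).
    have -> : b i + b j = (beta i + beta j) + ((b i - beta i) + (b j - beta j)) by ring.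
    apply: (@le_trans _ _ (v i j * expR (2 * M) * expR (2 * M))); last first.
      by rewrite -mulrA -expRD -mulrDl ler_wpM2l ?logistic_var_ge0// ler_expR; lra.
    apply: ler_pM; rewrite ?logistic_var_ge0 ?expR_ge0//.
      apply: (le_trans (logistic_var_diff _ _)).
      rewrite ler_wpM2l ?logistic_var_ge0// ler_expR (le_trans (ler_normD _ _))//.
      by rewrite mulr_natl mulr2n lerD.
    by rewrite ler_expR (le_trans (ler_normD _ _))// mulr_natl mulr2n lerD.
  have h2 : (t i + t j) ^+ 2 <= t i ^+ 2 * (1 + (j < r)%N%:R) + t j ^+ 2 * (1 + (i < r)%N%:R).
    case: (ltnP i r) => ir; case: (ltnP j r) => jr /=; rewrite ?(t0 _ ir) ?(t0 _ jr).
    - by have := sqr_ge0 (t i - t j); nra.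
    - by rewrite expr0n/= addr0 mul0r !addr0 mulr1.
    - by rewrite expr0n/= add0r mul0r !addr0 add0r mulr1.
    - by rewrite addr0 expr0n/= !mul0r addr0.
  have -> : G i j + G j i = v i j * (t i ^+ 2 * (1 + (j < r)%N%:R) + t j ^+ 2 * (1 + (i < r)%N%:R)).
    by rewrite /G /v (addrC (beta j)); ring.
  set Z := t i ^+ 2 * _ + _ in h2 *.
  apply: (@le_trans _ _ (2^-1 * (v i j * expR (4 * M)) * Z)).
    apply: ler_pM => //; rewrite ?sqr_ge0//; last by rewrite ler_wpM2l.
    by rewrite mulr_ge0// mulr_ge0 ?expR_ge0 ?logistic_var_ge0.
  by apply: le_of_eq; ring.
have -> : \sum_(i < n) \sum_(j < n | (i < j)%N) 2^-1 * expR (4 * M) * (G i j + G j i) =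
   2^-1 * expR (4 * M) * \sum_(i < n) \sum_(j < n | j != i) G i j.
  by rewrite sum_offdiag mulr_sumr; apply: eq_bigr => i _; rewrite mulr_sumr.
rewrite -!mulrA ler_wpM2l// ler_wpM2l ?expR_ge0// mulr_sumr.
rewrite (bigID (fun i : 'I_n => (i < r)%N))/= [X in _ + X <= _]big1 ?addr0; last first.
  move=> i; rewrite -leqNgt => ri; rewrite big1// => j _.
  by rewrite /G t0// expr0n mul0r mulr0.
rewrite ler_sum// => i ir.
rewrite /G (eq_bigr (fun j => t i ^+ 2 * (v i j * (1 + (j < r)%N%:R)))) => [|j _]; last by ring.
rewrite -mulr_sumr [leRHS]mulrA [leRHS]mulrC ler_wpM2l ?sqr_ge0//.
rewrite mulrDl mul1r; apply: (@le_trans _ _ (v_tail i + 2 * r%:R / C)); last by rewrite lerD2l heta.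
rewrite (bigID (fun j : 'I_n => (r <= j)%N))/= lerD//.
  apply: le_of_eq.
  apply: eq_big => [j|j /andP[_ rj]]; last by rewrite ltnNge rj addr0 mulr1.
  case: (leqP r j) => rj; rewrite ?andbF ?andbT//.
  by rewrite -val_eqE /= neq_ltn (leq_trans ir rj) orbT.
apply: (@le_trans _ _ (\sum_(j < n | (j < r)%N) (2 / C))).
  rewrite [leLHS]big_mkcond [leRHS]big_mkcond ler_sum// => j _.
  case: (leqP r j) => rj; rewrite ?andbF// andbT.
  case: (eqVneq j i) => [_|ji]; first by rewrite divr_ge0// ltW.
  by have /andP[_ h] := vb ji; rewrite /v /=; lra.
rewrite sumr_const -[leLHS]mulr_natl (_ : 2 * r%:R / C = r%:R * (2 / C)); last by ring.
rewrite ler_wpM2r ?divr_ge0 ?(ltW C0)// ler_nat; exact: card_lt_ord.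
Qed.

End Expansion.

(** * Sandwich for the likelihood ratio *)

Section SumLemmas.
Variables (R : realType) (I : finType) (A : pred I).

Definition mean (x : I -> R) : R := (\sum_(i | A i) x i) / #|A|%:R.

(** For the homogeneous null only pairwise differences of estimated parameters are under control;
    this identity passes from them to deviations from the mean. *)
Lemma sum_sqr_mean (x : I -> R) : (0 < #|A|)%N ->
  \sum_(i | A i) (x i - mean x) ^+ 2 =
  (2 * #|A|%:R)^-1 * \sum_(i | A i) \sum_(j | A j) (x i - x j) ^+ 2.
Proof.
move=> A0; set N : R := #|A|%:R; have N0 : N != 0 by rewrite pnatr_eq0 -lt0n.
have csum c : \sum_(i | A i) c = N * c by rewrite sumr_const mulr_natl.
pose S1 := \sum_(i | A i) x i; pose S2 := \sum_(i | A i) x i ^+ 2.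
have -> : \sum_(i | A i) (x i - mean x) ^+ 2 = S2 - S1 ^+ 2 / N.
  rewrite (eq_bigr (fun i => x i ^+ 2 - (2 * mean x) * x i + mean x ^+ 2)); last first.
    by move=> i _; ring.
  rewrite big_split /= sumrB -mulr_sumr csum -/S1 -/S2.
  by rewrite /mean -/S1 -/N; field.
have -> : \sum_(i | A i) \sum_(j | A j) (x i - x j) ^+ 2 = 2 * N * S2 - 2 * S1 ^+ 2.
  rewrite (eq_bigr (fun i => N * x i ^+ 2 - 2 * S1 * x i + S2)); last first.
    move=> i _; rewrite (eq_bigr (fun j => x i ^+ 2 - 2 * x i * x j + x j ^+ 2)); last first.
      by move=> j _; ring.
    rewrite big_split /= sumrB csum -mulr_sumr -/S1 -/S2.
    by ring.
  rewrite big_split /= sumrB -!mulr_sumr csum -/S1 -/S2.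
  by ring.
by field.
Qed.

End SumLemmas.

Section MaxLoglik.
Variables (R : realType) (n : nat) (g : {ffun 'I_n * 'I_n -> bool}).
Hypothesis ga : is_adj g.

Lemma max_loglik_attained (Theta : set ('I_n -> R)) b :
  Theta b -> (forall b', Theta b' -> loglik g b' <= loglik g b) ->
  max_loglik Theta g = loglik g b.
Proof.
move=> tb bmax; apply/eqP; rewrite eq_le; apply/andP; split.
  by apply: ge_sup; [exists (loglik g b), b|move=> _ [b' tb' <-]; exact: bmax].
apply: ub_le_sup; last by exists b.
by exists (loglik g b) => _ [b' tb' <-]; exact: bmax.
Qed.

Lemma max_loglik_mono (Theta Theta' : set ('I_n -> R)) :
  Theta !=set0 -> Theta `<=` Theta' -> max_loglik Theta g <= max_loglik Theta' g.
Proof.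
move=> T0 TT'; apply: le_sup.
- move=> _ [b tb <-]; exists (loglik g b); split => //; exists b => //; exact: TT'.
- by case: T0 => b tb; exists (loglik g b), b.
- split; first by case: T0 => b tb; exists (loglik g b), b => //; exact: TT'.
  by exists 0 => _ [b _ <-]; exact: loglik_le0.
Qed.

(** Holds for every graph, including those without a maximizer: the likelihood is at most 0, so both
    suprema are finite. *)
Lemma LRT_ge0 (Theta : set ('I_n -> R)) : Theta !=set0 -> 0 <= LRT Theta g.
Proof. by move=> T0; rewrite mulr_ge0// subr_ge0 max_loglik_mono. Qed.

End MaxLoglik.

Section Sandwich.
Variables (R : realType) (n r : nat).
Variables (g : {ffun 'I_n * 'I_n -> bool}) (beta : 'I_n -> R).
Variables (B C : R).
Hypotheses (ga : is_adj g) (B0 : 0 < B) (C0 : 0 < C).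
Hypothesis rn : (4 * r.+2 <= n)%N.
Hypothesis vb : forall i j, j != i ->
  B^-1 <= logistic_var (beta i + beta j) <= C^-1.
Variables (D M eta : R).
Hypotheses (D0 : 0 <= D) (M0 : 0 <= M) (M2 : M < 2^-1).
Hypothesis sD : forall i, `|score g beta i| <= D.
Hypothesis radM : 2 * mle_radius n r B C D <= M.
Hypothesis eta_tail : forall i : 'I_n, (i < r)%N -> 2 * r%:R / C <= eta * v_tail r beta i.

Let kappa := expR (4 * M) * (1 + eta).

Lemma mle_radius0 : 2 * mle_radius n 0 B C D <= M.
Proof.
apply: le_trans radM; rewrite ler_wpM2l// /mle_radius.
rewrite ler_wpM2r ?invr_ge0 ?mulr_ge0 ?(ltW C0)//.
by rewrite ler_wpM2r// ler_wpM2r ?sqr_ge0// ler_wpM2l ?ler1n.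
Qed.

Lemma mle_radius_ge0 k : 0 <= mle_radius n k B C D.
Proof.
by rewrite /mle_radius divr_ge0 ?(mulr_ge0 (ltW C0))// mulr_ge0// mulr_ge0 ?sqr_ge0.
Qed.

Lemma mle_radius_lt2 : mle_radius n r B C D < 2^-1.
Proof. by have := mle_radius_ge0 r; move: M2 radM; lra. Qed.

Lemma mle_radius0_lt2 : mle_radius n 0 B C D < 2^-1.
Proof. by have := mle_radius_ge0 0; have := mle_radius0; move: M2; lra. Qed.

Lemma v_tail_gt0 (i : 'I_n) : (i < r)%N -> 0 < v_tail r beta i.
Proof.
move=> ir; rewrite (lt_le_trans _ (v_tail_ge B0 rn vb ir))// !divr_gt0// ltr0n.
clear -rn; lia.
Qed.

(** The factor 2 leaves room for the move to the mean of the tied coordinates, a difference of two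
    deviations that must stay within [M]. *)
Lemma exists_free_mle : exists b, [/\ forall i, 2 * `|b i - beta i| <= M,
  forall k, score g b k = 0 & forall b', loglik g b' <= loglik g b].
Proof.
have rn0 : (4 * 0.+2 <= n)%N by clear -rn; lia.
have [b [_ bM bs _ bmax]] := exists_mle false ga B0 C0 D0 rn0 vb sD mle_radius0_lt2.
exists b; split=> [i|k|b']; first by have := bM i; have := mle_radius0; lra.
  by rewrite bs.
by apply: bmax; rewrite /dirs.
Qed.

Lemma kappa_ge0 : (exists i : 'I_n, (i < r)%N) -> 0 <= kappa.
Proof.
move=> [i ir]; rewrite /kappa mulr_ge0 ?expR_ge0// addr_ge0//.
have := eta_tail ir; have := v_tail_gt0 ir => v0 h.
rewrite -(pmulr_lge0 _ v0) (le_trans _ h)// divr_ge0// ?mulr_ge0// ltW//.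
Qed.

(** At the free maximizer the score vanishes, so a move [t] into the null set costs only the
    quadratic term; the 2 of the likelihood ratio cancels its factor 1/2. *)
Lemma lrt_upper b1 (t : 'I_n -> R) (Theta : set ('I_n -> R)) :
  (forall i, `|b1 i - beta i| <= M) -> (forall k, score g b1 k = 0) ->
  (forall b', loglik g b' <= loglik g b1) ->
  (forall i, `|t i| <= M) -> (forall i : 'I_n, (r <= i)%N -> t i = 0) ->
  Theta (b1 \+ t) ->
  LRT Theta g <= kappa * \sum_(i < n | (i < r)%N) v_tail r beta i * t i ^+ 2.
Proof.
move=> b1M b1s b1max tM t0 tT.
have := loglik_lower_block ga C0 vb b1M tM t0 eta_tail.
rewrite [X in _ + X - _]big1 ?addr0; last by move=> i _; rewrite b1s mulr0.
have : loglik g (b1 \+ t) <= max_loglik Theta g.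
  apply: ub_le_sup; last by exists (b1 \+ t).
  by exists 0 => _ [b' _ <-]; exact: loglik_le0.
rewrite /LRT (@max_loglik_attained _ _ _ setT b1)// -/kappa => h1 h2.
lra.
Qed.

(** The diagonal Newton step [score / v_tail] from the restricted maximizer gains [S - kappa S / 2],
    where [S] is the sum on the left; the bound on [E] keeps the step within [M]. *)
Lemma lrt_lower b0 (E : R) (Theta : set ('I_n -> R)) :
  (forall i, `|b0 i - beta i| <= M) -> Theta b0 ->
  (forall b', Theta b' -> loglik g b' <= loglik g b0) ->
  (forall i : 'I_n, (i < r)%N -> `|score g b0 i| <= E) -> E * (2 * B / n%:R) <= M ->
  (2 - kappa) * \sum_(i < n | (i < r)%N) score g b0 i ^+ 2 / v_tail r beta i <= LRT Theta g.
Proof.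
move=> b0M b0T b0max sE EM.
have n0 : 0 < n%:R :> R by rewrite ltr0n; clear -rn; lia.
pose t (i : 'I_n) := if (i < r)%N then score g b0 i / v_tail r beta i else 0.
have tM i : `|t i| <= M.
  rewrite /t; case: ifP => ir; last by rewrite normr0.
  rewrite normrM normfV (gtr0_norm (v_tail_gt0 ir)); apply: le_trans EM.
  apply: ler_pM; rewrite ?sE// ?invr_ge0 ?(ltW (v_tail_gt0 ir))//.
  rewrite -[leRHS]invrK lef_pV2 ?posrE ?v_tail_gt0 ?invr_gt0 ?divr_gt0 ?mulr_gt0//.
  apply: le_trans (v_tail_ge B0 rn vb ir).
  by apply: le_of_eq; field; rewrite !gt_eqF.
have t0 (i : 'I_n) : (r <= i)%N -> t i = 0 by move=> ri; rewrite /t ltnNge ri.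
have := loglik_lower_block ga C0 vb b0M tM t0 eta_tail.
have -> : \sum_(i < n | (i < r)%N) t i * score g b0 i =
    \sum_(i < n | (i < r)%N) score g b0 i ^+ 2 / v_tail r beta i.
  by apply: eq_bigr => i ir; rewrite /t ir; ring.
have -> : \sum_(i < n | (i < r)%N) v_tail r beta i * t i ^+ 2 =
    \sum_(i < n | (i < r)%N) score g b0 i ^+ 2 / v_tail r beta i.
  by apply: eq_bigr => i ir; rewrite /t ir; field; rewrite gt_eqF ?v_tail_gt0.
rewrite -/kappa; set S := \sum_(i < n | _) _.
have : loglik g (b0 \+ t) <= max_loglik setT g.
  apply: ub_le_sup; last by exists (b0 \+ t).
  by exists 0 => _ [b' _ <-]; exact: loglik_le0.
rewrite /LRT (max_loglik_attained b0T b0max) => h1 h2.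
lra.
Qed.

Lemma lrt_simple_bounds (Theta : set ('I_n -> R)) (T0 P : R) :
  (forall b, Theta b <-> forall i : 'I_n, (i < r)%N -> b i = beta i) ->
  0 <= T0 ->
  (forall i, `|\sum_(j < n | (j != i) && (r <= j)%N)
      logistic_var (beta i + beta j) * (score g beta j / v_row beta j)| <= T0) ->
  (forall i, `|\sum_(j < n | (j != i))
      logistic_var (beta i + beta j) * (score g beta j / v_row beta j)| <= T0) ->
  (2 + 4 * B ^+ 2 / C ^+ 2) * (T0 + 4 * expR 1 * M ^+ 2 * n%:R / C) <= P ->
  (D + P) * (2 * B / n%:R) <= M ->
  exists F G : 'I_n -> R,
  [/\ forall i : 'I_n, (i < r)%N -> `|F i - score g beta i| <= P,
      forall i : 'I_n, (i < r)%N -> `|G i - score g beta i| <= P,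
      (2 - kappa) * \sum_(i < n | (i < r)%N) F i ^+ 2 / v_tail r beta i <= LRT Theta g &
      LRT Theta g <= kappa * \sum_(i < n | (i < r)%N) G i ^+ 2 / v_tail r beta i].
Proof.
move=> ThetaE T00 hT hT' hP hDM.
have n0 : 0 < n%:R :> R by rewrite ltr0n; clear -rn; lia.
have [b0 [b0d b0M b0s _ b0max]] := exists_mle false ga B0 C0 D0 rn vb sD mle_radius_lt2.
have b0M' i : `|b0 i - beta i| <= M by have := b0M i; have := mle_radius_ge0 r; move: radM; lra.
have b0fix (k : 'I_n) : (k < r)%N -> b0 k = beta k.
  by move=> kr; apply/eqP; rewrite -subr_eq0; apply/eqP; exact: b0d.
have [b1 [b1M' b1s b1max]] := exists_free_mle.
have b1M i : `|b1 i - beta i| <= M by have := b1M' i; have := normr_ge0 (b1 i - beta i); lra.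
have E0 := score_expansion B0 C0 rn vb M0 (ltW M2) T00 b0M' b0fix b0s hT.
have rn0 : (4 * 0.+2 <= n)%N by clear -rn; lia.
(* With no coordinate fixed, the same expansion covers the free estimator. *)
have E1 := score_expansion (r := 0) B0 C0 rn0 vb M0 (ltW M2) T00 b1M _ (fun k _ => b1s k) _.
have {}E1 i : `|score g beta i - v_row beta i * (b1 i - beta i)| <= P.
  apply: le_trans hP; have := E1 _ _ i; rewrite b1s subr0; apply => //.
  by move=> k; under eq_bigl do rewrite leq0n andbT.
have {}E0 (i : 'I_n) : (i < r)%N -> `|score g b0 i - score g beta i| <= P.
  move=> ir; apply: le_trans hP; have := E0 i.
  by rewrite b0fix// subrr mulr0 subr0 distrC.
exists (score g b0), (fun i => v_row beta i * (b1 i - beta i)); split => //.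
- by move=> i _; rewrite distrC.
- apply: (lrt_lower b0M' _ _ _ hDM).
  + by apply/ThetaE.
  + move=> b' /ThetaE b'T; apply: b0max; rewrite /dirs /= => i ir.
    by rewrite b'T// subrr.
  + move=> i ir; have := E0 i ir; have := sD i.
    have := ler_normD (score g b0 i - score g beta i) (score g beta i).
    by rewrite subrK; lra.
- pose t (i : 'I_n) := if (i < r)%N then beta i - b1 i else 0.
  have Th : Theta (b1 \+ t) by apply/ThetaE => i ir; rewrite /t /= ir addrC subrK.
  have tM i : `|t i| <= M.
    by rewrite /t; case: ifP => ir; rewrite ?normr0// distrC b1M.
  have t0 (i : 'I_n) : (r <= i)%N -> t i = 0 by move=> ri; rewrite /t ltnNge ri.
  have := lrt_upper b1M b1s b1max tM t0 Th; move=> /le_trans; apply.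
  have [[i0 i0r]|] := pselect (exists i : 'I_n, (i < r)%N); last first.
    move=> H; rewrite !big_pred0// => i; apply/negP => ir; apply: H; by exists i.
  rewrite ler_wpM2l ?kappa_ge0//; first by exists i0.
  rewrite ler_sum// => i ir; rewrite /t ir.
  have v0 := v_tail_gt0 ir; rewrite ler_pdivlMr//.
  (* [G] is scaled by [v_row], while the quadratic form has [v_tail]; as [v_tail <= v_row],
     replacing [v_tail ^+ 2] by [v_row ^+ 2] keeps an upper bound. *)
  have := v_tail_le_row beta ir => h.
  rewrite (_ : _ * _ * _ = (v_tail r beta i) ^+ 2 * (b1 i - beta i) ^+ 2); last by ring.
  by rewrite exprMn ler_wpM2r ?sqr_ge0// ler_sqr ?nnegrE ?(ltW v0)// (le_trans (ltW v0)).
Qed.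

Hypothesis r0 : (0 < r)%N.
Hypothesis beta_tied : forall i j : 'I_n, (i < r)%N -> (j < r)%N -> beta i = beta j.

Let A := [pred i : 'I_n | (i < r)%N].

(** Once the diagonal term is added, both logistic sums run over all nodes and coincide. The
    right-hand side is free of [b], so score differences agree at any two parameters tied at [i] and
    [i']. *)
Lemma score_diff_tied (b : 'I_n -> R) (i i' : 'I_n) : (i < r)%N -> (i' < r)%N -> b i = b i' ->
  score g b i - score g b i' = (degree g i)%:R - (degree g i')%:R.
Proof.
move=> ir i'r bb; rewrite /score.
have E k : \sum_(j < n | j != k) logistic (b k + b j) =
   \sum_(j < n) logistic (b k + b j) - logistic (b k + b k).
  by rewrite [X in _ = X - _](bigD1 k)//= addrAC subrr add0r.
rewrite !E bb; ring.
Qed.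

Lemma v_tail_tied (i i' : 'I_n) : (i < r)%N -> (i' < r)%N ->
  v_tail r beta i = v_tail r beta i'.
Proof. by move=> ir i'r; rewrite /v_tail (beta_tied ir i'r). Qed.

(** The free estimator fits the degrees exactly, so a difference of degrees is a sum of logistic
    differences with one common increment [b1 i - b1 i']. All slopes are positive and nothing
    cancels, so no expansion is involved. *)
Lemma mle_diff_tied (b1 : 'I_n -> R) (i i' : 'I_n) : (forall i, `|b1 i - beta i| <= M) ->
  (forall k, score g b1 k = 0) -> (i < r)%N -> (i' < r)%N ->
  v_tail r beta i * `|b1 i - b1 i'| <= expR (4 * M) * `|score g beta i - score g beta i'|.
Proof.
move=> b1M b1s ir i'r.
case: (eqVneq i i') => [->|ii']; first by rewrite !subrr normr0 !mulr0.
have -> : score g beta i - score g beta i' =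
   \sum_(j < n | (j != i) && (j != i')) (logistic (b1 i + b1 j) - logistic (b1 i' + b1 j)).
  rewrite (score_diff_tied ir i'r (beta_tied ir i'r)).
  have E k : (degree g k)%:R = \sum_(j < n | j != k) logistic (b1 k + b1 j).
    by apply/eqP; rewrite -subr_eq0; have /eqP := b1s k; rewrite /score.
  rewrite !E sumrB (bigD1 i')/=; last by rewrite eq_sym.
  rewrite [X in _ - X = _](bigD1 i)//= [b1 i' + b1 i]addrC.
  rewrite [X in _ - (_ + X) = _](eq_bigl (fun j => (j != i) && (j != i'))) => [|j]; last by rewrite andbC.
  ring.
pose h := b1 i - b1 i'.
have hM : `|h| <= 2 * M.
  rewrite /h (_ : _ - _ = (b1 i - beta i) - (b1 i' - beta i')); last by rewrite (beta_tied ir i'r); ring.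
  by rewrite (le_trans (ler_normB _ _))// mulr_natl mulr2n lerD.
have H (j : 'I_n) : exists w : R, logistic (b1 i + b1 j) - logistic (b1 i' + b1 j) = w * h /\
   logistic_var (beta i + beta j) <= expR (4 * M) * w.
  have [w [w1 w2 _]] := logistic_slope (b1 i' + b1 j) h.
  exists w; split; first by rewrite -w1 /h; congr (logistic _ - _); ring.
  have e0 := expR_gt0 `|h|.
  have x1 : logistic_var (b1 i' + b1 j) <= expR (2 * M) * w.
    apply: (@le_trans _ _ (expR `|h| * w)).
      by rewrite mulrC -ler_pdivrMr// -expRN.
    rewrite ler_wpM2r ?ler_expR//.
    by rewrite (le_trans _ w2)// mulr_ge0 ?expR_ge0 ?logistic_var_ge0.
  have x2 : logistic_var (beta i + beta j) <= logistic_var (b1 i' + b1 j) * expR (2 * M).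
    have -> : beta i + beta j = (b1 i' + b1 j) + ((beta i' - b1 i') + (beta j - b1 j)).
      by rewrite (beta_tied ir i'r); ring.
    apply: (le_trans (logistic_var_diff _ _)).
    rewrite ler_wpM2l ?logistic_var_ge0// ler_expR (le_trans (ler_normD _ _))//.
    by rewrite mulr_natl mulr2n lerD// distrC.
  apply: (le_trans x2); rewrite mulrC.
  rewrite (_ : 4 * M = 2 * M + 2 * M) ?expRD -?mulrA ?ler_wpM2l ?expR_ge0//; lra.
have [w Hw] := choice H.
have -> : \sum_(j < n | (j != i) && (j != i')) (logistic (b1 i + b1 j) - logistic (b1 i' + b1 j)) =
   (\sum_(j < n | (j != i) && (j != i')) w j) * h.
  by rewrite mulr_suml; apply: eq_bigr => j _; have [-> _] := Hw j.
rewrite normrM mulrA ler_wpM2r//.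
apply: (@le_trans _ _ (expR (4 * M) * \sum_(j < n | (j != i) && (j != i')) w j)); last first.
  by rewrite ler_wpM2l ?expR_ge0// ler_norm.
rewrite mulr_sumr [leRHS](bigID (fun j : 'I_n => (r <= j)%N))/= ler_wpDr//.
  rewrite sumr_ge0// => j _; have [_ hj] := Hw j.
  by rewrite (le_trans _ hj)// logistic_var_ge0.
rewrite /v_tail [leRHS](eq_bigl (fun j : 'I_n => (r <= j)%N)) => [|j].
  by apply: ler_sum => j _; have [_ hj] := Hw j.
case: (leqP r j) => rj; rewrite ?andbF ?andbT//.
by rewrite -!val_eqE /= !neq_ltn (leq_trans ir rj) (leq_trans i'r rj) !orbT.
Qed.

Lemma card_tied : #|A| = r.
Proof.
rewrite -sum1_card; have rn' : (r <= n)%N by clear -rn; lia.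
by rewrite (eq_bigl (fun i : 'I_n => (i < r)%N))// -(big_ord_widen _ (fun=> 1%N) rn') sum1_card card_ord.
Qed.

Lemma lrt_tied_bounds (Theta : set ('I_n -> R)) :
  (forall b, Theta b <-> forall i j : 'I_n, (i < r)%N -> (j < r)%N -> b i = b j) ->
  2 * D * (2 * B / n%:R) <= M ->
  forall S, S = \sum_(i < n | (i < r)%N)
     (score g beta i - mean A (score g beta)) ^+ 2 / v_tail r beta i ->
  (2 - kappa) * S <= LRT Theta g <= kappa * expR (8 * M) * S.
Proof.
move=> ThetaE hDM S SE.
have n0 : 0 < n%:R :> R by rewrite ltr0n; clear -rn; lia.
have r0R : 0 < r%:R :> R by rewrite ltr0n.
have [i0 i0r] : exists i : 'I_n, (i < r)%N.
  have n0' : (0 < n)%N by clear -rn; lia.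
  by exists (Ordinal n0').
have [b0 [b0d b0M b0s b0sum b0max]] := exists_mle true ga B0 C0 D0 rn vb sD mle_radius_lt2.
have b0M' i : `|b0 i - beta i| <= M by have := b0M i; have := mle_radius_ge0 r; move: radM; lra.
have b0tied (i j : 'I_n) : (i < r)%N -> (j < r)%N -> b0 i = b0 j.
  by move=> ir jr; have := b0d i j ir jr; rewrite (beta_tied ir jr); lra.
have [b1 [b1M' b1s b1max]] := exists_free_mle.
have b1M i : `|b1 i - beta i| <= M by have := b1M' i; have := normr_ge0 (b1 i - beta i); lra.
have meanD : `|mean A (score g beta)| <= D.
  rewrite /mean card_tied normrM normfV (gtr0_norm r0R) ler_pdivrMr//.
  rewrite (le_trans (ler_norm_sum _ _ _))// (le_trans (ler_sum _ (fun i _ => sD i)))//.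
  by rewrite sumr_const card_tied mulr_natr.
have csum (x : R) : \sum_(k | A k) x = r%:R * x.
  by rewrite sumr_const card_tied mulr_natl.
(* The scores of [b0] sum to 0 over the block and have the same differences as those of [beta],
   hence are the centred scores exactly. *)
have F0 (i : 'I_n) : (i < r)%N -> score g b0 i = score g beta i - mean A (score g beta).
  move=> ir; apply: (mulfI (_ : r%:R != 0 :> R)); first by rewrite gt_eqF.
  rewrite [RHS]mulrBr; have -> : r%:R * mean A (score g beta) = \sum_(k | A k) score g beta k.
    by rewrite /mean card_tied mulrC divfK// gt_eqF.
  have -> : r%:R * score g beta i - \sum_(k | A k) score g beta k =
     \sum_(k | A k) (score g beta i - score g beta k).
    by rewrite -csum -sumrB.
  rewrite (eq_bigr (fun k => score g b0 i - score g b0 k)).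
    have -> : \sum_(k | A k) (score g b0 i - score g b0 k) =
        r%:R * score g b0 i - \sum_(k | A k) score g b0 k by rewrite -csum -sumrB.
    by rewrite (_ : \sum_(k | A k) score g b0 k = 0) ?subr0// b0sum.
  move=> k kr; rewrite (score_diff_tied ir kr (beta_tied ir kr)).
  by rewrite (score_diff_tied ir kr (b0tied _ _ ir kr)).
apply/andP; split.
  have -> : S = \sum_(i < n | (i < r)%N) score g b0 i ^+ 2 / v_tail r beta i.
    by rewrite SE; apply: eq_bigr => i ir; rewrite F0.
  apply: (lrt_lower b0M' _ _ _ hDM).
  + by apply/ThetaE.
  + move=> b' /ThetaE b'T; apply: b0max; rewrite /dirs /= => i j ir jr.
    by rewrite (b'T i j)// (beta_tied ir jr).
  + by move=> i ir; rewrite F0// (le_trans (ler_normB _ _))//; have := sD i; lra.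
(* The way back to the null set: every tied coordinate is moved to the block mean. *)
pose t (i : 'I_n) := if (i < r)%N then mean A b1 - b1 i else 0.
have Th : Theta (b1 \+ t).
  by apply/ThetaE => i j ir jr; rewrite /t /= ir jr ![b1 _ + _]addrC !subrK.
have meanb : 2 * `|mean A b1 - beta i0| <= M.
  have -> : mean A b1 - beta i0 = mean A (fun i => b1 i - beta i).
    rewrite /mean sumrB mulrBl; congr (_ - _).
    rewrite (eq_bigr (fun=> beta i0)) => [|i ir]; last exact: beta_tied.
    by rewrite sumr_const card_tied -[beta i0 *+ r]mulr_natl mulrC mulKf// gt_eqF.
  rewrite -ler_pdivlMl// /mean card_tied normrM normfV (gtr0_norm r0R) ler_pdivrMr//.
  rewrite (le_trans (ler_norm_sum _ _ _))//.
  apply: (@le_trans _ _ (\sum_(i | A i) 2^-1 * M)).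
    by rewrite ler_sum// => i _; have := b1M' i; lra.
  by rewrite sumr_const card_tied mulr_natr.
have tM i : `|t i| <= M.
  rewrite /t; case: ifP => ir; rewrite ?normr0//.
  rewrite (_ : _ - _ = (mean A b1 - beta i0) - (b1 i - beta i)); last by rewrite (beta_tied ir i0r); ring.
  by rewrite (le_trans (ler_normB _ _))//; have := b1M' i; lra.
have t0 (i : 'I_n) : (r <= i)%N -> t i = 0 by move=> ri; rewrite /t ltnNge ri.
have := lrt_upper b1M b1s b1max tM t0 Th; move=> /le_trans; apply.
rewrite -mulrA ler_wpM2l ?kappa_ge0//; first by exists i0.
set vt := v_tail r beta i0; have v0 : 0 < vt := v_tail_gt0 i0r.
have A0 : (0 < #|A|)%N by rewrite card_tied.
have -> : \sum_(i < n | (i < r)%N) v_tail r beta i * t i ^+ 2 =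
    vt * \sum_(i | A i) (b1 i - mean A b1) ^+ 2.
  rewrite mulr_sumr; apply: eq_bigr => i ir.
  by rewrite /t ir (v_tail_tied ir i0r) -/vt; ring.
have -> : S = vt^-1 * \sum_(i | A i) (score g beta i - mean A (score g beta)) ^+ 2.
  rewrite SE mulr_sumr; apply: eq_bigr => i ir.
  by rewrite (v_tail_tied ir i0r) mulrC.
(* Both sides become sums over pairs, compared term by term through the square of [mle_diff_tied],
   whence [expR (8 * M)]. *)
rewrite !sum_sqr_mean//.
rewrite [leLHS]mulrCA [leRHS]mulrA [leRHS]mulrCA ler_wpM2l//.
rewrite !mulr_sumr ler_sum// => i ir; rewrite !mulr_sumr ler_sum// => j jr.
have := mle_diff_tied b1M b1s ir jr; rewrite (v_tail_tied ir i0r) -/vt => h.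
have h2 : (vt * `|b1 i - b1 j|) ^+ 2 <= (expR (4 * M) * `|score g beta i - score g beta j|) ^+ 2.
  by rewrite ler_sqr ?nnegrE ?mulr_ge0 ?expR_ge0// ltW.
rewrite !exprMn !real_normK ?num_real// -expRM_natl in h2.
rewrite -(ler_pM2l v0) mulrA -expr2 (le_trans h2)//.
rewrite (_ : 2%:R * (4 * M) = 8 * M); last by ring.
by apply: le_of_eq; field; rewrite gt_eqF.
Qed.

End Sandwich.

(** * Laplace transforms of quadratic forms *)

Section ExpTaylor.
Variable R : realType.
Implicit Types x h w : R.

Lemma expR_sub1_le x : expR x - 1 <= x * expR x.
Proof.
have := expR_ge1Dx (- x); rewrite expRN => H.
have e0 := expR_gt0 x.
have : (1 - x) * expR x <= (expR x)^-1 * expR x by rewrite ler_pM2r.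
rewrite mulVf ?gt_eqF//; lra.
Qed.

Lemma expR_taylor1 x : 0 <= expR x - 1 - x <= x ^+ 2 * expR `|x|.
Proof.
have h1 := expR_ge1Dx x; have h2 := expR_sub1_le x.
apply/andP; split; first by lra.
have [x0|x0] := leP 0 x.
  rewrite ger0_norm//; have := ler_wpM2l x0 h2; rewrite expr2 -mulrA; lra.
apply: (@le_trans _ _ (x ^+ 2)).
  have x0' : 0 <= - x by lra.
  have := ler_wpM2l x0' h1; rewrite expr2; lra.
by rewrite ler_peMr ?sqr_ge0//; have := expR_ge1Dx `|x|; have := normr_ge0 x; lra.
Qed.

Lemma expR_taylor2 x : `|expR x - 1 - x - x ^+ 2 / 2| <= `|x| ^+ 3 * expR `|x|.
Proof.
pose F (t : R) := expR t - 1 - t - t ^+ 2 / 2.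
have dF (t : R) : is_derive t 1 F (expR t - 1 - t).
  have d2 := @is_deriveX _ _ id 2%N t 1 1 (is_derive_id _ _).
  have d3 := @is_deriveZ _ _ _ _ 2^-1 t 1 _ d2.
  have dE := is_derive_expR t.
  have d4 : is_derive t 1 (fun t : R => t ^+ 2 / 2) t.
    rewrite (_ : (fun _ => _) = 2^-1 \*: (id ^+ 2)); last first.
      by apply/funext => u; rewrite /= mulrC.
    apply: is_derive_eq d3 _.
    by rewrite /GRing.scale/= expr1; field.
  have d5 : is_derive t 1 (fun t : R => expR t - 1) (expR t).
    by apply: is_derive_eq; rewrite subr0.
  by rewrite /F; apply: is_deriveB.
have F0 : F 0 = 0 by rewrite /F expR0 expr0n/= mul0r; lra.
have cF (a b : R) : {within `[a, b], continuous F}.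
  apply: derivable_within_continuous => t _.
  exact: (@ex_derive _ _ _ _ _ _ _ (dF t)).
have bound (c : R) : `|c| <= `|x| -> `|expR c - 1 - c| <= `|x| ^+ 2 * expR `|x|.
  move=> cx; have /andP[c1 c2] := expR_taylor1 c.
  rewrite ger0_norm// (le_trans c2)//.
  rewrite ler_pM ?expR_ge0 ?sqr_ge0 ?ler_expR//.
  by rewrite -real_normK ?num_real// ler_sqr ?nnegrE.
rewrite -/(F x); have [x0|x0] := leP 0 x.
  have [c] := @MVT_segment _ F _ 0 x x0 (fun t _ => dF t) (cF 0 x).
  rewrite in_itv/= => /andP[c0 cx]; rewrite F0 !subr0 => ->.
  rewrite normrM exprSr -mulrA (mulrC `|x| (expR _)) mulrA ler_wpM2r//.
  by apply: bound; rewrite !ger0_norm.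
have [c] := @MVT_segment _ F _ x 0 (ltW x0) (fun t _ => dF t) (cF x 0).
rewrite in_itv/= => /andP[c0 cx]; rewrite F0 !sub0r => /(congr1 (fun u => `|u|)).
rewrite normrN normrM normrN => ->.
rewrite exprSr -mulrA (mulrC `|x| (expR _)) mulrA ler_wpM2r//.
by apply: bound; rewrite !ler0_norm ?lerN2// ltW.
Qed.

(** The first-order expansion in the time step [h] of the explicit heat solution. It has to be
    uniform in [q]: the powers of [q] in the Taylor remainder are absorbed by [expR (- q)]. *)
Lemma heat_step_bound (q h k : R) : 0 <= q -> 0 <= h -> h <= 2^-1 -> 0 <= k ->
  `|expR (- (k / 2 * ln (1 + h))) * expR (- (q / (1 + h)))
     - expR (- q) * (1 - k / 2 * h + h * q)| <= 72 * expR (k / 2) * h ^+ 2.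
Proof.
move=> q0 h0 h2 k0.
pose l := ln (1 + h).
have l1 : l <= h by apply: le_ln1Dx; lra.
have hh : h / (1 + h) <= h by rewrite ler_pdivrMr; nra.
have hh2 : h - h ^+ 2 <= h / (1 + h) by rewrite ler_pdivlMr; [nra|lra].
have l2 : h / (1 + h) <= l.
  have : ln (1 + h)^-1 <= (1 + h)^-1 - 1.
    rewrite -[X in ln X](subrK 1) addrC; apply: le_ln1Dx.
    have : 0 < (1 + h)^-1 by rewrite invr_gt0; lra.
    lra.
  rewrite lnV ?posrE; last by lra.
  rewrite -/l; have -> : (1 + h)^-1 - 1 = - (h / (1 + h)) by field; lra.
  lra.
pose w := q + k / 2.
have w0 : 0 <= w by rewrite /w; lra.
pose E := q * (h / (1 + h)) - k / 2 * l.
pose L := h * q - k / 2 * h.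
have -> : expR (- (k / 2 * ln (1 + h))) * expR (- (q / (1 + h))) = expR (- q) * expR E.
  by rewrite -!expRD -/l /E; congr expR; field; lra.
rewrite (_ : _ - _ = expR (- q) * ((expR E - 1 - E) + (E - L))); last by rewrite /L; ring.
have k2 : 0 <= k / 2 by lra.
have EL : `|E - L| <= w * h ^+ 2.
  rewrite /E /L /w ler_norml.
  have := ler_wpM2l q0 hh; have := ler_wpM2l q0 hh2.
  have := ler_wpM2l k2 l1; have := ler_wpM2l k2 (le_trans hh2 l2).
  have := mulr_ge0 q0 (sqr_ge0 h); have := mulr_ge0 k2 (sqr_ge0 h).
  by move: (h / (1 + h)) => u *; apply/andP; split; lra.
have hq : 0 <= h / (1 + h) by rewrite divr_ge0//; lra.
have Ew : `|E| <= w * h.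
  rewrite /E /w ler_norml.
  have := ler_wpM2l q0 hh; have := ler_wpM2l q0 hq.
  have := ler_wpM2l k2 l1; have := ler_wpM2l k2 (le_trans hq l2).
  have := mulr_ge0 q0 h0; have := mulr_ge0 k2 h0.
  by move: (h / (1 + h)) => u *; apply/andP; split; lra.
have wh : w * h <= w / 2 by rewrite ler_wpM2l.
have w8 : w <= 8 * expR (w / 8) by have := expR_ge1Dx (w / 8); lra.
(* The square costs [expR (w / 4)] and the Taylor remainder [expR (w / 2)]; their product
   [expR (3 / 4 * w)] is still beaten by [expR (- q)], up to a factor depending on [k] alone. The
   final 72 is 64 + 8. *)
have w82 : w ^+ 2 <= 64 * expR (w / 4).
  have -> : 64 * expR (w / 4) = (8 * expR (w / 8)) ^+ 2.
    by rewrite exprMn -expRM_natl; congr (_ * expR _); [ring|field].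
  by rewrite ler_sqr ?nnegrE ?mulr_ge0 ?expR_ge0.
have T1 : `|expR E - 1 - E| <= h ^+ 2 * (64 * expR (3 / 4 * w)).
  have /andP[c1 c2] := expR_taylor1 E; rewrite ger0_norm// (le_trans c2)//.
  apply: (@le_trans _ _ ((w * h) ^+ 2 * expR (w / 2))).
    rewrite ler_pM ?expR_ge0 ?sqr_ge0 ?ler_expR ?(le_trans Ew)//.
    by rewrite -real_normK ?num_real// ler_sqr ?nnegrE ?mulr_ge0.
  rewrite exprMn mulrAC mulrC ler_wpM2l ?sqr_ge0//.
  apply: (le_trans (ler_wpM2r (expR_ge0 _) w82)).
  by rewrite -[leLHS]mulrA -expRD ler_wpM2l// ler_expR; lra.
have T2 : `|E - L| <= h ^+ 2 * (8 * expR (3 / 4 * w)).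
  rewrite (le_trans EL)// mulrC ler_wpM2l ?sqr_ge0// (le_trans w8)//.
  by rewrite ler_wpM2l// ler_expR; lra.
rewrite normrM ger0_norm ?expR_ge0//.
apply: (@le_trans _ _ (expR (- q) * (h ^+ 2 * (72 * expR (3 / 4 * w))))).
  by rewrite ler_wpM2l ?expR_ge0// (le_trans (ler_normD _ _))//; lra.
rewrite (_ : _ * _ = 72 * (expR (- q) * expR (3 / 4 * w)) * h ^+ 2); last by ring.
rewrite ler_wpM2r ?sqr_ge0// ler_wpM2l// -expRD ler_expR /w; lra.
Qed.

End ExpTaylor.

Section QuadraticLaplace.
Variables (R : realType) (m : nat) (theta : R).
Hypothesis theta_idem : theta ^+ 2 * m%:R = theta.
Implicit Types x y : 'I_m -> R.

(* theta = 0 or 1/m: the squared norm of x, or of x minus its mean *)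
Definition quad x : R := \sum_i x i ^+ 2 - theta * (\sum_i x i) ^+ 2.
Definition proj x (i : 'I_m) : R := x i - theta * \sum_j x j.
(** The trace of the projection [proj], that is, [m] or [m - 1]. *)
Definition quad_rank : R := m%:R - theta * m%:R.

Lemma theta_ge0 : 0 <= theta.
Proof. by rewrite -theta_idem mulr_ge0 ?sqr_ge0. Qed.

Lemma theta_m_le1 : theta * m%:R <= 1.
Proof.
have [->|t0] := eqVneq theta 0; first by rewrite mul0r ler01.
have t1 : 0 < theta by rewrite lt_neqAle eq_sym t0 theta_ge0.
by rewrite -(ler_pM2l t1) mulrA -expr2 theta_idem mulr1.
Qed.

Lemma quad_rank_ge0 : 0 <= quad_rank.
Proof.
case: (posnP m) => m0; first by rewrite /quad_rank m0 mulr0 subr0.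
have := theta_m_le1; have : 1 <= m%:R :> R by rewrite ler1n.
by rewrite /quad_rank; lra.
Qed.

Lemma quad_rank_le : quad_rank <= m%:R.
Proof. by rewrite /quad_rank gerBl mulr_ge0// theta_ge0. Qed.

Lemma quad_proj x : quad x = \sum_i proj x i ^+ 2.
Proof.
set S := \sum_i x i.
rewrite (eq_bigr (fun i => x i ^+ 2 - (2 * theta * S) * x i + theta ^+ 2 * S ^+ 2)); last first.
  by move=> i _; rewrite /proj -/S; ring.
rewrite big_split /= sumrB -mulr_sumr sumr_const card_ord -[X in _ + X]mulr_natr -/S.
by rewrite -[X in _ + X]mulrA (mulrC (S ^+ 2)) mulrA theta_idem /quad -/S; ring.
Qed.

Lemma quad_ge0 x : 0 <= quad x.
Proof. by rewrite quad_proj sumr_ge0// => i _; rewrite sqr_ge0. Qed.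

Lemma quad_le_sum x : quad x <= \sum_i x i ^+ 2.
Proof. by rewrite /quad gerBl mulr_ge0 ?theta_ge0 ?sqr_ge0. Qed.

Lemma quadD x y : quad (x \+ y) = quad x + 2 * (\sum_i proj x i * y i) + quad y.
Proof.
rewrite /quad /= (eq_bigr (fun i => x i ^+ 2 + 2 * (x i * y i) + y i ^+ 2)); last first.
  by move=> i _; ring.
rewrite !big_split /= -mulr_sumr.
rewrite (eq_bigr (F1 := fun i => proj x i * y i) (fun i => x i * y i - theta * (\sum_j x j) * y i)); last first.
  by move=> i _; rewrite /proj; ring.
rewrite sumrB -mulr_sumr; ring.
Qed.

Lemma quadZ (c : R) x : quad (fun i => c * x i) = c ^+ 2 * quad x.
Proof.
rewrite /quad -mulr_sumr (eq_bigr (fun i => c ^+ 2 * x i ^+ 2)) => [|i _].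
  by rewrite -mulr_sumr exprMn; ring.
by rewrite exprMn.
Qed.

Lemma proj_le_quad x (y : R) i : 0 <= y -> quad x = y ^+ 2 -> `|proj x i| <= y.
Proof.
move=> y0 qy; rewrite -ler_sqr ?nnegrE// real_normK ?num_real// -qy quad_proj.
by rewrite (bigD1 i)//= lerDl sumr_ge0// => j _; rewrite sqr_ge0.
Qed.

(* the increments are deterministically of size c, so the third-order Taylor
   remainder is O(c^3) and only the first two moments are computed *)
Section Step.
Variables (I : finType) (p : I -> R) (e : 'I_m -> I) (nu c : R).
Hypotheses (p01 : forall k, 0 <= p k <= 1) (e_inj : injective e).
Hypothesis e_var : forall i, p (e i) * (1 - p (e i)) = nu.
Hypotheses (c0 : 0 <= c) (mc : m%:R * c <= 2^-1).

Let xi (a : {ffun I -> bool}) (i : 'I_m) : R := c * centered p (e i) a.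

Lemma expect_lin x : expect p (fun a => \sum_i proj x i * xi a i) = 0.
Proof.
rewrite expect_sum big1// => i _.
under eq_expect do rewrite /xi mulrA.
by rewrite expectZl expect_centered mulr0.
Qed.

Lemma expect_lin_sqr (y : 'I_m -> R) :
  expect p (fun a => (\sum_i y i * xi a i) ^+ 2) = c ^+ 2 * nu * \sum_i y i ^+ 2.
Proof.
rewrite (@eq_expect _ _ p _ (fun a => \sum_i \sum_j (y i * y j * c ^+ 2) *
   (centered p (e i) a * centered p (e j) a))); last first.
  move=> a; rewrite expr2 mulr_suml; apply: eq_bigr => i _.
  by rewrite mulr_sumr; apply: eq_bigr => j _; rewrite /xi; ring.
rewrite expect_sum mulr_sumr; apply: eq_bigr => i _.
rewrite expect_sum (bigD1 i)//= [X in _ + X]big1 ?addr0.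
  rewrite expectZl (@eq_expect _ _ p _ (fun a => centered p (e i) a ^+ 2)) => [|a]; last by rewrite expr2.
  by rewrite expect_centered_sqr e_var; ring.
move=> j ji; rewrite expectZl expect_centeredM ?mulr0//.
by apply: contra ji => /eqP/e_inj ->.
Qed.

Lemma expect_quad : expect p (fun a => quad (xi a)) = c ^+ 2 * nu * quad_rank.
Proof.
rewrite expectB expectZl expect_sum.
have -> : expect p (fun a => (\sum_i xi a i) ^+ 2) = c ^+ 2 * nu * m%:R.
  rewrite (@eq_expect _ _ p _ (fun a => (\sum_i 1 * xi a i) ^+ 2)); last first.
    by move=> a; congr (_ ^+ 2); apply: eq_bigr => i _; rewrite mul1r.
  rewrite expect_lin_sqr (eq_bigr (fun=> 1)) => [|i _]; last by rewrite expr1n.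
  by rewrite sumr_const card_ord.
rewrite (eq_bigr (fun=> c ^+ 2 * nu)) => [|i _]; last first.
  rewrite (@eq_expect _ _ p _ (fun a => c ^+ 2 * centered p (e i) a ^+ 2)) => [|a]; last by rewrite /xi exprMn.
  by rewrite expectZl expect_centered_sqr e_var.
by rewrite sumr_const card_ord -[X in X - _]mulr_natr /quad_rank; ring.
Qed.

Lemma xi_bound a i : `|xi a i| <= c.
Proof. by rewrite normrM ger0_norm// ler_piMr// centered_bound. Qed.

(** 17 is the maximum of [8 y + 1 - y^2], where [y] is the square root of [quad x]; the second
    summand accounts for [heat_step_bound]. *)
Definition step_const : R := 2 * expR 17 + 288 * expR (m%:R / 2).

Lemma step_const_ge0 : 0 <= step_const.
Proof.
rewrite /step_const; have := expR_ge0 (17 : R); have := expR_ge0 (m%:R / 2 : R).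
by move: (expR _) (expR _) => u v; lra.
Qed.

(** With [z = - (2 q1 + q2)], the linear part [q1] has mean 0, while [2 q1 ^+ 2] and [q2] have means
    [h q] and [k h / 2]. These are the terms of the heat step of length [h = 2 c^2 nu], so the two
    sides differ by third-order remainders only. *)
Lemma step_error x :
  `|expect p (fun a => expR (- quad (x \+ xi a))) -
    expR (- (quad_rank / 2 * ln (1 + 2 * (c ^+ 2 * nu))))
      * expR (- (quad x / (1 + 2 * (c ^+ 2 * nu))))|
  <= step_const * (m%:R * c) ^+ 3.
Proof.
case: (posnP m) => m0.
  have q0 z : quad z = 0.
    apply/eqP; rewrite eq_le quad_ge0 (le_trans (quad_le_sum _))// big1// => i _.
    by have := leq_ltn_trans (leq0n i) (ltn_ord i); rewrite m0.
  have k0 : quad_rank = 0 by rewrite /quad_rank m0 mulr0 subr0.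
  under eq_expect do rewrite q0.
  rewrite expect_cst q0 k0 !mul0r oppr0 expR0 mulr1 subrr normr0.
  by rewrite m0 mul0r expr0n/= mulr0.
set d := m%:R * c; have d1 : d <= 2^-1 := mc.
have d0 : 0 <= d by rewrite mulr_ge0.
have cd : c <= d by rewrite ler_peMl// ler1n.
have nu1 : 0 <= nu <= 4^-1.
  rewrite -(e_var (Ordinal m0)); have := p01 (e (Ordinal m0)); have := sqr_ge0 (1 - 2 * p (e (Ordinal m0))).
  by move: (p _) => q; nra.
set h := 2 * (c ^+ 2 * nu).
have c2d2 : c ^+ 2 <= d ^+ 2 by rewrite ler_sqr ?nnegrE.
have h0 : 0 <= h by rewrite mulr_ge0// mulr_ge0 ?sqr_ge0//; case/andP: nu1.
have hc : h <= 2^-1 * d ^+ 2.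
  have /andP[n0 n1] := nu1; have : c ^+ 2 * nu <= d ^+ 2 * 4^-1 by rewrite ler_pM ?sqr_ge0.
  by rewrite /h; lra.
have d21 : d ^+ 2 <= 4^-1 by nra.
have h2 : h <= 2^-1 by lra.
set k := quad_rank; have k0 : 0 <= k := quad_rank_ge0.
set q := quad x; have q0 : 0 <= q := quad_ge0 x.
pose y := Num.sqrt q; have y0 : 0 <= y by rewrite sqrtr_ge0.
have yq : q = y ^+ 2 by rewrite sqr_sqrtr.
pose q1 a := \sum_i proj x i * xi a i; pose q2 a := quad (xi a).
have q1B a : `|q1 a| <= d * y.
  rewrite (le_trans (ler_norm_sum _ _ _))// (@le_trans _ _ (\sum_(i < m) y * c))//.
    by rewrite ler_sum// => i _; rewrite normrM ler_pM ?xi_bound// proj_le_quad.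
  by rewrite sumr_const card_ord -[leLHS]mulr_natr /d; lra.
have q2B a : 0 <= q2 a <= d ^+ 2.
  rewrite quad_ge0 (le_trans (quad_le_sum _))// (@le_trans _ _ (\sum_(i < m) c ^+ 2))//.
    rewrite ler_sum// => i _; rewrite -real_normK ?num_real// ler_sqr ?nnegrE//.
    exact: xi_bound.
  rewrite sumr_const card_ord -[leLHS]mulr_natr /d exprMn mulrC ler_wpM2r ?sqr_ge0//.
  by rewrite ler_eXnr// ler1n.
pose z a := - (2 * q1 a + q2 a).
have zB a : `|z a| <= d * (2 * y + 1).
  rewrite normrN (le_trans (ler_normD _ _))// normrM (ger0_norm (_ : 0 <= 2))//.
  have /andP[u1 u2] := q2B a; rewrite (ger0_norm u1).
  have := q1B a; have : d ^+ 2 <= d * 1 by rewrite expr2 ler_wpM2l//; lra.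
  lra.
pose main a := 1 - 2 * q1 a - q2 a + 2 * q1 a ^+ 2.
have remB a : `|expR (z a) - main a| <= d ^+ 3 * (2 * expR (8 * y + 1)).
  have -> : expR (z a) - main a = (expR (z a) - 1 - z a - z a ^+ 2 / 2)
      + (2 * (q1 a * q2 a) + q2 a ^+ 2 / 2) by rewrite /main /z; field.
  rewrite (le_trans (ler_normD _ _))//.
  have w1 : 1 <= 2 * y + 1 by lra.
  have ew : 2 * y + 1 <= expR (2 * y) by rewrite addrC expR_ge1Dx.
  have p3 : (2 * y + 1) ^+ 3 <= expR (6 * y).
    have -> : expR (6 * y) = expR (2 * y) ^+ 3 by rewrite -expRM_natl; congr expR; ring.
    by rewrite lerXn2r ?nnegrE ?expR_ge0//; lra.
  have t1 : `|expR (z a) - 1 - z a - z a ^+ 2 / 2| <= d ^+ 3 * expR (8 * y + 1).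
    rewrite (le_trans (expR_taylor2 _))//.
    apply: (@le_trans _ _ ((d * (2 * y + 1)) ^+ 3 * expR (2 * y + 1))).
      rewrite ler_pM ?expR_ge0 ?exprn_ge0//.
        by rewrite lerXn2r ?nnegrE// (le_trans _ (zB a)).
      rewrite ler_expR (le_trans (zB a))// ler_piMl//; lra.
    rewrite exprMn -mulrA ler_wpM2l ?exprn_ge0//.
    have -> : 8 * y + 1 = 6 * y + (2 * y + 1) by ring.
    by rewrite [in leRHS]expRD ler_wpM2r ?expR_ge0.
  have /andP[u1 u2] := q2B a.
  have t2 : `|2 * (q1 a * q2 a) + q2 a ^+ 2 / 2| <= d ^+ 3 * (2 * y + 1).
    rewrite (le_trans (ler_normD _ _))//.
    have -> : `|2 * (q1 a * q2 a)| = 2 * (`|q1 a| * q2 a).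
      by rewrite !normrM (ger0_norm u1) (ger0_norm (ler0n R 2)).
    have -> : `|q2 a ^+ 2 / 2| = q2 a ^+ 2 / 2 by rewrite ger0_norm// divr_ge0// sqr_ge0.
    have s1 : `|q1 a| * q2 a <= d * y * d ^+ 2 by rewrite ler_pM.
    have s2 : q2 a ^+ 2 <= d ^+ 2 * d ^+ 2 by rewrite expr2 ler_pM.
    have s3 : d ^+ 3 * d <= d ^+ 3 * 2 by rewrite ler_wpM2l ?exprn_ge0//; lra.
    have -> : d ^+ 3 * (2 * y + 1) = 2 * (d * y * d ^+ 2) + d ^+ 3 by ring.
    have e4 : d ^+ 2 * d ^+ 2 = d ^+ 3 * d by ring.
    by rewrite e4 in s2; lra.
  have : d ^+ 3 * (2 * y + 1) <= d ^+ 3 * expR (8 * y + 1).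
    rewrite ler_wpM2l ?exprn_ge0// (le_trans ew)// ler_expR; lra.
  lra.
have expE a : expR (- quad (x \+ xi a)) = expR (- q) * expR (z a).
  by rewrite quadD -expRD; congr expR; rewrite /z /q1 /q2 /q; ring.
have mainE : expect p main = 1 - k / 2 * h + h * q.
  rewrite /main expectD expectB expectB expect_cst !expectZl expect_lin expect_quad expect_lin_sqr.
  by rewrite -quad_proj -/q -/k /h; field.
have := heat_step_bound q0 h0 h2 k0; rewrite -mainE => B2.
set tgt := expR (- (k / 2 * ln (1 + h))) * _ in B2 *.
have B1 : `|expect p (fun a => expR (- quad (x \+ xi a))) - expR (- q) * expect p main|
    <= 2 * expR 17 * d ^+ 3.
  rewrite -expectZl -expectB (le_trans (ler_norm_expect p01 _))//.
  rewrite -[leRHS](expect_cst p) ler_expect// => a.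
  rewrite expE -mulrBr normrM ger0_norm ?expR_ge0//.
  apply: (le_trans (ler_wpM2l (expR_ge0 _) (remB a))).
  rewrite [leLHS](_ : _ = 2 * (expR (- q) * expR (8 * y + 1)) * d ^+ 3); last by ring.
  rewrite ler_wpM2r ?exprn_ge0// ler_wpM2l// -expRD ler_expR yq.
  have := sqr_ge0 (y - 4); nra.
rewrite -[X in `|X|](subrKA (expR (- q) * expect p main)).
rewrite (le_trans (ler_normD _ _))//.
rewrite [X in _ + X <= _]distrC /step_const mulrDl lerD//.
rewrite (le_trans B2)//.
apply: (@le_trans _ _ (72 * expR (m%:R / 2) * (d ^+ 2 * d ^+ 2))).
  apply: ler_pM; rewrite ?sqr_ge0 ?mulr_ge0 ?expR_ge0//.
    by rewrite ler_wpM2l// ler_expR ler_wpM2r// quad_rank_le.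
  by rewrite -expr2 ler_sqr ?nnegrE ?sqr_ge0//; have := sqr_ge0 d; lra.
have : 72 * expR (m%:R / 2) * (d ^+ 2 * d ^+ 2) = 72 * expR (m%:R / 2) * d ^+ 3 * d by ring.
move=> ->; rewrite -[leRHS]mulr1.
have P0 : 0 <= expR (m%:R / 2) * d ^+ 3 by rewrite mulr_ge0 ?expR_ge0 ?exprn_ge0.
have := ler_wpM2l P0 d1; lra.
Qed.

End Step.

Section Iterate.
Variables (I : finType) (J : eqType) (p : I -> R) (e : J -> 'I_m -> I) (nu : J -> R).
Variables (c s : R).
Hypotheses (p01 : forall k, 0 <= p k <= 1).
Hypothesis e_inj : forall j j' i i', e j i = e j' i' -> j = j' /\ i = i'.
Hypotheses (c0 : 0 <= c) (s0 : 0 <= s) (mc : m%:R * (Num.sqrt s * c) <= 2^-1).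

Definition block_sum (l : seq J) (a : {ffun I -> bool}) (i : 'I_m) : R :=
  \sum_(j <- l) c * centered p (e j i) a.
Definition block_var (l : seq J) : R := \sum_(j <- l) c ^+ 2 * nu j.

(** Lindeberg replacement, one block at a time. [x] is arbitrary because the induction hypothesis is
    applied conditionally on the first block, which shifts the starting point. *)
Lemma laplace_block_sum (l : seq J) x : uniq l ->
  (forall j i, j \in l -> p (e j i) * (1 - p (e j i)) = nu j) ->
  (forall j, j \in l -> 0 <= nu j) ->
  `|expect p (fun a => expR (- (s * quad (x \+ block_sum l a)))) -
    expR (- (quad_rank / 2 * ln (1 + 2 * s * block_var l)))
      * expR (- (s * quad x / (1 + 2 * s * block_var l)))|
  <= (size l)%:R * (step_const * (m%:R * (Num.sqrt s * c)) ^+ 3).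
Proof.
elim: l x => [|j l IH] x /=.
  move=> _ _ _; rewrite /block_var big_nil mulr0 addr0 ln1 mulr0 oppr0 expR0 mul1r divr1 mul0r.
  rewrite (@eq_expect _ _ p _ (fun=> expR (- (s * quad x)))) ?expect_cst ?subrr ?normr0// => a.
  congr (expR (- (s * quad _))); apply/funext => i.
  by rewrite /block_sum /= big_nil addr0.
move=> /andP[jl ul] var nu0.
set K := step_const * _.
have varj i : p (e j i) * (1 - p (e j i)) = nu j by apply: var; rewrite inE eqxx.
have nuj : 0 <= nu j by apply: nu0; rewrite inE eqxx.
have bv0 : 0 <= block_var l.
  rewrite /block_var big_seq sumr_ge0// => j' j'l; rewrite mulr_ge0 ?sqr_ge0//.
  by apply: nu0; rewrite inE j'l orbT.
pose T := 1 + 2 * s * block_var l.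
have T1 : 1 <= T by rewrite lerDl mulr_ge0// mulr_ge0.
have T0 : 0 < T by lra.
(* After the remaining blocks are replaced, the form carries the parameter [s / T]; scaling by its
   square root reduces the first block to [step_error]. *)
pose s' := s / T.
have s'0 : 0 <= s' by rewrite divr_ge0// ltW.
have s's : s' <= s by rewrite ler_pdivrMr// ler_peMr.
pose xi a i := c * centered p (e j i) a.
pose A : pred I := fun u => [exists i, u == e j i].
have splitE a a' : x \+ block_sum (j :: l) (ffun_merge A a a') =
    (x \+ xi a) \+ block_sum l a'.
  apply/funext => i; rewrite /block_sum /= big_cons -addrA /xi; congr (_ + (_ + _)).
    by rewrite /centered ffunE /A ifT//; apply/existsP; exists i.
  apply: eq_big_seq => j' j'l; rewrite /centered ffunE /A ifF//.
  apply/negbTE/negP => /existsP[i' /eqP/e_inj[jj' _]].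
  by move: jl; rewrite -jj' j'l.
rewrite (expect_merge p A).
under eq_expect do under eq_expect do rewrite splitE.
have B1 a : `|expect p (fun a' => expR (- (s * quad ((x \+ xi a) \+ block_sum l a')))) -
     expR (- (quad_rank / 2 * ln T)) * expR (- (s * quad (x \+ xi a) / T))| <= (size l)%:R * K.
  apply: IH => // [j' i j'l|j' j'l]; first by apply: var; rewrite inE j'l orbT.
  by apply: nu0; rewrite inE j'l orbT.
pose pref := expR (- (quad_rank / 2 * ln T)).
have pref01 : 0 <= pref <= 1.
  rewrite expR_ge0 expR_le1 oppr_le0 mulr_ge0 ?divr_ge0 ?quad_rank_ge0// ln_ge0//.
have rs' : Num.sqrt s' ^+ 2 = s' by rewrite sqr_sqrtr.
have mc' : m%:R * (Num.sqrt s' * c) <= 2^-1.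
  apply: le_trans mc; rewrite ler_wpM2l// ler_wpM2r//.
  by rewrite ler_wsqrtr.
have := @step_error I p (e j) (nu j) (Num.sqrt s' * c) p01 _ varj _ mc'
  (fun i => Num.sqrt s' * x i).
rewrite exprMn rs' => B2.
have {}B2 : `|expect p (fun a => expR (- (s * quad (x \+ xi a) / T))) -
   expR (- (quad_rank / 2 * ln (1 + 2 * (s' * c ^+ 2 * nu j)))) *
   expR (- (s' * quad x / (1 + 2 * (s' * c ^+ 2 * nu j))))| <= K.
  have := B2 _ _; rewrite quadZ rs'.
  have -> : expect p (fun a => expR (- quad ((fun i => Num.sqrt s' * x i) \+
       (fun i => Num.sqrt s' * c * centered p (e j i) a)))) =
     expect p (fun a => expR (- (s * quad (x \+ xi a) / T))).
    apply: eq_expect => a; congr (expR (- _)).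
    rewrite (_ : _ \+ _ = (fun i => Num.sqrt s' * (x \+ xi a) i)).
      by rewrite quadZ rs' /s' mulrAC.
    by apply/funext => i; rewrite /xi /=; ring.
  move=> H; apply: (le_trans (H _ _)).
  - by move=> i i' /e_inj[].
  - by rewrite mulr_ge0 ?sqrtr_ge0.
  rewrite ler_wpM2l ?step_const_ge0//.
  rewrite lerXn2r ?nnegrE ?mulr_ge0 ?sqrtr_ge0//.
  by rewrite ler_wpM2l// ler_wpM2r// ler_wsqrtr.
(* The semigroup property of the heat solution: variances add up as the factors [T] multiply. *)
have TE : 1 + 2 * s * block_var (j :: l) = T * (1 + 2 * (s' * c ^+ 2 * nu j)).
  by rewrite /block_var big_cons -/(block_var l) /s' -/T; rewrite (_ : 1 + 2 * s * (c ^+ 2 * nu j + block_var l) = T + 2 * s * c ^+ 2 * nu j); [by field; rewrite gt_eqF|by rewrite /T; ring].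
have U1 : 1 <= 1 + 2 * (s' * c ^+ 2 * nu j).
  by rewrite lerDl mulr_ge0// mulr_ge0// mulr_ge0 ?sqr_ge0.
have U0 : 0 < 1 + 2 * (s' * c ^+ 2 * nu j) by lra.
have tgtE : expR (- (quad_rank / 2 * ln (1 + 2 * s * block_var (j :: l))))
      * expR (- (s * quad x / (1 + 2 * s * block_var (j :: l)))) =
  pref * (expR (- (quad_rank / 2 * ln (1 + 2 * (s' * c ^+ 2 * nu j)))) *
   expR (- (s' * quad x / (1 + 2 * (s' * c ^+ 2 * nu j))))).
  have -> : expR (- (quad_rank / 2 * ln (1 + 2 * s * block_var (j :: l)))) =
      pref * expR (- (quad_rank / 2 * ln (1 + 2 * (s' * c ^+ 2 * nu j)))).
    by rewrite TE lnM ?posrE// -expRD; congr expR; ring.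
  rewrite TE -mulrA; congr (_ * (_ * expR (- _))).
  move: U0; rewrite /s' => U0; rewrite invfM; ring.
rewrite tgtE.
set F := expect p (fun a => expect p _).
set G := expect p (fun a => expR (- (s * quad (x \+ xi a) / T))) in B2.
set tg := expR (- (quad_rank / 2 * ln (1 + 2 * (s' * c ^+ 2 * nu j)))) * _ in B2 *.
(* Errors just add, since the prefactor of the last step is at most 1. *)
rewrite -(subrKA (pref * G)) (le_trans (ler_normD _ _))//.
rewrite -natr1 mulrDl mul1r lerD//.
  rewrite /F /G -expectZl -expectB (le_trans (ler_norm_expect p01 _))//.
  by rewrite -[leRHS](expect_cst p) ler_expect.
rewrite -mulrBr normrM (le_trans _ B2)// ler_piMl//.
by case/andP: pref01 => q0 q1; rewrite ger0_norm.
Qed.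

End Iterate.

End QuadraticLaplace.

(** * The chi-square law *)

Section LebesgueScaling.
Variable R : realType.
Local Notation mu := (@lebesgue_measure R).
Local Open Scope ereal_scope.

Definition dilation (c : R) : R -> R := fun t => (c * t)%R.

Lemma measurable_dilation (c : R) :
  @measurable_fun _ _ (measurableTypeR R) (measurableTypeR R) setT (dilation c).
Proof. by apply: measurable_funM => //; exact: measurable_id. Qed.

Let dilated (c : R) : {measure set (measurableTypeR R) -> \bar R} :=
  measure_function_pushforward__canonical__measure_function_Measure mu
    (measurable_dilation c).

(** By uniqueness of the Lebesgue measure the identity is checked on half-open intervals only. *)
Lemma lebesgue_measure_dilation (c : R) (c0 : (0 < c)%R) (A : set R) : measurable A ->
  mu A = mscale (NngNum (ltW c0)) (dilated c) A.
Proof.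
move=> mA; apply/lebesgue_measure_unique => //= _ [[a b]] _ <-.
rewrite /mscale /= /pushforward.
rewrite (_ : _ @^-1` _ = `](a / c)%R, (b / c)%R]%classic); last first.
  apply/seteqP; split => t /=; rewrite !in_itv/= /dilation;
    by rewrite ltr_pdivrMr// ler_pdivlMr// ![(t * c)%R]mulrC.
rewrite !lebesgue_measure_itv/= !lte_fin ltr_pM2r ?invr_gt0//.
case: ifPn => _; last by rewrite mule0.
by rewrite -!EFinD -EFinM; congr EFin; field; rewrite gt_eqF.
Qed.

Lemma ge0_integral_scale (c : R) (f : R -> R) : (0 < c)%R ->
  measurable_fun [set: R] f -> (forall t, 0 <= f t)%R ->
  \int[mu]_t (f t)%:E = c%:E * \int[mu]_t (f (c * t)%R)%:E.
Proof.
move=> c0 mf f0.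
have mE : measurable_fun setT (EFin \o f : measurableTypeR R -> \bar R).
  exact/measurable_EFinP.
transitivity (\int[mscale (NngNum (ltW c0)) (dilated c)]_t (EFin \o f) t).
  by apply: eq_measure_integral => A mA _; first [exact: lebesgue_measure_dilation|exact/esym/lebesgue_measure_dilation].
rewrite ge0_integral_mscale//; last by move=> x _; rewrite lee_fin.
rewrite ge0_integral_pushforward//; first exact: measurable_dilation.
by move=> x _; rewrite lee_fin.
Qed.

End LebesgueScaling.

(** * Integrability and Laplace transform of the chi-square density *)

Section ChiSquareDensity.
Variables (R : realType) (k : nat).
Hypothesis k0 : (0 < k)%N.
Local Notation mu := (@lebesgue_measure R).
Local Notation dens := (@chisq_dens R k).
Let alpha : R := k%:R / 2.

Lemma chisq_dens_ge0 t : 0 <= dens t.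
Proof. by rewrite /chisq_dens; case: ifP => // _; rewrite mulr_ge0 ?powR_ge0 ?expR_ge0. Qed.

Lemma chisq_dens_le0 t : t <= 0 -> dens t = 0.
Proof. by rewrite /chisq_dens leNgt => /negbTE ->. Qed.

Lemma alpha_gt0 : 0 < alpha.
Proof. by rewrite divr_gt0// ltr0n. Qed.

Lemma measurable_chisq_dens : measurable_fun setT dens.
Proof.
apply: measurable_fun_ifT => //.
  exact: measurable_fun_ltr.
apply: measurable_funM; first exact: measurable_powR.
apply: measurableT_comp => //.
by apply: measurableT_comp => //; apply: measurable_funM.
Qed.

(* [F] is bounded and its derivative [f] dominates a multiple of the density. *)
Let F (t : R) : R := - (1 + t `^ alpha)^-1.
Let f (t : R) : R := alpha * t `^ (alpha - 1) / (1 + t `^ alpha) ^+ 2.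

Lemma is_derive_F (t : R) : 0 < t -> is_derive t 1 F (f t).
Proof.
move=> t0.
have d1 := is_derive1_powR alpha t0.
have d2 : is_derive t 1 (fun t : R => 1 + t `^ alpha) (alpha * t `^ (alpha - 1)).
  by have := is_deriveD (is_derive_cst (1 : R) t 1) d1; rewrite add0r.
have n0 : 1 + t `^ alpha != 0 by rewrite gt_eqF// ltr_pwDl// powR_ge0.
have d3 := @is_deriveV _ (fun t : R => 1 + t `^ alpha) t _ _ n0 d2.
have := is_deriveN d3.
rewrite (_ : - _ = f t) //.
by rewrite /f /GRing.scale/= mulNr opprK mulrC.
Qed.

(** One comparison treats both the possible singularity at 0 and the tail: the ratio is a multiple
    of [(1 + t^alpha)^2 expR (- t / 2)], and [t^alpha] squared is [t ^+ k]. *)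
Lemma powR_le_dens_bound t : 0 < t ->
  dens t <= (2 + 2 * (2 * k%:R) ^+ k) / alpha * f t.
Proof.
move=> t0; rewrite /chisq_dens t0 /f.
have a0 := alpha_gt0.
set w := t `^ alpha; have w0 : 0 <= w by exact: powR_ge0.
have w2 : w ^+ 2 = t ^+ k.
  by rewrite -powR_mulrn// /w -powRrM /alpha divfK ?pnatr_eq0// powR_mulrn// ltW.
set K := (2 * k%:R) ^+ k.
have kR : 0 < k%:R :> R by rewrite ltr0n.
(* The [k]-th power of [u <= expR u] at [u = t / (2 k)]. *)
have tk : t ^+ k <= K * expR (t / 2).
  have -> : t ^+ k = K * (t / (2 * k%:R)) ^+ k.
    by rewrite -exprMn mulrC divfK// mulf_neq0// ?pnatr_eq0 ?gt_eqF.
  rewrite ler_wpM2l ?exprn_ge0 ?mulr_ge0//.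
  have -> : expR (t / 2) = expR (t / (2 * k%:R)) ^+ k.
    by rewrite -expRM_natl; congr expR; field; rewrite gt_eqF.
  have u0 : 0 <= t / (2 * k%:R) by rewrite divr_ge0 ?mulr_ge0// ltW.
  rewrite lerXn2r ?nnegrE ?expR_ge0//.
  by have := expR_ge1Dx (t / (2 * k%:R)); lra.
have e1 : 1 <= expR (t / 2) by have := expR_ge1Dx (t / 2); lra.
have bd : (1 + w) ^+ 2 * expR (- (t / 2)) <= 2 + 2 * K.
  have : (1 + w) ^+ 2 <= (2 + 2 * K) * expR (t / 2).
    have := sqr_ge0 (1 - w); rewrite !expr2 in w2 *; nra.
  by rewrite expRN ler_pdivrMr ?expR_gt0.
have n0 : 0 < (1 + w) ^+ 2 by rewrite exprn_gt0//; lra.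
have p0 : 0 <= t `^ (alpha - 1) by exact: powR_ge0.
have -> : (2 + 2 * K) / alpha * (alpha * t `^ (alpha - 1) / (1 + w) ^+ 2) =
  t `^ (alpha - 1) * ((2 + 2 * K) / (1 + w) ^+ 2).
  by field; rewrite !gt_eqF//; lra.
by rewrite ler_wpM2l// ler_pdivlMr// mulrC.
Qed.

Lemma f_ge0 t : 0 <= f t.
Proof.
by rewrite /f divr_ge0 ?sqr_ge0// mulr_ge0 ?powR_ge0// ltW// alpha_gt0.
Qed.

Lemma continuous_f (t : R) : 0 < t -> f @ t --> f t.
Proof.
move=> t0.
  have cp (r : R) : (fun t : R => t `^ r) @ t --> t `^ r.
    have /derivable1_diffP/differentiable_continuous : derivable (fun t : R => t `^ r) t 1.
      by case: (is_derive1_powR r t0).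
    exact.
  apply: cvgM; first by apply: cvgM; [exact: cvg_cst|exact: cp].
  apply: cvgV.
    by rewrite expf_neq0// gt_eqF// ltr_pwDl// powR_ge0.
  by apply: cvgM; apply: cvgD => //; exact: cvg_cst.
Qed.

Lemma integral_f_le1 (a b : R) : 0 < a -> a < b ->
  (\int[mu]_(t in `[a, b]) (f t)%:E <= 1)%E.
Proof.
move=> a0 ab.
have d0 (t : R) : 0 < t -> derivable F t 1 by move=> t0; case: (is_derive_F t0).
have cF (t : R) : 0 < t -> F @ t --> F t.
  by move=> t0; apply: differentiable_continuous; apply/derivable1_diffP/d0.
rewrite (continuous_FTC2 (F := F) ab).
- rewrite -EFinB lee_fin /F opprK.
  have h1 : (1 + a `^ alpha)^-1 <= 1.
    by rewrite invf_le1 ?lerDl ?powR_ge0// ltr_pwDl// powR_ge0.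
  have h2 : 0 <= (1 + b `^ alpha)^-1 by rewrite invr_ge0 addr_ge0// powR_ge0.
  lra.
- apply: continuous_in_subspaceT => t; rewrite inE/= in_itv/= => /andP[at_ _].
  by apply: continuous_f; exact: lt_le_trans at_.
- split.
  + by move=> t; rewrite in_itv/= => /andP[at_ _]; apply: d0; exact: lt_trans at_.
  + by apply: cvg_at_right_filter; exact: cF.
  + by apply: cvg_at_left_filter; apply: cF; exact: lt_trans ab.
- move=> t; rewrite in_itv/= => /andP[at_ _].
  have t0 : 0 < t by exact: lt_trans at_.
  by case: (is_derive_F t0) => _; rewrite derive1E.
Qed.

(** On each interval [[1/(n+2), n+2]] the domination by a multiple of [f], the derivative of a
    bounded function, gives the same bound [K]; these intervals exhaust the positive axis. *)
Lemma chisq_dens_integral_fin : (\int[mu]_t (dens t)%:E < +oo)%E.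
Proof.
have mdens : measurable_fun [set: R] (EFin \o dens).
  by apply/measurable_EFinP; exact: measurable_chisq_dens.
pose K : R := (2 + 2 * (2 * k%:R) ^+ k) / alpha.
have K0 : 0 <= K.
  by rewrite divr_ge0 ?(ltW alpha_gt0)// addr_ge0// mulr_ge0// exprn_ge0// mulr_ge0.
pose Dn (n : nat) : set R := `[n.+2%:R^-1, n.+2%:R]%classic.
have a0 (n : nat) : 0 < n.+2%:R^-1 :> R by rewrite invr_gt0 ltr0n.
have ab (n : nat) : n.+2%:R^-1 < n.+2%:R :> R.
  by rewrite (@lt_trans _ _ 1)// ?invf_lt1 ?ltr0n ?ltr1n.
have Z : (\int[mu]_t (dens t)%:E = \int[mu]_(t in \bigcup_n Dn n) (dens t)%:E)%E.
  rewrite [RHS]integral_mkcond; apply: eq_integral => t _.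
  rewrite /patch; case: ifPn => // tD; rewrite chisq_dens_le0//.
  rewrite leNgt; apply: contra tD => t0; rewrite inE.
  have [n nt] : exists n : nat, t <= n.+2%:R /\ t^-1 <= n.+2%:R.
    exists (Num.truncn (t + t^-1)).
    have ti : 0 < t^-1 by rewrite invr_gt0.
    have h : t + t^-1 <= (Num.truncn (t + t^-1)).+2%:R.
      by rewrite (le_trans (ltW (truncnS_gt _)))// ler_nat.
    by split; lra.
  exists n => //; rewrite /Dn/= in_itv/=; case: nt => -> h; rewrite andbT.
  by rewrite -[leRHS]invrK lef_pV2 ?posrE ?ltr0n ?invr_gt0.
rewrite Z.
apply: (@le_lt_trans _ _ K%:E); last exact: ltry.
have cvg : ((\int[mu]_(x in Dn i) (dens x)%:E)%E @[i --> \oo] --> (\int[mu]_(x in \bigcup_i Dn i) (dens x)%:E)%E).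
  apply: ge0_nondecreasing_set_cvg_integral.
  - apply/nondecreasing_seqP => n; rewrite /Dn subsetEset => t /=; rewrite !in_itv/= => /andP[h1 h2].
    apply/andP; split; last by rewrite (le_trans h2)// ler_nat.
    by rewrite (le_trans _ h1)// lef_pV2 ?posrE ?ltr0n// ler_nat.
  - by move=> i; exact: measurable_itv.
  - by move=> i; exact: measurable_funS mdens.
  - by move=> i x _; rewrite lee_fin chisq_dens_ge0.
apply: (cvge_le _ cvg); apply: nearW => n.
have mf : measurable_fun (Dn n) f.
  apply: subspace_continuous_measurable_fun; first exact: measurable_itv.
  apply: continuous_in_subspaceT => t; rewrite inE /Dn/= in_itv/= => /andP[h _].
  by apply: continuous_f; exact: lt_le_trans h.
have mKf : measurable_fun (Dn n) (fun t => (K%:E * (f t)%:E)%E).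
  have -> : (fun t => (K%:E * (f t)%:E)%E) = EFin \o (fun t => K * f t) by [].
  by apply/measurable_EFinP; apply: measurable_funM.
apply: (@le_trans _ _ (\int[mu]_(t in Dn n) (K%:E * (f t)%:E))%E).
  apply: ge0_le_integral => //=.
  - exact: measurable_itv.
  - by move=> x _; rewrite lee_fin chisq_dens_ge0.
  - exact: measurable_funS mdens.
  - move=> t; rewrite /Dn/= in_itv/= => /andP[h _]; rewrite -EFinM lee_fin.
    by apply: powR_le_dens_bound; exact: lt_le_trans h.
rewrite ge0_integralZl//; last 2 first.
- exact/measurable_EFinP.
- by move=> t _; rewrite lee_fin f_ge0.
- by rewrite -[leRHS]mule1 lee_wpmul2l// ?lee_fin//; exact: integral_f_le1.
- exact: measurable_itv.
Qed.

Local Notation chisq_integrable h := (mu.-integrable setT (fun t => (h t * dens t)%:E)).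

Lemma integrable_chisq_mul (h : R -> R) : measurable_fun setT h ->
  (forall t, 0 <= t -> `|h t| <= 1) ->
  chisq_integrable h.
Proof.
move=> mh h1.
have mdens := measurable_chisq_dens.
have idens : mu.-integrable setT (EFin \o dens).
  apply/integrableP; split; first exact/measurable_EFinP.
  apply: le_lt_trans chisq_dens_integral_fin.
  apply: le_of_eq; apply: eq_integral => t _ /=.
  by rewrite ger0_norm// chisq_dens_ge0.
apply: (le_integrable _ _ _ idens) => //.
  by apply/measurable_EFinP; apply: measurable_funM.
move=> t _ /=; rewrite lee_fin normrM.
have [t0|/ltW/chisq_dens_le0 ->] := leP 0 t; last by rewrite normr0 mulr0.
by rewrite ler_piMl// h1.
Qed.

Definition chisq_int (h : R -> R) : R := \int[mu]_t (h t * dens t).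

Lemma chisq_intD (h1 h2 : R -> R) : chisq_integrable h1 ->
  chisq_integrable h2 ->
  chisq_int (fun t => h1 t + h2 t) = chisq_int h1 + chisq_int h2.
Proof.
move=> i1 i2; rewrite /chisq_int -RintegralD//.
by apply: eq_Rintegral => t _; rewrite mulrDl.
Qed.

Lemma chisq_intZ (c : R) (h : R -> R) : chisq_integrable h ->
  chisq_int (fun t => c * h t) = c * chisq_int h.
Proof.
move=> i; rewrite /chisq_int -RintegralZl//.
by apply: eq_Rintegral => t _; rewrite mulrA.
Qed.

Lemma ler_chisq_int (h1 h2 : R -> R) : chisq_integrable h1 ->
  chisq_integrable h2 ->
  (forall t, 0 <= t -> h1 t <= h2 t) -> chisq_int h1 <= chisq_int h2.
Proof.
move=> i1 i2 h; apply: le_Rintegral => // t _.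
have [t0|/ltW/chisq_dens_le0 ->] := leP 0 t; last by rewrite !mulr0.
by rewrite ler_wpM2r ?chisq_dens_ge0// h.
Qed.

Let Z := chisq_int (cst 1).

Lemma integrable_chisq1 : chisq_integrable (cst (1 : R)).
Proof. by apply: integrable_chisq_mul => // t _; rewrite normr1. Qed.

Lemma chisq_int1E : Z%:E = (\int[mu]_t (dens t)%:E)%E.
Proof.
rewrite /Z /chisq_int /Rintegral fineK.
  by apply: eq_integral => t _; rewrite mul1r.
by apply: integrable_fin_num => //; exact: integrable_chisq1.
Qed.

Lemma measurable_expZ (s : R) : measurable_fun setT (fun t : R => expR (- (s * t))).
Proof.
by apply: measurableT_comp => //; apply: measurableT_comp.
Qed.

Lemma integrable_chisq_exp (s : R) : 0 <= s ->
  mu.-integrable setT (fun t => (expR (- (s * t)) * dens t)%:E).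
Proof.
move=> s0; apply: integrable_chisq_mul; first exact: measurable_expZ.
by move=> t t0; rewrite ger0_norm ?expR_ge0// -expR0 ler_expR oppr_le0 mulr_ge0.
Qed.

(** Scaling by [1 + 2 s] turns the density into itself times [expR (- (s t))] and a constant, so the
    transform follows up to the common factor [Z], which is never evaluated. *)
Lemma chisq_int_exp (s : R) : 0 <= s ->
  chisq_int (fun t => expR (- (s * t))) = expR (- (alpha * ln (1 + 2 * s))) * Z.
Proof.
move=> s0; set c := 1 + 2 * s; have c0 : 0 < c by rewrite /c; lra.
have dc t : dens (c * t) = c `^ (alpha - 1) * (expR (- (s * t)) * dens t).
  have [t0|t0] := ltP 0 t; last first.
    by rewrite !chisq_dens_le0 ?mulr0// mulr_ge0_le0// ltW.
  rewrite /chisq_dens t0 mulr_gt0// powRM ?ltW// -!mulrA; congr (_ * _).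
  rewrite [RHS]mulrCA; congr (_ * _).
  by rewrite -expRD; congr expR; rewrite /c; field.
have i1 := integrable_chisq_exp s0.
have := ge0_integral_scale c0 measurable_chisq_dens chisq_dens_ge0.
rewrite -chisq_int1E.
under eq_integral do rewrite dc EFinM.
rewrite integralZl//.
have -> : (\int[mu]_t (expR (- (s * t)) * dens t)%:E)%E = (chisq_int (fun t => expR (- (s * t))))%:E.
  by rewrite /chisq_int /Rintegral fineK//; exact: integrable_fin_num.
rewrite -!EFinM => -[->].
rewrite /powR gt_eqF// !mulrA.
have -> : expR (- (alpha * ln c)) * c = expR (- ((alpha - 1) * ln c)).
  by rewrite -{2}[c]lnK ?posrE// -expRD; congr expR; ring.
by rewrite -expRD addNr expR0 mul1r.
Qed.

Lemma chisq_int_sum (c s : nat -> R) (n : nat) : (forall j, 0 <= s j) ->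
  mu.-integrable setT (fun t => ((\sum_(j < n) c j * expR (- (s j * t))) * dens t)%:E) /\
  chisq_int (fun t => \sum_(j < n) c j * expR (- (s j * t))) =
  \sum_(j < n) c j * chisq_int (fun t => expR (- (s j * t))).
Proof.
move=> s0; elim: n => [|n [IHi IH]].
  under eq_fun do rewrite big_ord0 mul0r.
  split; first exact: integrable0.
  by rewrite big_ord0 /chisq_int; under eq_Rintegral do rewrite big_ord0 mul0r; rewrite Rintegral_cst// mul0r.
have ic : mu.-integrable setT (fun t => ((c n * expR (- (s n * t))) * dens t)%:E).
  under eq_fun do rewrite -mulrA EFinM.
  by apply: integrableZl => //; exact: integrable_chisq_exp.
have E t : \sum_(j < n.+1) c j * expR (- (s j * t)) =
   (\sum_(j < n) c j * expR (- (s j * t))) + c n * expR (- (s n * t)).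
  by rewrite big_ord_recr.
split.
  under eq_fun do rewrite E mulrDl EFinD.
  exact: integrableD.
transitivity (chisq_int (fun t => (\sum_(j < n) c j * expR (- (s j * t))) + c n * expR (- (s n * t)))).
  by apply: eq_Rintegral => t _; rewrite E.
rewrite chisq_intD// IH big_ord_recr/=; congr (_ + _).
by rewrite chisq_intZ//; exact: integrable_chisq_exp.
Qed.

Lemma pow_one_sub_exp (m N : nat) (t : R) : (1 - expR (- (m%:R * t))) ^+ N =
  \sum_(j < N.+1) ((-1) ^+ j *+ 'C(N, j)) * expR (- ((j * m)%:R * t)).
Proof.
rewrite exprBn; apply: eq_bigr => j _.
have -> : expR (- ((j * m)%:R * t)) = expR (- (m%:R * t)) ^+ j.
  by rewrite -expRM_natl; congr expR; rewrite natrM; ring.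
by rewrite [RHS]mulrnAl expr1n mulr1.
Qed.

Lemma chisq_int_pow (m N : nat) :
  chisq_int (fun t => (1 - expR (- (m%:R * t))) ^+ N) =
  \sum_(j < N.+1) ((-1) ^+ j *+ 'C(N, j)) * (expR (- (alpha * ln (1 + 2 * (j * m)%:R))) * Z).
Proof.
have := @chisq_int_sum (fun j => (-1) ^+ j *+ 'C(N, j)) (fun j => (j * m)%:R) N.+1.
case=> [j|_ h]; first exact: ler0n.
transitivity (chisq_int (fun t => \sum_(j < N.+1) ((-1) ^+ j *+ 'C(N, j)) * expR (- ((j * m)%:R * t)))).
  by apply: eq_Rintegral => t _; rewrite pow_one_sub_exp.
by rewrite h; apply: eq_bigr => j _; rewrite chisq_int_exp.
Qed.

(** The constant [K], namely [2^(-(k/2+1)) / e], is a lower bound of the density on [[1, 2]]. *)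
Lemma chisq_int1_gt0 : 0 < Z.
Proof.
pose K : R := expR (- ((k%:R / 2 + 1) * ln 2 + 1)).
have K0 : 0 < K by exact: expR_gt0.
pose h (t : R) : R := (t \in `[1, 2])%:R.
have mh : measurable_fun setT h.
  rewrite (_ : h = \1_(`[1, 2]%classic)); first exact: measurable_indic.
  by apply/funext => t; rewrite indicE /h mem_setE.
have hd t : K * h t <= dens t.
  rewrite /h in_itv/=; case: andP => [[t1 t2]|_]; last by rewrite mulr0 chisq_dens_ge0.
  have t0 : 0 < t by lra.
  rewrite mulr1 /chisq_dens t0 /powR gt_eqF// -expRD /K ler_expR.
  have l0 : 0 <= ln t by rewrite ln_ge0.
  have l2 : ln t <= ln 2 by rewrite ler_ln ?posrE.
  have k1 : 0 <= k%:R :> R by [].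
  have : 0 <= k%:R * ln t by rewrite mulr_ge0.
  have : 0 <= k%:R * ln (2 : R) by rewrite mulr_ge0// ln_ge0//; lra.
  have -> : (k%:R / 2 - 1) * ln t = (k%:R * ln t) / 2 - ln t by ring.
  have -> : (k%:R / 2 + 1) * ln 2 = (k%:R * ln 2) / 2 + ln 2 :> R by ring.
  lra.
have hE : (\int[mu]_t (K * h t)%:E = K%:E)%E.
  under eq_integral do rewrite EFinM.
  rewrite ge0_integralZl//; last 3 first.
  - exact/measurable_EFinP.
  - by move=> t _; rewrite lee_fin ler0n.
  - by rewrite lee_fin ltW.
  rewrite (_ : \int[mu]_x (h x)%:E = \int[mu]_x (\1_(`[1, 2]%classic) x)%:E)%E; last first.
    by apply: eq_integral => t _; rewrite indicE /h mem_setE.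
  rewrite integral_indic ?setIT//.
  rewrite [X in (_ * X)%E](lebesgue_measure_itv `[1:R, 2])/= lte_fin ltr1n.
  by rewrite -EFinB -EFinM; congr EFin; ring.
suff : (K%:E <= Z%:E)%E by rewrite lee_fin; apply: lt_le_trans.
rewrite chisq_int1E -hE; apply: ge0_le_integral => //.
- by move=> t _; rewrite lee_fin mulr_ge0// ltW.
- by apply/measurable_EFinP; apply: measurable_funM.
- by apply/measurable_EFinP; exact: measurable_chisq_dens.
- by move=> t _; rewrite lee_fin.
Qed.

Lemma chisq_cdfE (x : R) : chisq_cdf k x = chisq_int (fun t => (t <= x)%R%:R) / Z.
Proof.
rewrite /chisq_cdf gtn_eqF//; congr (fine _ / fine _); last first.
  by apply: eq_integral => t _; rewrite mul1r.
rewrite [LHS]integral_mkcond; congr (integral _ _ _).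
apply/funext => t; rewrite /patch mem_setE in_itv/=; case: ifP => _; first by rewrite mul1r.
by rewrite mul0r.
Qed.

Lemma integrable_chisq_le (x : R) :
  mu.-integrable setT (fun t => ((t <= x)%R%:R * dens t)%:E).
Proof.
apply: integrable_chisq_mul.
  rewrite (_ : (fun _ => _) = \1_(`]-oo, x]%classic)); first exact: measurable_indic.
  by apply/funext => t; rewrite indicE mem_setE in_itv.
by move=> t _; rewrite ger0_norm ?ler0n// lern1 leq_b1.
Qed.

Lemma integrable_chisq_pow (m N : nat) :
  mu.-integrable setT (fun t => ((1 - expR (- (m%:R * t))) ^+ N * dens t)%:E).
Proof.
have := @chisq_int_sum (fun j => (-1) ^+ j *+ 'C(N, j)) (fun j => (j * m)%:R) N.+1.
case=> [j|h _]; first exact: ler0n.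
by under eq_fun do rewrite pow_one_sub_exp.
Qed.

Lemma chisq_cdf_le0 (x : R) : x <= 0 -> chisq_cdf k x = 0.
Proof.
move=> x0; rewrite chisq_cdfE (_ : chisq_int _ = 0) ?mul0r//.
transitivity (\int[mu]_(t in [set: R]) (0 : R)); last by rewrite Rintegral_cst ?mul0r.
apply: eq_Rintegral => t _; have [tx|_] := leP t x; last by rewrite mul0r.
by rewrite chisq_dens_le0 ?mulr0// (le_trans tx).
Qed.

End ChiSquareDensity.

(** * Polynomials in [exp (- t)] approximating an indicator *)

Section Cutoff.
Variable R : realType.

Lemma bernoulli_ineq (u : R) (N : nat) : 0 <= u -> u <= 1 -> 1 - N%:R * u <= (1 - u) ^+ N.
Proof.
move=> u0 u1; elim: N => [|N IH]; first by rewrite expr0 mul0r subr0.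
rewrite exprS -natr1.
have h : (1 - u) * (1 - N%:R * u) <= (1 - u) * (1 - u) ^+ N by rewrite ler_wpM2l// subr_ge0.
apply: le_trans h; have : 0 <= N%:R * u ^+ 2 by rewrite mulr_ge0 ?sqr_ge0.
by rewrite expr2; nra.
Qed.

(* With [u = exp (- m t)], [(1 - u)^N] is about [exp (- N u)]; taking [N] near
   [exp (m y)] makes it a steep step located at [t = y]. *)
Lemma exp_cutoff (x1 x2 del : R) : 0 <= x1 -> x1 < x2 -> 0 < del ->
  exists m N : nat, forall t, 0 <= t ->
    (t <= x1 -> (1 - expR (- (m%:R * t))) ^+ N <= del) /\
    (x2 <= t -> 1 - (1 - expR (- (m%:R * t))) ^+ N <= del).
Proof.
move=> x10 x12 d0.
pose d := (x2 - x1) / 2; have dd : 0 < d by rewrite /d; lra.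
(* The step will be at most [1 / (m d)] up to [x1] and within [2 / (m d)] of 1 from [x2] on; this
   [m] brings both below [del]. *)
pose m := (Num.truncn (2 / (d * del))).+1.
have hm : 2 <= (m%:R * d) * del.
  have : 2 / (d * del) < m%:R by exact: truncnS_gt.
  rewrite ltr_pdivrMr; last by rewrite mulr_gt0.
  by rewrite -mulrA; exact: ltW.
pose y := (x1 + x2) / 2; pose e := expR (m%:R * y).
pose N := (Num.truncn e).+1.
have e1 : 1 <= e.
  rewrite /e -expR0 ler_expR mulr_ge0// /y; lra.
have eN : e <= N%:R by rewrite ltW// truncnS_gt.
have Ne : N%:R <= 2 * e.
  rewrite /N -natr1; have := @truncn_le _ e; rewrite (le_trans ler01 e1) => ?; lra.
have md : 0 < m%:R * d by rewrite mulr_gt0// ltr0n.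
exists m, N => t t0.
set u := expR (- (m%:R * t)).
have u0 : 0 < u by exact: expR_gt0.
have u1 : u <= 1 by rewrite /u -expR0 ler_expR oppr_le0 mulr_ge0.
split=> [tx|xt].
- have h1 : (1 - u) ^+ N <= expR (- (N%:R * u)).
    have -> : - (N%:R * u) = N%:R * (- u) by ring.
    rewrite expRM_natl lerXn2r ?nnegrE ?expR_ge0 ?subr_ge0//.
    by have := expR_ge1Dx (- u); lra.
  apply: (le_trans h1); rewrite expRN.
  have h2 : m%:R * d <= N%:R * u.
    have : e * u <= N%:R * u by rewrite ler_wpM2r// ltW.
    apply: le_trans; rewrite /e /u -expRD.
    have : m%:R * d <= m%:R * y - m%:R * t.
      by rewrite -mulrBr ler_wpM2l// /d /y; lra.
    by have := expR_ge1Dx (m%:R * y - m%:R * t); lra.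
  have h3 : m%:R * d <= expR (N%:R * u) by have := expR_ge1Dx (N%:R * u); lra.
  rewrite invf_ple ?posrE ?expR_gt0//; apply: le_trans h3.
  rewrite -[leLHS]mul1r ler_pdivrMr//; lra.
- have := bernoulli_ineq N (ltW u0) u1; set v := (1 - u) ^+ N => hv.
  suff : N%:R * u <= del by lra.
  have h1 : N%:R * u <= 2 * (e * u) by rewrite mulrA ler_wpM2r// ltW.
  apply: (le_trans h1); rewrite /e /u -expRD.
  have h2 : m%:R * y + - (m%:R * t) <= - (m%:R * d).
    by rewrite -mulrN -mulrDr -mulrN ler_wpM2l// /d /y; lra.
  have h3 : expR (m%:R * y - m%:R * t) <= (m%:R * d)^-1.
    apply: (@le_trans _ _ (expR (- (m%:R * d)))); first by rewrite ler_expR.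
    by rewrite expRN lef_pV2 ?posrE ?expR_gt0//; have := expR_ge1Dx (m%:R * d); lra.
  apply: (@le_trans _ _ (2 * (m%:R * d)^-1)); first by rewrite ler_wpM2l.
  by rewrite ler_pdivrMr// mulrC.
Qed.

End Cutoff.

(** * Convergence in distribution *)

Section ChiSquareLimit.
Variables (R : realType) (k : nat).
Hypothesis k0 : (0 < k)%N.
Variables (I : nat -> finType) (p : forall n, I n -> R).
Variable Q : forall n, {ffun I n -> bool} -> R.
Arguments Q : clear implicits.
Arguments p : clear implicits.
Hypothesis p01 : forall n i, 0 <= p n i <= 1.
Hypothesis Q0 : forall n a, 0 <= Q n a.
Hypothesis laplace_lim : forall s : nat,
  (fun n => expect (p n) (fun a => expR (- (s%:R * Q n a)))) @ \oo -->
    expR (- (k%:R / 2 * ln (1 + 2 * s%:R))).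

Local Notation F := (@chisq_cdf R k).
Let Z := chisq_int k (cst (1 : R)).
Local Notation chisq_integrable h :=
  ((@lebesgue_measure R).-integrable setT (fun t : R => (h t * chisq_dens k t)%:E)).

Lemma cvg_expect_pow (m N : nat) :
  (fun n => expect (p n) (fun a => (1 - expR (- (m%:R * Q n a))) ^+ N)) @ \oo -->
    chisq_int k (fun t : R => (1 - expR (- (m%:R * t))) ^+ N) / Z.
Proof.
have Z0 : Z != 0 by rewrite gt_eqF// chisq_int1_gt0.
rewrite chisq_int_pow// mulr_suml.
rewrite (_ : (fun n => _) = (fun n => \sum_(j < N.+1) ((-1) ^+ j *+ 'C(N, j)) *
   expect (p n) (fun a => expR (- ((j * m)%:R * Q n a))))); last first.
  apply/funext => n; under eq_bigr do rewrite -expectZl.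
  by rewrite -expect_sum; apply: eq_expect => a; rewrite pow_one_sub_exp.
apply: cvg_big => [|j _]; first exact: add_continuous.
by rewrite -mulrA mulfK//; apply: cvgM; [exact: cvg_cst|exact: laplace_lim].
Qed.

(** One minus the cutoff lies between the indicators of [t <= x1] and [t <= x2] up to [d], under
    both laws. The three errors, one for each law and one for the convergence of expectations, are
    each [eps / 3]; continuity of [F] enters only later. *)
Lemma chisq_cutoff (x1 x2 eps : R) : 0 <= x1 -> x1 < x2 -> 0 < eps ->
  \forall n \near \oo,
    expect (p n) (fun a => (Q n a <= x1)%R%:R) <= F x2 + eps /\
    F x1 - eps <= expect (p n) (fun a => (Q n a <= x2)%R%:R).
Proof.
move=> x10 x12 eps0.
pose d := eps / 3; have d0 : 0 < d by rewrite divr_gt0.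
have Z0 : 0 < Z by exact: chisq_int1_gt0.
have i1 : chisq_integrable (cst 1 : R -> R) by exact: integrable_chisq1.
have ile (y : R) := integrable_chisq_le k0 y.
have ipow := @integrable_chisq_pow R k k0.
have iN h : chisq_integrable h -> chisq_integrable (fun t => 1 - h t).
  move=> ih; rewrite (_ : (fun _ => _) = (fun t => ((cst 1 : R -> R) t * chisq_dens k t)%:E
     - (h t * chisq_dens k t)%:E)%E); first exact: integrableB.
  by apply/funext => t; rewrite mulrBl EFinB.
have iZ : chisq_integrable (fun t => d * (cst 1 : R -> R) t).
  by rewrite /=; under eq_fun do rewrite -mulrA EFinM; exact: integrableZl.
have intN h : chisq_integrable h -> chisq_int k h = Z - chisq_int k (fun t => 1 - h t).
  move=> ih; have -> : Z = chisq_int k (fun t => (1 - h t) + h t).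
    by congr (chisq_int k _); apply/funext => t; rewrite subrK.
  by rewrite chisq_intD//; [ring|exact: iN].
have iD h1 h2 : chisq_integrable h1 -> chisq_integrable h2 ->
    chisq_integrable (fun t => h1 t + h2 t).
  by move=> ih1 ih2; under eq_fun do rewrite mulrDl EFinD; exact: integrableD.
have [m [N hm]] := exp_cutoff x10 x12 d0.
have h01 (t : R) : 0 <= t -> 0 <= (1 - expR (- (m%:R * t))) ^+ N <= 1.
  move=> t0; have u0 := expR_gt0 (- (m%:R * t)).
  have u1 : expR (- (m%:R * t)) <= 1 by rewrite -expR0 ler_expR oppr_le0 mulr_ge0.
  by rewrite exprn_ge0 ?exprn_ile1//; lra.
have /cvgrPdist_lt/(_ d d0) := @cvg_expect_pow m N.
apply: filterS => n; rewrite ltr_norml => /andP[c1 c2].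
set E1 := chisq_int k _ in c1 c2.
pose H := chisq_int k (fun t : R => 1 - (1 - expR (- (m%:R * t))) ^+ N).
have E1E : E1 / Z = 1 - H / Z by rewrite /E1 (intN _ (ipow m N)) mulrBl divff// gt_eqF.
have H2 : H / Z <= F x2 + d.
  rewrite ler_pdivrMr// mulrDl chisq_cdfE// divfK ?gt_eqF//.
  rewrite -[d * Z]chisq_intZ// -chisq_intD//.
  apply: ler_chisq_int => //; [exact: iN|exact: iD|move=> t t0 /=].
  have /andP[? ?] := h01 t t0; have [_ hb] := hm t t0.
  have [_|tx] /= := leP t x2; first by lra.
  by have := hb (ltW tx); lra.
have H1 : F x1 - d <= H / Z.
  rewrite ler_pdivlMr// mulrBl chisq_cdfE// divfK ?gt_eqF// lerBlDr.
  rewrite -[d * Z]chisq_intZ// -chisq_intD//; last exact: iN.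
  apply: ler_chisq_int => //; [by apply: iD => //; exact: iN|move=> t t0 /=].
  have /andP[? ?] := h01 t t0; have [hb _] := hm t t0.
  have [tx|_] /= := leP t x1; last by lra.
  by have := hb tx; lra.
set Eh := expect _ _ in c1 c2.
have U : expect (p n) (fun a => (Q n a <= x1)%R%:R) <= 1 + d - Eh.
  rewrite -(expect_cst (p n) (1 + d)) -expectB; apply: ler_expect; [exact: p01|move=> a].
  have /andP[? ?] := h01 _ (Q0 a); have [ha _] := hm _ (Q0 a).
  have [qx|_] /= := leP (Q n a) x1; last by lra.
  by have := ha qx; lra.
have V : 1 - d - Eh <= expect (p n) (fun a => (Q n a <= x2)%R%:R).
  rewrite -(expect_cst (p n) (1 - d)) -expectB; apply: ler_expect; [exact: p01|move=> a].
  have /andP[? ?] := h01 _ (Q0 a); have [_ ha] := hm _ (Q0 a).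
  have [_|qx] /= := leP (Q n a) x2; first by lra.
  by have := ha (ltW qx); lra.
by rewrite E1E in c1 c2; move: c1 c2 U V H1 H2; rewrite /d; split; lra.
Qed.

Variable T : forall n, {ffun I n -> bool} -> R.
Variable bad : forall (eps : R) n, {ffun I n -> bool} -> bool.
Arguments T : clear implicits.
Arguments bad : clear implicits.
Hypothesis T0 : forall n a, 0 <= T n a.
Hypothesis bad_small : forall eps, 0 < eps ->
  \forall n \near \oo, expect (p n) (fun a => (bad eps n a)%:R) <= eps.
Hypothesis T_close : forall eps, 0 < eps -> \forall n \near \oo, forall a, ~~ bad eps n a ->
  T n a <= (1 + eps) * Q n a + eps /\ Q n a <= (1 + eps) * T n a + eps.

(** Outside the bad event [T n a <= x] implies [Q n a <= x + eta], and [Q n a <= x - eta] implies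
    [T n a <= x]; another [eta] is spent in [chisq_cutoff], and continuity at [x] absorbs both. *)
Lemma chisq_limit (x : R) : {for x, continuous F} ->
  (fun n => expect (p n) (fun a => (T n a <= x)%R%:R)) @ \oo --> F x.
Proof.
move=> cF; have [x0|x0] := ltP x 0.
  rewrite chisq_cdf_le0// ?(ltW x0)//.
  rewrite (_ : (fun _ => _) = (fun=> 0)); first exact: cvg_cst.
  apply/funext => n; rewrite -[RHS](expect_cst (p n) 0); apply: eq_expect => a.
  by rewrite leNgt (lt_le_trans x0 (T0 a)).
apply/cvgrPdist_le => e e0.
pose d := e / 3; have d0 : 0 < d by rewrite divr_gt0.
have [del del0 hF] : exists2 del : R, 0 < del & forall y, `|x - y| < del -> `|F x - F y| < d.
  by have /cvgrPdist_lt/(_ d d0)/nbhs_ballP[del /= del0 h] := cF; exists del.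
pose eta := del / 3; have eta0 : 0 < eta by rewrite divr_gt0.
(* Chosen so that [(1 + c) x + c <= x + eta], and so that the bad event weighs at most [d]. *)
pose c := Num.min d (eta / (x + 1)).
have x1 : 0 < x + 1 by lra.
have c0 : 0 < c by rewrite lt_min d0 divr_gt0.
have cd : c <= d by rewrite ge_min lexx.
have cx : c * (x + 1) <= eta by rewrite -ler_pdivlMr// ge_min lexx orbT.
have evU : \forall n \near \oo,
    expect (p n) (fun a => (Q n a <= x + eta)%R%:R) <= F (x + eta + eta) + d.
  have y1 : 0 <= x + eta by lra.
  have y2 : x + eta < x + eta + eta by lra.
  by apply: filterS (chisq_cutoff y1 y2 d0) => n [].
have evL : \forall n \near \oo,
    F (x - eta - eta) - d <= expect (p n) (fun a => (Q n a <= x - eta)%R%:R).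
  (* [chisq_cutoff] takes nonnegative thresholds; to the left of 0 the distribution function
     vanishes and the bound is trivial. *)
  have [xm|/ltW xm] := leP (x - eta - eta) 0.
    apply: nearW => n; rewrite chisq_cdf_le0// (@le_trans _ _ 0)//; first by lra.
    by apply: expect_ge0; first exact: p01.
  have y2 : x - eta - eta < x - eta by lra.
  by apply: filterS (chisq_cutoff xm y2 d0) => n [].
near=> n.
have Hup : expect (p n) (fun a => (Q n a <= x + eta)%R%:R) <= F (x + eta + eta) + d by near: n.
have Hlo : F (x - eta - eta) - d <= expect (p n) (fun a => (Q n a <= x - eta)%R%:R) by near: n.
have Hbad : expect (p n) (fun a => (bad c n a)%:R) <= c by near: n; exact: bad_small.
have HT : forall a, ~~ bad c n a ->
  T n a <= (1 + c) * Q n a + c /\ Q n a <= (1 + c) * T n a + c by near: n; exact: T_close.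
have U : expect (p n) (fun a => (T n a <= x)%R%:R) <=
    expect (p n) (fun a => (Q n a <= x + eta)%R%:R) + expect (p n) (fun a => (bad c n a)%:R).
  rewrite -expectD; apply: ler_expect; [exact: p01|move=> a].
  have [Tx|_] := leP (T n a) x; last by rewrite addr_ge0.
  have [_|/HT[_ h]] := boolP (bad c n a); first by rewrite lerDr.
  rewrite (_ : (Q n a <= x + eta) = true) ?addr0//; apply/idP.
  have : c * T n a <= c * x by rewrite ler_wpM2l// ltW.
  by move: cx h; rewrite mulrDr mulrDl; lra.
have L : expect (p n) (fun a => (Q n a <= x - eta)%R%:R) <=
    expect (p n) (fun a => (T n a <= x)%R%:R) + expect (p n) (fun a => (bad c n a)%:R).
  rewrite -expectD; apply: ler_expect; [exact: p01|move=> a].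
  have [Tx|_] := leP (Q n a) (x - eta); last by rewrite addr_ge0.
  have [_|/HT[h _]] := boolP (bad c n a); first by rewrite lerDr.
  rewrite (_ : (T n a <= x) = true) ?addr0//; apply/idP.
  have : c * Q n a <= c * x by rewrite ler_wpM2l ?(ltW c0)//; lra.
  by move: cx h; rewrite mulrDr mulrDl; lra.
have /hF : `|x - (x + eta + eta)| < del.
  rewrite (_ : x - (x + eta + eta) = - (2 * eta)); last by ring.
  by rewrite normrN gtr0_norm ?mulr_gt0// /eta; lra.
have /hF : `|x - (x - eta - eta)| < del.
  rewrite (_ : x - (x - eta - eta) = 2 * eta); last by ring.
  by rewrite gtr0_norm ?mulr_gt0// /eta; lra.
rewrite !ltr_norml => /andP[h1 h2] /andP[h3 h4].
rewrite ler_norml; move: h1 h2 h3 h4 U L Hup Hlo Hbad cd; rewrite /d; lra.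
Unshelve. all: by end_near. Qed.

End ChiSquareLimit.

(** * The limiting quadratic forms *)

Lemma norm_prod_diff (R : realType) (J : Type) (l : seq J) (u v : J -> R) :
  (forall j, 0 <= u j <= 1) -> (forall j, 0 <= v j <= 1) ->
  `|\prod_(j <- l) u j - \prod_(j <- l) v j| <= \sum_(j <- l) `|u j - v j|.
Proof.
move=> u01 v01; elim: l => [|j l IH]; first by rewrite !big_nil subrr normr0.
rewrite !big_cons; set U := \prod_(j <- l) u j; set V := \prod_(j <- l) v j.
have -> : u j * U - v j * V = u j * (U - V) + (u j - v j) * V by ring.
have V0 : 0 <= V by apply: prodr_ge0 => i _; have /andP[] := v01 i.
have V1 : V <= 1 by rewrite /V; elim: l {IH U V V0} => [|i l' IH]; rewrite ?big_nil// big_cons; have /andP[v0 v1] := v01 i; rewrite mulr_ile1//; apply: prodr_ge0 => i' _; have /andP[] := v01 i'.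
have /andP[u0 u1] := u01 j.
rewrite (le_trans (ler_normD _ _))// !normrM addrC (ger0_norm V0) (ger0_norm u0).
rewrite lerD//; first by rewrite ler_piMr.
by rewrite (le_trans _ IH)// ler_piMl.
Qed.

Section Rows.
Variables (R : realType) (n r : nat) (beta : 'I_n -> R).
Implicit Types (a : {ffun 'I_n * 'I_n -> bool}) (i j : 'I_n).
Local Notation p := (edge_p beta).

(** Only entries with [i < r <= j] will count: they lie above the diagonal, so they are genuine
    coordinates of the product law, and distinct rows use distinct ones. With [v_tail] as
    normalization the variance is exactly 1. *)
Definition row_stat i a : R :=
  (\sum_(j < n | (r <= j)%N) centered p (i, j) a) / Num.sqrt (v_tail r beta i).

Definition simple_stat a : R := \sum_(i < n | (i < r)%N) row_stat i a ^+ 2.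

Definition tied_stat a : R :=
  \sum_(i < n | (i < r)%N)
     (row_stat i a - mean [pred i : 'I_n | (i < r)%N] (row_stat^~ a)) ^+ 2.

Lemma simple_stat_ge0 a : 0 <= simple_stat a.
Proof. by rewrite sumr_ge0// => i _; rewrite sqr_ge0. Qed.

Lemma tied_stat_ge0 a : 0 <= tied_stat a.
Proof. by rewrite sumr_ge0// => i _; rewrite sqr_ge0. Qed.

Lemma edge_p_lt i j : (i < j)%N -> p (i, j) = logistic (beta i + beta j).
Proof. by rewrite /edge_p /= => ->. Qed.

Variables (B C : R).
Hypotheses (B0 : 0 < B) (rn : (4 * r.+2 <= n)%N).
Hypothesis vb : forall i j, j != i ->
  B^-1 <= logistic_var (beta i + beta j) <= C^-1.

Let rn' : (r <= n)%N. Proof. by clear -rn; lia. Qed.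

Let tail_gt0 i : (i < r)%N -> 0 < v_tail r beta i.
Proof. exact: (v_tail_gt0 B0 rn vb). Qed.

(** At most [r] entries are dropped, each of modulus at most 1. *)
Lemma score_row_stat a i : (i < r)%N ->
  `|score (sym_graph a) beta i - Num.sqrt (v_tail r beta i) * row_stat i a| <= r%:R.
Proof.
move=> ir; rewrite /row_stat mulrC divfK; last by rewrite gt_eqF// sqrtr_gt0 tail_gt0.
rewrite scoreE (bigID (fun j : 'I_n => (r <= j)%N))/=.
rewrite [X in X + _ - _](_ : _ = \sum_(j < n | (r <= j)%N) centered p (i, j) a).
  rewrite [X in `|X|]addrAC subrr add0r (le_trans (ler_norm_sum _ _ _))//.
  apply: (@le_trans _ _ (\sum_(j < n | (j < r)%N) 1)).
    rewrite [leRHS]big_mkcond [leLHS]big_mkcond/=; apply: ler_sum => j _.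
    rewrite -ltnNge; case: (j < r)%N; rewrite ?andbF// andbT; case: ifP => // _.
    have l0 := logistic_gt0 (beta i + beta j); have l1 := logistic_lt1 (beta i + beta j).
    by rewrite ler_norml; case: (sym_graph a (i, j)) => /=; apply/andP; split; lra.
  by rewrite -(big_ord_widen _ (fun=> 1) rn') sumr_const card_ord.
apply: eq_big => [j|j /andP[_ rj]].
  case: (leqP r j) => rj; rewrite ?andbF// andbT.
  by apply/eqP => ji; move: ir rj; rewrite ji; lia.
have ij : (i < j)%N by exact: leq_trans ir rj.
by rewrite /centered edge_p_lt// ffunE/= ij.
Qed.

Let cbar : R := Num.sqrt (2 * B / n%:R).

Lemma inv_sqrt_tail_le i : (i < r)%N -> (Num.sqrt (v_tail r beta i))^-1 <= cbar.
Proof.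
move=> ir; have n0 : 0 < n%:R :> R by rewrite ltr0n; clear -rn; lia.
rewrite /cbar -sqrtrV ?(ltW (tail_gt0 ir))// ler_sqrt; last first.
  by rewrite divr_ge0 ?mulr_ge0 ?(ltW B0)// (ltW n0).
have := v_tail_ge B0 rn vb ir.
rewrite -[2 * B / n%:R]invrK lef_pV2 ?posrE ?invr_gt0 ?divr_gt0 ?mulr_gt0 ?tail_gt0//.
by rewrite (_ : (2 * B / n%:R)^-1 = n%:R / 2 / B)//; field; rewrite !gt_eqF.
Qed.

Let tail_seq : seq 'I_n := [seq j : 'I_n <- index_enum 'I_n | (r <= j)%N].

Let tail_seq_uniq : uniq tail_seq.
Proof. by rewrite filter_uniq// index_enum_uniq. Qed.

Let tail_seq_size : (size tail_seq <= n)%N.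
Proof. by rewrite size_filter (leq_trans (count_size _ _))// [index_enum _]unlock -enumT size_enum_ord. Qed.

Lemma edge_p_var i j : (i < r)%N -> j \in tail_seq ->
  p (i, j) * (1 - p (i, j)) = logistic_var (beta i + beta j).
Proof.
move=> ir; rewrite mem_filter => /andP[rj _].
by rewrite edge_p_lt ?logistic_varE// (leq_trans ir rj).
Qed.

Lemma block_var_tail i : (i < r)%N ->
  block_var (fun j => logistic_var (beta i + beta j)) (Num.sqrt (v_tail r beta i))^-1 tail_seq = 1.
Proof.
move=> ir; rewrite /block_var -mulr_sumr exprVn sqr_sqrtr ?(ltW (tail_gt0 ir))// big_filter.
by rewrite -/(v_tail r beta i) mulVf// gt_eqF// tail_gt0.
Qed.

Variable s : R.
Hypothesis s0 : 0 <= s.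

Lemma laplace_row i : (i < r)%N -> Num.sqrt s * cbar <= 2^-1 ->
  `|expect p (fun a => expR (- (s * row_stat i a ^+ 2))) -
    expR (- (1 / 2 * ln (1 + 2 * s)))|
  <= n%:R * (step_const R 1 * (Num.sqrt s * cbar) ^+ 3).
Proof.
move=> ir hc; set c := (Num.sqrt (v_tail r beta i))^-1.
have cc : c <= cbar by exact: inv_sqrt_tail_le.
have c0 : 0 <= c by rewrite invr_ge0 sqrtr_ge0.
have sc : Num.sqrt s * c <= Num.sqrt s * cbar by rewrite ler_wpM2l ?sqrtr_ge0.
have th0 : 0 ^+ 2 * 1%:R = 0 :> R by rewrite expr2 !mul0r.
have mc : 1%:R * (Num.sqrt s * c) <= 2^-1 by rewrite mul1r; exact: le_trans hc.
have einj (j j' : 'I_n) (k k' : 'I_1) : (i, j) = (i, j') -> j = j' /\ k = k'.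
  by case=> ->; rewrite !ord1.
have := @laplace_block_sum R 1 0 th0 _ _ p (fun j _ => (i, j))
  (fun j => logistic_var (beta i + beta j)) c s (edge_p01 beta) einj c0 s0 mc tail_seq (fun=> 0)
  tail_seq_uniq (fun j k jt => edge_p_var ir jt) (fun j _ => logistic_var_ge0 _).
rewrite block_var_tail// /quad_rank mul0r subr0 mulr1.
have -> : @quad R 1 0 (fun=> 0) = 0.
  by rewrite /quad big1 ?mul0r ?subr0// => k _; rewrite expr2 mulr0.
rewrite mulr0 mul0r oppr0 expR0 mulr1 mul1r => h.
rewrite (@eq_expect _ _ p _ (fun a => expR (- (s * quad 0 ((fun=> 0) \+ block_sum p (fun j (_ : 'I_1) => (i, j)) c tail_seq a))))); last first.
  move=> a; congr (expR (- (s * _))).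
  rewrite /quad mul0r subr0 big_ord1 /= add0r /block_sum -mulr_sumr big_filter.
  by rewrite /row_stat mulrC.
apply: (le_trans h); apply: ler_pM => //.
- by rewrite mulr_ge0 ?step_const_ge0// exprn_ge0// mul1r mulr_ge0 ?sqrtr_ge0.
- by rewrite ler_nat.
- by rewrite ler_wpM2l ?step_const_ge0// mul1r lerXn2r ?nnegrE ?mulr_ge0 ?sqrtr_ge0.
Qed.

(** Rows may have different variances, so they are treated one at a time, as blocks of size 1, and
    multiplied by independence. *)
Lemma laplace_simple : Num.sqrt s * cbar <= 2^-1 ->
  `|expect p (fun a => expR (- (s * simple_stat a))) - expR (- (r%:R / 2 * ln (1 + 2 * s)))|
  <= r%:R * (n%:R * (step_const R 1 * (Num.sqrt s * cbar) ^+ 3)).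
Proof.
move=> hc; pose l := [seq i : 'I_n <- index_enum 'I_n | (i < r)%N].
have ul : uniq l by rewrite filter_uniq// index_enum_uniq.
have sl : size l = r.
  rewrite size_filter -sum1_count -(big_ord_widen n (fun=> 1%N) rn') sum1_card card_ord //.
pose u i := expect p (fun a => expR (- (s * row_stat i a ^+ 2))).
pose w := expR (- (1 / 2 * ln (1 + 2 * s))).
have u01 i : 0 <= u i <= 1.
  apply/andP; split; first by apply: expect_ge0 => [|a]; [exact: edge_p01|exact: expR_ge0].
  rewrite -(expect_cst p 1); apply: ler_expect; first exact: edge_p01.
  by move=> a; rewrite -expR0 ler_expR oppr_le0 mulr_ge0// sqr_ge0.
have w01 : 0 <= w <= 1.
  rewrite /w expR_ge0 -[leRHS]expR0 ler_expR oppr_le0; apply: mulr_ge0; first by rewrite divr_ge0.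
  by apply: ln_ge0; move: s0; lra.
have -> : expect p (fun a => expR (- (s * simple_stat a))) = \prod_(i <- l) u i.
  rewrite /u -(@expect_indep_prod _ _ p _ l (fun i e => e.1 == i)) //.
  - apply: eq_expect => a; rewrite big_filter /simple_stat mulr_sumr -sumrN.
    by rewrite expR_sum.
  - move=> i a a' haa'; suff -> : row_stat i a = row_stat i a' by [].
    rewrite /row_stat; congr (_ / _); apply: eq_bigr => j _.
    by rewrite /centered haa'/=.
  - by move=> i i' e /eqP <- /eqP <-.
have -> : expR (- (r%:R / 2 * ln (1 + 2 * s))) = \prod_(i <- l) w.
  by rewrite big_const_seq count_predT sl iter_mulr_1 /w -expRM_natl; congr expR; ring.
apply: (le_trans (@norm_prod_diff _ _ l _ (fun=> w) u01 (fun=> w01))).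
rewrite big_filter; apply: (@le_trans _ _ (\sum_(i < n | (i < r)%N) (n%:R * (step_const R 1 * (Num.sqrt s * cbar) ^+ 3)))).
  by apply: ler_sum => i ir; exact: laplace_row.
by rewrite -(big_ord_widen n (fun=> n%:R * (step_const R 1 * (Num.sqrt s * cbar) ^+ 3)) rn') sumr_const card_ord -[leLHS]mulr_natl.
Qed.

Hypothesis r0 : (0 < r)%N.
Hypothesis beta_tied : forall i j, (i < r)%N -> (j < r)%N -> beta i = beta j.

(** Centring couples the rows, so they form one vector block of size [r] with [theta = 1/r]. Tied
    parameters give the entries of a column a common variance, as the replacement step demands. *)
Lemma laplace_tied : r%:R * (Num.sqrt s * cbar) <= 2^-1 ->
  `|expect p (fun a => expR (- (s * tied_stat a))) - expR (- (r.-1%:R / 2 * ln (1 + 2 * s)))|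
  <= n%:R * (step_const R r * (r%:R * (Num.sqrt s * cbar)) ^+ 3).
Proof.
move=> hc; pose w (k : 'I_r) : 'I_n := widen_ord rn' k.
have i0r : (w (Ordinal r0) < r)%N by [].
set i0 := w (Ordinal r0) in i0r.
set c := (Num.sqrt (v_tail r beta i0))^-1.
have cc : c <= cbar by exact: inv_sqrt_tail_le.
have c0 : 0 <= c by rewrite invr_ge0 sqrtr_ge0.
have sc : r%:R * (Num.sqrt s * c) <= r%:R * (Num.sqrt s * cbar).
  by rewrite ler_wpM2l// ler_wpM2l ?sqrtr_ge0.
have rR : r%:R != 0 :> R by rewrite pnatr_eq0 -lt0n.
have th : r%:R^-1 ^+ 2 * r%:R = r%:R^-1 :> R by rewrite expr2 mulfVK.
have mc : r%:R * (Num.sqrt s * c) <= 2^-1 by exact: le_trans hc.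
have einj (j j' : 'I_n) (k k' : 'I_r) : (w k, j) = (w k', j') -> j = j' /\ k = k'.
  by case=> h ->; split=> //; exact: val_inj.
have var (j : 'I_n) (k : 'I_r) : j \in tail_seq ->
    p (w k, j) * (1 - p (w k, j)) = logistic_var (beta i0 + beta j).
  by move=> jt; rewrite (edge_p_var (ltn_ord k : (w k < r)%N) jt) (beta_tied (i := w k) (j := i0))//=.
have := @laplace_block_sum R r r%:R^-1 th _ _ p (fun j k => (w k, j))
  (fun j => logistic_var (beta i0 + beta j)) c s (edge_p01 beta) einj c0 s0 mc tail_seq (fun=> 0)
  tail_seq_uniq var (fun j _ => logistic_var_ge0 _).
rewrite block_var_tail//.
have -> : quad_rank r r%:R^-1 = r.-1%:R :> R.
  by rewrite /quad_rank mulVf// -{1}(prednK r0) -natr1 addrK.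
have -> : @quad R r r%:R^-1 (fun=> 0) = 0.
  by rewrite /quad !big1 ?expr2 ?mulr0 ?subr0// => k _; rewrite expr2 mulr0.
rewrite mulr0 mul0r oppr0 expR0 !mulr1 => h.
rewrite (@eq_expect _ _ p _ (fun a => expR (- (s * quad r%:R^-1 ((fun=> 0) \+ block_sum p (fun j k => (w k, j)) c tail_seq a))))); last first.
  move=> a; congr (expR (- (s * _))).
  have rowE k : ((fun=> 0) \+ block_sum p (fun j k => (w k, j)) c tail_seq a) k = row_stat (w k) a.
    rewrite /= add0r /block_sum -mulr_sumr big_filter /row_stat mulrC /c.
    by rewrite /v_tail (beta_tied (i := w k) (j := i0))//=.
  rewrite (quad_proj th) /tied_stat (big_ord_narrow rn').
  apply: eq_bigr => k _; rewrite /proj rowE; congr ((_ - _) ^+ 2).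
  rewrite /mean (card_tied rn) mulrC; congr (_ * _).
  by rewrite (big_ord_narrow rn'); apply: eq_bigr => k' _; rewrite rowE.
apply: (le_trans h); apply: ler_pM => //.
- by rewrite mulr_ge0 ?step_const_ge0// exprn_ge0// !mulr_ge0 ?sqrtr_ge0.
- by rewrite ler_nat.
- by rewrite ler_wpM2l ?step_const_ge0// lerXn2r ?nnegrE ?mulr_ge0 ?sqrtr_ge0.
Qed.

End Rows.

(** * Typical graphs and error rates *)

Section Tails.
Variables (R : realType) (n : nat) (beta : 'I_n -> R).
Implicit Types (a : {ffun 'I_n * 'I_n -> bool}) (i j : 'I_n).
Hypothesis n0 : (0 < n)%N.

Lemma pair_sum_le (z : 'I_n -> R) :
  \sum_(i < n) \sum_(j < n | (i < j)%N) (z i + z j) ^+ 2 <= 2 * n%:R * \sum_i z i ^+ 2.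
Proof.
apply: (@le_trans _ _ (\sum_(i < n) \sum_(j < n | (i < j)%N) (2 * z i ^+ 2 + 2 * z j ^+ 2))).
  apply: ler_sum => i _; apply: ler_sum => j _.
  by have := sqr_ge0 (z i - z j); rewrite !expr2; nra.
rewrite -(sum_offdiag (fun i _ => 2 * z i ^+ 2)) mulr_sumr; apply: ler_sum => i _.
apply: (@le_trans _ _ (\sum_(j < n) 2 * z i ^+ 2)).
  rewrite [leLHS]big_mkcond; apply: ler_sum => j _; case: ifP => // _.
  by rewrite mulr_ge0 ?sqr_ge0.
by rewrite sumr_const card_ord -[leLHS]mulr_natl mulrA [n%:R * 2]mulrC.
Qed.

Lemma score_tail_ln (z : 'I_n -> R) (w lam : R) : 0 < w -> 0 <= lam ->
  \sum_i z i ^+ 2 <= w -> lam ^+ 2 = 32 * n%:R * w * ln n%:R ->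
  expect (edge_p beta) (fun a => (lam < `|\sum_i z i * score (sym_graph a) beta i|)%R%:R)
    <= 2 * (n%:R ^+ 2)^-1.
Proof.
move=> w0 lam0 hz hlam; have nR : 0 < n%:R :> R by rewrite ltr0n.
have s20 : 0 < 2 * n%:R * w by rewrite !mulr_gt0.
have := @score_tail R n beta z (2 * n%:R * w) lam s20 lam0.
rewrite graph_expectE.
have -> : expR (- (lam ^+ 2 / (8 * (2 * n%:R * w)))) = (n%:R ^+ 2)^-1.
  rewrite hlam (_ : 32 * n%:R * w * ln n%:R / (8 * (2 * n%:R * w)) = 2 * ln n%:R); last first.
    by field; rewrite !gt_eqF.
  by rewrite expRN expRM_natl lnK ?posrE.
apply; apply: (le_trans (pair_sum_le z)).
by rewrite ler_wpM2l// mulr_ge0// ltW.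
Qed.

Variables (r : nat) (B C : R).
(* Hoeffding levels for which each deviation has probability at most [2 / n^2]. *)
Definition score_bound : R := Num.sqrt (32 * n%:R * ln n%:R).
Definition stat_bound : R := Num.sqrt (128 * ln n%:R) * (B / C).

(** The right-hand side of the system in [score_expansion]. Its weights are of order [B / (C n)], so
    averaging makes it smaller than a single score by [sqrt n], up to [B / C]. *)
Definition weighted_score (A : pred 'I_n) i (g : {ffun 'I_n * 'I_n -> bool}) : R :=
  \sum_(j < n | A j) logistic_var (beta i + beta j) * (score g beta j / v_row beta j).

Definition atypical a : bool :=
  [exists i, [|| score_bound < `|score (sym_graph a) beta i|,
    stat_bound < `|weighted_score [pred j : 'I_n | (j != i) && (r <= j)%N] i (sym_graph a)| |
    stat_bound < `|weighted_score [pred j : 'I_n | j != i] i (sym_graph a)|]].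

Hypotheses (B0 : 0 < B) (C0 : 0 < C) (rn : (4 * r.+2 <= n)%N).
Hypothesis vb : forall i j, j != i ->
  B^-1 <= logistic_var (beta i + beta j) <= C^-1.

Let ln0 : 0 <= ln (n%:R : R).
Proof. by rewrite ln_ge0// ler1n. Qed.

Lemma weighted_score_tail (A : pred 'I_n) i : (forall j, A j -> j != i) ->
  expect (edge_p beta) (fun a => (stat_bound < `|weighted_score A i (sym_graph a)|)%R%:R)
    <= 2 * (n%:R ^+ 2)^-1.
Proof.
move=> Ai; have nR : 0 < n%:R :> R by rewrite ltr0n.
pose z j : R := if A j then logistic_var (beta i + beta j) / v_row beta j else 0.
(* The sum of [n] squared weights, each weight being at most [C^-1 * (2 B / n)]. *)
pose w : R := 4 * B ^+ 2 / (C ^+ 2 * n%:R).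
have w0 : 0 < w by rewrite divr_gt0 ?mulr_gt0 ?exprn_gt0.
have zw : \sum_j z j ^+ 2 <= w.
  apply: (@le_trans _ _ (\sum_(j < n) (2 * B / (C * n%:R)) ^+ 2)).
    apply: ler_sum => j _; rewrite /z; case: ifP => [Aj|_]; last by rewrite expr0n/= sqr_ge0.
    have /andP[v1 v2] := vb (Ai j Aj).
    have r1 := v_row_ge B0 rn vb j; have r2 := v_row_gt0 B0 rn vb j.
    have v0 := logistic_var_ge0 (beta i + beta j).
    rewrite lerXn2r ?nnegrE ?divr_ge0 ?mulr_ge0 ?(ltW B0) ?(ltW C0) ?(ltW r2)//.
    rewrite (_ : 2 * B / (C * n%:R) = C^-1 * (2 * B / n%:R)); last by field; rewrite !gt_eqF.
    apply: ler_pM => //; first by rewrite invr_ge0 ltW.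
    rewrite -[2 * B / n%:R]invrK lef_pV2 ?posrE ?invr_gt0 ?divr_gt0 ?mulr_gt0//.
    by rewrite (_ : (2 * B / n%:R)^-1 = n%:R / 2 / B)//; field; rewrite !gt_eqF.
  rewrite sumr_const card_ord -[leLHS]mulr_natl /w.
  by rewrite (_ : n%:R * (2 * B / (C * n%:R)) ^+ 2 = 4 * B ^+ 2 / (C ^+ 2 * n%:R))//; field; rewrite !gt_eqF.
have sb0 : 0 <= stat_bound by rewrite mulr_ge0 ?sqrtr_ge0// divr_ge0// ltW.
have := @score_tail_ln z w stat_bound w0 sb0 zw.
rewrite /stat_bound exprMn sqr_sqrtr; last by rewrite mulr_ge0.
have -> : 128 * ln n%:R * (B / C) ^+ 2 = 32 * n%:R * w * ln n%:R.
  by rewrite /w; field; rewrite !gt_eqF.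
move=> /(_ erefl); rewrite (@eq_expect _ _ _ _ (fun a => (stat_bound < `|weighted_score A i (sym_graph a)|)%R%:R))// => a.
congr ((_ < `|_|)%R%:R); rewrite /weighted_score [RHS]big_mkcond; apply: eq_bigr => j _.
by rewrite /z; case: ifP => _; [ring|rewrite mul0r].
Qed.

Lemma score_bound_tail i :
  expect (edge_p beta) (fun a => (score_bound < `|score (sym_graph a) beta i|)%R%:R)
    <= 2 * (n%:R ^+ 2)^-1.
Proof.
have zw : \sum_(j < n) ((j == i)%:R : R) ^+ 2 <= 1.
  by rewrite (bigD1 i)//= eqxx big1 ?addr0 ?expr1n// => j /negbTE ->; rewrite expr0n.
have := @score_tail_ln (fun j => (j == i)%:R) 1 score_bound ltr01 (sqrtr_ge0 _) zw.
rewrite mulr1 /score_bound sqr_sqrtr; last by rewrite mulr_ge0// mulr_ge0.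
move=> /(_ erefl); rewrite (@eq_expect _ _ _ _ (fun a => (score_bound < `|score (sym_graph a) beta i|)%R%:R))// => a.
congr ((_ < `|_|)%R%:R); rewrite (bigD1 i)//= eqxx mul1r big1 ?addr0// => j /negbTE ->.
by rewrite mul0r.
Qed.

(** Union bound over [3 n] deviations of probability at most [2 / n^2] each. *)
Lemma atypical_prob : expect (edge_p beta) (fun a => (atypical a)%:R) <= 6 / n%:R.
Proof.
have nR : 0 < n%:R :> R by rewrite ltr0n.
pose e1 i a : R := (score_bound < `|score (sym_graph a) beta i|)%R%:R.
pose e2 i a : R := (stat_bound < `|weighted_score [pred j : 'I_n | (j != i) && (r <= j)%N] i (sym_graph a)|)%R%:R.
pose e3 i a : R := (stat_bound < `|weighted_score [pred j : 'I_n | j != i] i (sym_graph a)|)%R%:R.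
apply: (@le_trans _ _ (expect (edge_p beta) (fun a => \sum_(i < n) (e1 i a + e2 i a + e3 i a)))).
  apply: ler_expect; first exact: edge_p01.
  move=> a; have e0 i : 0 <= e1 i a + e2 i a + e3 i a by rewrite !addr_ge0.
  rewrite /atypical; case: existsP => [[i hi]|_]; last by rewrite sumr_ge0.
  rewrite (bigD1 i)//= -[leLHS]addr0 lerD//; last by rewrite sumr_ge0.
  move: hi; rewrite /e1 /e2 /e3.
  by case: (score_bound < _) => /=; case: (stat_bound < _) => /=; case: (stat_bound < _) => //= _; lra.
rewrite expect_sum; apply: (@le_trans _ _ (\sum_(i < n) 6 * (n%:R ^+ 2)^-1)).
  apply: ler_sum => i _; rewrite !expectD.
  have h1 := score_bound_tail i.
  have h2 := @weighted_score_tail [pred j : 'I_n | (j != i) && (r <= j)%N] i (fun j h => proj1 (andP h)).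
  have h3 := @weighted_score_tail [pred j : 'I_n | j != i] i (fun j h => h).
  by rewrite /e1 /e2 /e3; lra.
rewrite sumr_const card_ord -[leLHS]mulr_natl.
by rewrite (_ : n%:R * (6 * (n%:R ^+ 2)^-1) = 6 / n%:R)//; field; rewrite gt_eqF.
Qed.

End Tails.

(** Young's inequality with parameter [t], applied in both directions to the normalized error, whose
    square is at most [d]. *)
Lemma sqr_sandwich (R : realType) (J : finType) (A : pred J) (v x f : J -> R) (e d t : R) :
  0 < t ->
  (forall i, A i -> [/\ 0 < v i, `|f i - Num.sqrt (v i) * x i| <= e & e ^+ 2 <= d * v i]) ->
  \sum_(i | A i) f i ^+ 2 / v i <=
    (1 + t) * \sum_(i | A i) x i ^+ 2 + (1 + t^-1) * (#|A|%:R * d) /\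
  \sum_(i | A i) x i ^+ 2 <=
    (1 + t) * \sum_(i | A i) f i ^+ 2 / v i + (1 + t^-1) * (#|A|%:R * d).
Proof.
move=> t0 H.
have young (y u : R) : (y + u) ^+ 2 <= (1 + t) * y ^+ 2 + (1 + t^-1) * u ^+ 2.
  rewrite -subr_ge0.
  rewrite (_ : _ - _ = t^-1 * (t * y - u) ^+ 2); last by field; rewrite gt_eqF.
  by rewrite mulr_ge0 ?sqr_ge0// invr_ge0 ltW.
have ti : 0 <= 1 + t^-1 by rewrite addr_ge0// invr_ge0 ltW.
have E : (1 + t^-1) * (#|A|%:R * d) = \sum_(i | A i) (1 + t^-1) * d.
  by rewrite sumr_const -[RHS]mulr_natl; ring.
have K i : A i -> exists2 u : R, f i ^+ 2 / v i = (x i + u) ^+ 2 & u ^+ 2 <= d.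
  move=> /H[v0 fe ed]; have s0 : 0 < Num.sqrt (v i) by rewrite sqrtr_gt0.
  exists ((f i - Num.sqrt (v i) * x i) / Num.sqrt (v i)).
    rewrite -{1}(sqr_sqrtr (ltW v0)); field; exact: lt0r_neq0.
  rewrite expr_div_n sqr_sqrtr ?(ltW v0)// ler_pdivrMr// (le_trans _ ed)//.
  by rewrite -[leLHS]real_normK ?num_real// lerXn2r ?nnegrE// (le_trans _ fe).
rewrite E !mulr_sumr -!big_split/=; split; apply: ler_sum => i /K[u -> ud].
  by rewrite (le_trans (young _ _))// lerD2l ler_wpM2l.
rewrite -{1}[x i](addrK u) (le_trans (young _ _))// sqrrN lerD2l ler_wpM2l//.
Qed.

Lemma close_of_sandwich (R : realType) (t rho k1 k2 T Q S1 S2 : R) :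
  0 < t -> t <= 2^-1 -> 0 <= rho -> rho <= 2 * t -> 0 <= Q -> 0 <= S1 ->
  k1 <= 1 + t -> 0 <= k2 -> k2 <= 1 + t ->
  (2 - k1) * S1 <= T -> T <= k2 * S2 -> S2 <= (1 + t) * Q + rho -> Q <= (1 + t) * S1 + rho ->
  T <= (1 + 4 * t) * Q + 4 * t /\ Q <= (1 + 4 * t) * T + 4 * t.
Proof.
move=> t0 t2 rho0 rho2 Q0 S10 hk1 k20 hk2 hT1 hT2 hS2 hQ; split.
  have h1 : k2 * S2 <= (1 + t) * ((1 + t) * Q + rho).
    apply: (@le_trans _ _ (k2 * ((1 + t) * Q + rho))); first by rewrite ler_wpM2l.
    by rewrite ler_wpM2r// addr_ge0// mulr_ge0//; lra.
  have h2 : t * Q <= 2^-1 * Q by rewrite ler_wpM2r.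
  have h3 : t * (t * Q) <= t * (2^-1 * Q) by rewrite ler_wpM2l// ltW.
  have h4 : t * rho <= 2^-1 * rho by rewrite ler_wpM2r.
  have : (1 + t) * ((1 + t) * Q + rho) = Q + 2 * (t * Q) + t * (t * Q) + rho + t * rho by ring.
  have : (1 + 4 * t) * Q = Q + 4 * (t * Q) by ring.
  have : 0 <= t * Q by rewrite mulr_ge0// ltW.
  lra.
have h1 : (1 - t) * S1 <= T.
  by apply: le_trans hT1; rewrite ler_wpM2r//; lra.
have h2 : (1 + t) * S1 <= (1 + 4 * t) * ((1 - t) * S1).
  rewrite mulrA ler_wpM2r//; have : t * t <= 2^-1 * t by rewrite ler_wpM2r// ltW.
  by lra.
have h3 : (1 + 4 * t) * ((1 - t) * S1) <= (1 + 4 * t) * T by rewrite ler_wpM2l//; lra.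
lra.
Qed.

(** * Error rates, and closeness of the likelihood ratio to its limiting form *)

Section Rates.
Variables (R : realType) (n r : nat) (B C : R).
Local Notation L := (ln (n%:R : R)).

(* The sixth power of the ratio assumed to tend to 0. *)
Definition rate : R := (B ^+ 3 / C) ^+ 6 * L ^+ 6 / n%:R.

Hypotheses (n0 : (0 < n)%N) (C1 : 1 <= C) (CB : C <= B) (L1 : 1 <= L).

Let nR : 0 < n%:R :> R. Proof. by rewrite ltr0n. Qed.
Let C0 : 0 < C. Proof. exact: lt_le_trans C1. Qed.
Let B1 : 1 <= B. Proof. exact: le_trans CB. Qed.
Let B0 : 0 < B. Proof. exact: lt_le_trans B1. Qed.
Let C_ge0 : 0 <= C := ltW C0.
Let B_ge0 : 0 <= B := ltW B0.
Let n_ge0 : 0 <= n%:R :> R := ltW nR.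

(** Missing powers of [C] in the denominator are paid for by powers of [B >= C], and surplus ones
    are harmless as [C >= 1]; the truncated subtraction [6 - j] expresses both cases. *)
Lemma rate_ge (i j k : nat) : (i + (6 - j) <= 18)%N -> (k <= 6)%N ->
  B ^+ i / C ^+ j * L ^+ k / n%:R <= rate.
Proof.
move=> ij k6; rewrite /rate ler_wpM2r ?invr_ge0//.
apply: ler_pM; [by rewrite divr_ge0 ?exprn_ge0|by rewrite exprn_ge0// (le_trans ler01)| |by rewrite ler_weXn2l].
rewrite expr_div_n -exprM ler_pdivrMr ?exprn_gt0// mulrAC ler_pdivlMr ?exprn_gt0//.
apply: (@le_trans _ _ (B ^+ i * (C ^+ j * C ^+ (6 - j)))).
  rewrite ler_wpM2l ?exprn_ge0// -exprD ler_weXn2l//; lia.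
rewrite mulrCA mulrC ler_wpM2r ?exprn_ge0//.
apply: (@le_trans _ _ (B ^+ i * B ^+ (6 - j))).
  by rewrite ler_wpM2l ?exprn_ge0// lerXn2r ?nnegrE.
by rewrite -exprD ler_weXn2l.
Qed.

(** These constants come from squaring. [2048] is [8^2 * 32], with 32 from [score_bound]; the two
    terms of [error_const] belong to the averaged scores and to the linearization error. *)
Definition radius_const : R := 2048 * expR 1 ^+ 6 * r.+1%:R ^+ 2.
Definition error_const : R := 72 * 128 + 72 * 16 * expR 1 ^+ 2 * radius_const ^+ 2.

Let D := score_bound R n.
Let T0 := stat_bound n B C.
Let M := 2 * mle_radius n r B C D.
Let P := (2 + 4 * B ^+ 2 / C ^+ 2) * (T0 + 4 * expR 1 * M ^+ 2 * n%:R / C).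
Let eta := 4 * r%:R * B / (C * n%:R).

Let D2 : D ^+ 2 = 32 * n%:R * L.
Proof. by rewrite sqr_sqrtr// !mulr_ge0// (le_trans ler01). Qed.

Let D0 : 0 <= D. Proof. exact: sqrtr_ge0. Qed.

Let M2E : M ^+ 2 = radius_const * (B ^+ 4 / C ^+ 2 * L ^+ 1 / n%:R).
Proof.
rewrite /M /mle_radius /radius_const.
have -> : (2 * (4 * expR 1 ^+ 3 * r.+1%:R * B ^+ 2 * D / (C * n%:R))) ^+ 2 =
  (8 * expR 1 ^+ 3 * r.+1%:R * B ^+ 2 / (C * n%:R)) ^+ 2 * D ^+ 2 by ring.
rewrite D2; field; rewrite !gt_eqF//.
Qed.

Let rc0 : 0 <= radius_const.
Proof.
rewrite /radius_const; apply: mulr_ge0; last exact/exprn_ge0/ler0n.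
by apply: mulr_ge0; [exact: ler0n|exact/exprn_ge0/expR_ge0].
Qed.

Let ec0 : 0 <= error_const.
Proof.
rewrite /error_const; apply: addr_ge0; first by apply: mulr_ge0; exact: ler0n.
apply: mulr_ge0; last exact: sqr_ge0.
by apply: mulr_ge0; [apply: mulr_ge0; exact: ler0n|exact: sqr_ge0].
Qed.

Let tc0 : 0 <= 4 * error_const + 16 * r%:R ^+ 2.
Proof.
by apply: addr_ge0; apply: mulr_ge0 => //; exact: sqr_ge0.
Qed.

Lemma radius_sqr_le : M ^+ 2 <= radius_const * rate.
Proof. by rewrite M2E ler_wpM2l//; exact: rate_ge. Qed.

Lemma radius_ge0 : 0 <= M.
Proof.
by rewrite /M /mle_radius mulr_ge0// divr_ge0 ?mulr_ge0 ?exprn_ge0 ?expR_ge0// ltW.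
Qed.

(** Keeps the diagonal Newton step within the radius [M] for scores up to [2 * D]. *)
Lemma degree_dev_le_radius : 2 * D * (2 * B / n%:R) <= M.
Proof.
have -> : M = 2 * D * (2 * B / n%:R) * (expR 1 ^+ 3 * r.+1%:R * (B / C) * 2).
  by rewrite /M /mle_radius; field; rewrite !gt_eqF.
have h0 : 0 <= 2 * D * (2 * B / n%:R).
  by rewrite !mulr_ge0 ?invr_ge0// ltW.
rewrite ler_peMr//.
have e1 : 1 <= expR 1 ^+ 3 :> R by rewrite exprn_ege1// -expR0 ler_expR.
have r1 : 1 <= r.+1%:R :> R by rewrite ler1n.
have bc : 1 <= B / C by rewrite ler_pdivlMr// mul1r.
have h1 : 1 <= expR 1 ^+ 3 * r.+1%:R :> R by rewrite mulr_ege1.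
have : 1 <= expR 1 ^+ 3 * r.+1%:R * (B / C) by rewrite mulr_ege1.
lra.
Qed.

Let X_ge0 : 0 <= 4 * expR 1 * M ^+ 2 * n%:R / C.
Proof.
apply: divr_ge0; last exact: ltW.
apply: mulr_ge0; last exact: ler0n.
apply: mulr_ge0; last exact: sqr_ge0.
by apply: mulr_ge0; [exact: ler0n|exact: expR_ge0].
Qed.

Let P0 : 0 <= P.
Proof.
rewrite /P mulr_ge0//.
  by rewrite addr_ge0// divr_ge0 ?mulr_ge0 ?exprn_ge0.
rewrite addr_ge0//; first by rewrite mulr_ge0 ?sqrtr_ge0// divr_ge0.
Qed.

Lemma error_sqr_le : P ^+ 2 <= error_const * rate * (n%:R / B).
Proof.
have bc : 1 <= B ^+ 2 / C ^+ 2 by rewrite ler_pdivlMr ?exprn_gt0// mul1r lerXn2r ?nnegrE.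
set X := 4 * expR 1 * M ^+ 2 * n%:R / C.
have X0 : 0 <= X by exact: X_ge0.
have T00 : 0 <= T0 by rewrite mulr_ge0 ?sqrtr_ge0// divr_ge0.
have T02 : T0 ^+ 2 = 128 * L * (B / C) ^+ 2.
  by rewrite exprMn sqr_sqrtr// mulr_ge0// (le_trans ler01).
have h1 : P <= 6 * (B ^+ 2 / C ^+ 2) * (T0 + X).
  by rewrite /P ler_wpM2r ?addr_ge0//; rewrite -mulrA; lra.
have h2 : (T0 + X) ^+ 2 <= 2 * (T0 ^+ 2 + X ^+ 2).
  by have := sqr_ge0 (T0 - X); rewrite !expr2; nra.
have h3 : P ^+ 2 <= 36 * (B ^+ 2 / C ^+ 2) ^+ 2 * (2 * (T0 ^+ 2 + X ^+ 2)).
  apply: (@le_trans _ _ ((6 * (B ^+ 2 / C ^+ 2) * (T0 + X)) ^+ 2)).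
    by rewrite lerXn2r ?nnegrE// (le_trans P0).
  rewrite exprMn ler_pM ?sqr_ge0// exprMn; by rewrite (_ : 6 ^+ 2 = 36 :> R)//; ring.
apply: (le_trans h3).
have -> : 36 * (B ^+ 2 / C ^+ 2) ^+ 2 * (2 * (T0 ^+ 2 + X ^+ 2)) =
  (72 * 128 * (B ^+ 7 / C ^+ 6 * L ^+ 1 / n%:R) +
   72 * 16 * expR 1 ^+ 2 * radius_const ^+ 2 * (B ^+ 13 / C ^+ 10 * L ^+ 2 / n%:R)) * (n%:R / B).
  by rewrite T02 /X M2E; field; rewrite !gt_eqF.
rewrite ler_wpM2r ?divr_ge0// /error_const [leRHS]mulrDl.
apply: lerD.
  by apply: ler_wpM2l; [apply: mulr_ge0; exact: ler0n|exact: rate_ge].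
apply: ler_wpM2l; last exact: rate_ge.
apply: mulr_ge0; last exact: sqr_ge0.
by apply: mulr_ge0; [apply: mulr_ge0; exact: ler0n|exact: sqr_ge0].
Qed.

Lemma rate_gt0 : 0 < rate.
Proof. by rewrite divr_gt0// mulr_gt0 ?exprn_gt0 ?divr_gt0 ?exprn_gt0// (lt_le_trans ltr01). Qed.

Lemma eta_le : eta <= 4 * r%:R * rate.
Proof.
rewrite /eta (_ : _ / _ = 4 * r%:R * (B ^+ 1 / C ^+ 1 * L ^+ 0 / n%:R)).
  by rewrite ler_wpM2l ?mulr_ge0// rate_ge.
by field; rewrite !gt_eqF.
Qed.

(** In order: the radius is small, the expansion error stays below the typical score, edges inside
    the block are negligible, and so is the additive error after Young's inequality. *)
Definition rate_ok (t : R) : Prop :=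
  [/\ radius_const * rate <= (t / 96) ^+ 2, error_const * rate <= 1,
      4 * r%:R * rate <= t / 4 &
      (1 + t^-1) * (r%:R * ((4 * error_const + 16 * r%:R ^+ 2) * rate)) <= 2 * t].

Variable t : R.
Hypotheses (t0 : 0 < t) (t2 : t <= 2^-1) (ok : rate_ok t).

Lemma radius_small : M <= t / 96.
Proof.
case: ok => h _ _ _; have := le_trans radius_sqr_le h.
by rewrite ler_pXn2r// nnegrE ?radius_ge0// divr_ge0// ltW.
Qed.

(** [12 * M] is the [4 * M] of the quadratic minorant plus the [8 * M] of the homogeneous upper
    bound; with [M <= t / 96] the exponent is at most [t / 8]. *)
Lemma inflation_le : expR (12 * M) * (1 + eta) <= 1 + t.
Proof.
case: ok => _ _ h _; have he := le_trans eta_le h; have hM := radius_small; have M0 := radius_ge0.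
have e1 : expR (12 * M) <= 1 + t / 4.
  have h1 : 1 - 12 * M <= expR (- (12 * M)) by have := expR_ge1Dx (- (12 * M)); lra.
  have h2 : 0 < 1 - 12 * M by move: t2 hM; lra.
  rewrite -[12 * M]opprK expRN; apply: (@le_trans _ _ (1 - 12 * M)^-1).
    by rewrite lef_pV2 ?posrE ?expR_gt0.
  rewrite -[leLHS]mul1r ler_pdivrMr//.
  have : t * M <= 2^-1 * M by rewrite ler_wpM2r.
  move: hM; lra.
have eta0 : 0 <= eta by rewrite divr_ge0 ?mulr_ge0.
apply: (@le_trans _ _ ((1 + t / 4) * (1 + t / 4))).
  by apply: ler_pM; rewrite ?expR_ge0 ?addr_ge0//; lra.
have : t * t <= 2^-1 * t by rewrite ler_wpM2r// ltW.
move: t0; lra.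
Qed.

Lemma error_le_dev : P <= D.
Proof.
case: ok => _ h _ _.
suff : P ^+ 2 <= D ^+ 2 by rewrite ler_pXn2r ?nnegrE.
apply: (le_trans error_sqr_le); rewrite D2.
apply: (@le_trans _ _ (1 * n%:R)).
  apply: ler_pM => //.
  - by rewrite mulr_ge0// (ltW rate_gt0).
  - by rewrite divr_ge0.
  - by rewrite ler_pdivrMr// ler_peMr.
rewrite mulrAC ler_wpM2r////; move: L1; lra.
Qed.

(** To the expansion error [P] are added [r] for the dropped entries and another [r] for their mean
    under the homogeneous null. *)
Lemma total_error_le : (P + 2 * r%:R) ^+ 2 <=
  (4 * error_const + 16 * r%:R ^+ 2) * rate * (n%:R / 2 / B).
Proof.
have h1 := error_sqr_le.
(* Lets the bounded error [r] be expressed through [rate] as well. *)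
have h2 : 1 <= rate * (n%:R / B).
  have : B ^+ 1 / C ^+ 0 * L ^+ 0 / n%:R <= rate by exact: rate_ge.
  rewrite expr1 !expr0 divr1 mulr1 => h.
  have : B / n%:R * (n%:R / B) <= rate * (n%:R / B) by rewrite ler_wpM2r ?divr_ge0.
  by rewrite (_ : B / n%:R * (n%:R / B) = 1)//; field; rewrite !gt_eqF.
have h3 : (P + 2 * r%:R) ^+ 2 <= 2 * P ^+ 2 + 8 * r%:R ^+ 2.
  by have := sqr_ge0 (P - 2 * r%:R); rewrite !expr2; nra.
apply: (le_trans h3).
have -> : (4 * error_const + 16 * r%:R ^+ 2) * rate * (n%:R / 2 / B) =
  2 * (error_const * rate * (n%:R / B)) + 8 * (r%:R ^+ 2 * (rate * (n%:R / B))).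
  by field; rewrite gt_eqF.
apply: lerD; first by rewrite ler_wpM2l.
by rewrite ler_wpM2l// ler_peMr ?sqr_ge0.
Qed.

Variable beta : 'I_n -> R.
Hypothesis rn : (4 * r.+2 <= n)%N.
Hypothesis vb : forall i j : 'I_n, j != i ->
  B^-1 <= logistic_var (beta i + beta j) <= C^-1.
Variable a : {ffun 'I_n * 'I_n -> bool}.
Hypothesis typical : ~~ atypical beta r B C a.

Let ga : is_adj (sym_graph a). Proof. exact: sym_graph_adj. Qed.

Let typicalP i : [/\ `|score (sym_graph a) beta i| <= D,
   `|weighted_score beta [pred j : 'I_n | (j != i) && (r <= j)%N] i (sym_graph a)| <= T0 &
   `|weighted_score beta [pred j : 'I_n | j != i] i (sym_graph a)| <= T0].
Proof.
move: typical; rewrite negb_exists => /forallP/(_ i).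
by rewrite !negb_or -!leNgt => /and3P[].
Qed.

Let eta_tail (i : 'I_n) : (i < r)%N -> 2 * r%:R / C <= eta * v_tail r beta i.
Proof.
move=> ir; apply: (@le_trans _ _ (eta * (n%:R / 2 / B))).
  by rewrite (_ : eta * _ = 2 * r%:R / C)// /eta; field; rewrite !gt_eqF.
rewrite ler_wpM2l ?(v_tail_ge B0 rn vb)//.
by rewrite divr_ge0 ?mulr_ge0.
Qed.

Let M_lt : M < 2^-1.
Proof. by have := radius_small; move: t2 t0; lra. Qed.

Let kappa_le : expR (4 * M) * (1 + eta) <= 1 + t.
Proof.
apply: le_trans inflation_le; rewrite ler_wpM2r ?ler_expR//.
  by rewrite addr_ge0// divr_ge0 ?mulr_ge0.
by have := radius_ge0; lra.
Qed.

Let rho := (1 + t^-1) * (r%:R * ((4 * error_const + 16 * r%:R ^+ 2) * rate)).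

Let rho0 : 0 <= rho.
Proof.
rewrite /rho mulr_ge0 ?addr_ge0 ?invr_ge0 ?(ltW t0)// mulr_ge0// mulr_ge0 ?(ltW rate_gt0)//.
Qed.

Let sandwich (f x : 'I_n -> R) :
  (forall i : 'I_n, (i < r)%N -> `|f i - Num.sqrt (v_tail r beta i) * x i| <= P + 2 * r%:R) ->
  \sum_(i < n | (i < r)%N) f i ^+ 2 / v_tail r beta i <=
    (1 + t) * \sum_(i < n | (i < r)%N) x i ^+ 2 + rho /\
  \sum_(i < n | (i < r)%N) x i ^+ 2 <=
    (1 + t) * \sum_(i < n | (i < r)%N) f i ^+ 2 / v_tail r beta i + rho.
Proof.
move=> H; have := @sqr_sandwich R _ [pred i : 'I_n | (i < r)%N] (v_tail r beta) x f
  (P + 2 * r%:R) ((4 * error_const + 16 * r%:R ^+ 2) * rate) t t0.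
rewrite (card_tied rn); apply=> i ir; split; [exact: (v_tail_gt0 B0 rn vb)|exact: H|].
apply: (le_trans total_error_le); rewrite ler_wpM2l ?(v_tail_ge B0 rn vb)//.
by rewrite mulr_ge0 ?(ltW rate_gt0).
Qed.

Let sum_sqr_ge0 (f : 'I_n -> R) : 0 <= \sum_(i < n | (i < r)%N) f i ^+ 2 / v_tail r beta i.
Proof.
by rewrite sumr_ge0// => i ir; rewrite divr_ge0 ?sqr_ge0// ltW// (v_tail_gt0 B0 rn vb).
Qed.

Lemma lrt_simple_close (Theta : set ('I_n -> R)) :
  (forall b, Theta b <-> forall i : 'I_n, (i < r)%N -> b i = beta i) ->
  LRT Theta (sym_graph a) <= (1 + 4 * t) * simple_stat r beta a + 4 * t /\
  simple_stat r beta a <= (1 + 4 * t) * LRT Theta (sym_graph a) + 4 * t.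
Proof.
move=> ThetaE.
have sD i : `|score (sym_graph a) beta i| <= D by case: (typicalP i).
have T00 : 0 <= T0 by rewrite mulr_ge0 ?sqrtr_ge0// divr_ge0.
have DP : (D + P) * (2 * B / n%:R) <= M.
  apply: le_trans degree_dev_le_radius; rewrite ler_wpM2r ?divr_ge0 ?mulr_ge0//.
  by have := error_le_dev; lra.
have [F [G [hF hG h1 h2]]] := lrt_simple_bounds ga B0 C0 rn vb D0 radius_ge0 M_lt sD (lexx _)
  eta_tail ThetaE T00 (fun i => let: And3 _ h _ := typicalP i in h)
  (fun i => let: And3 _ _ h := typicalP i in h) (lexx _) DP.
have err (f : 'I_n -> R) : (forall i : 'I_n, (i < r)%N -> `|f i - score (sym_graph a) beta i| <= P) ->
    forall i : 'I_n, (i < r)%N ->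
    `|f i - Num.sqrt (v_tail r beta i) * row_stat r beta i a| <= P + 2 * r%:R.
  move=> hf i ir; have := hf i ir; have := score_row_stat B0 rn vb a ir.
  rewrite !ler_norml => /andP[? ?] /andP[? ?]; have r0 : 0 <= r%:R :> R by [].
  by apply/andP; split; lra.
have [_ hF2] := sandwich (err F hF); have [hG1 _] := sandwich (err G hG).
case: ok => _ _ _ rho2.
apply: (close_of_sandwich t0 t2 rho0 rho2 (simple_stat_ge0 _ _ _) (sum_sqr_ge0 F) kappa_le _ kappa_le h1 h2 hG1 hF2).
by rewrite mulr_ge0 ?expR_ge0// addr_ge0// divr_ge0 ?mulr_ge0.
Qed.

Hypothesis r0 : (0 < r)%N.
Hypothesis beta_tied : forall i j : 'I_n, (i < r)%N -> (j < r)%N -> beta i = beta j.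

Lemma lrt_tied_close (Theta : set ('I_n -> R)) :
  (forall b, Theta b <-> forall i j : 'I_n, (i < r)%N -> (j < r)%N -> b i = b j) ->
  LRT Theta (sym_graph a) <= (1 + 4 * t) * tied_stat r beta a + 4 * t /\
  tied_stat r beta a <= (1 + 4 * t) * LRT Theta (sym_graph a) + 4 * t.
Proof.
move=> ThetaE.
have sD i : `|score (sym_graph a) beta i| <= D by case: (typicalP i).
have /andP[h1 h2] := lrt_tied_bounds ga B0 C0 rn vb D0 radius_ge0 M_lt sD (lexx _)
  eta_tail r0 beta_tied ThetaE degree_dev_le_radius erefl.
set A := [pred i : 'I_n | (i < r)%N].
have err (i : 'I_n) : (i < r)%N ->
    `|(score (sym_graph a) beta i - mean A (score (sym_graph a) beta)) -
      Num.sqrt (v_tail r beta i) * (row_stat r beta i a - mean A (fun i => row_stat r beta i a))| <= P + 2 * r%:R.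
  move=> ir; have rR : 0 < r%:R :> R by rewrite ltr0n.
  (* All rows share the same [v_tail] here, so centring commutes with the normalization and the
     error is [dl i] minus its mean. *)
  pose dl j := score (sym_graph a) beta j - Num.sqrt (v_tail r beta i) * row_stat r beta j a.
  have dlr (j : 'I_n) : (j < r)%N -> `|dl j| <= r%:R.
    move=> jr; rewrite /dl (@v_tail_tied _ _ r beta beta_tied i j)//.
    exact: (score_row_stat B0 rn vb).
  have -> : score (sym_graph a) beta i - mean A (score (sym_graph a) beta) -
      Num.sqrt (v_tail r beta i) * (row_stat r beta i a - mean A (fun i => row_stat r beta i a)) =
      dl i - (\sum_(j < n | (j < r)%N) dl j) / r%:R.
    rewrite /dl sumrB -mulr_sumr /mean (card_tied rn); field; exact: lt0r_neq0.
  have m1 : `|(\sum_(j < n | (j < r)%N) dl j) / r%:R| <= r%:R.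
    rewrite normrM normfV (gtr0_norm rR) ler_pdivrMr//.
    rewrite (le_trans (ler_norm_sum _ _ _))//.
    apply: (@le_trans _ _ (\sum_(j < n | (j < r)%N) r%:R)); first by apply: ler_sum => j; exact: dlr.
    by rewrite -(big_ord_widen n (fun=> r%:R)) ?sumr_const ?card_ord ?mulr_natr//; clear -rn; lia.
  have := dlr i ir; move: m1; rewrite !ler_norml => /andP[? ?] /andP[? ?].
  by apply/andP; split; move: P0; lra.
have [hs1 hs2] := sandwich err.
case: ok => _ _ _ rho2.
apply: (close_of_sandwich t0 t2 rho0 rho2 (tied_stat_ge0 _ _ _) (sum_sqr_ge0 _) kappa_le _ _ h1 h2 hs1 hs2).
- by rewrite !mulr_ge0 ?expR_ge0// addr_ge0// divr_ge0 ?mulr_ge0.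
- rewrite mulrAC -expRD (_ : 4 * M + 8 * M = 12 * M); last by ring.
  exact: inflation_le.
Qed.

End Rates.

(** * The limit theorems *)

Section Extremes.
Variables (R : realType) (n : nat) (beta : 'I_n -> R).

Lemma vfun_le_b_n (i j : 'I_n) : j != i -> vfun (beta i + beta j) <= b_n beta.
Proof.
move=> ji; apply: (@bigmax_sup _ _ _ _ i predT) => //.
exact: (@bigmax_sup _ _ _ _ j (fun j => j != i)).
Qed.

Lemma c_n_le_vfun (i j : 'I_n) : j != i -> c_n beta <= vfun (beta i + beta j).
Proof.
move=> ji; apply: (@bigmin_inf _ _ _ _ i predT) => //.
exact: (@bigmin_inf _ _ _ _ j (fun j => j != i)).
Qed.

Lemma c_n_le_b_n : c_n beta <= b_n beta.
Proof. exact: bigmin_le_id. Qed.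

Lemma c_n_ge1 : (1 < n)%N -> 1 <= c_n beta.
Proof.
move=> n1; have v1 i j : 1 <= vfun (beta i + beta j).
  by have := vfun_ge4 (beta i + beta j); lra.
have b1 : 1 <= b_n beta.
  have ne : Ordinal n1 != Ordinal (ltnW n1) by [].
  exact: le_trans (v1 _ _) (vfun_le_b_n ne).
by apply: le_bigmin => // i _; apply: le_bigmin.
Qed.

Lemma logistic_var_bounds : (1 < n)%N -> forall i j : 'I_n, j != i ->
  (b_n beta)^-1 <= logistic_var (beta i + beta j) <= (c_n beta)^-1.
Proof.
move=> n1 i j ji; have c1 := c_n_ge1 n1; have v4 := vfun_ge4 (beta i + beta j).
have b1 := le_trans c1 c_n_le_b_n.
rewrite logistic_var_vfun !lef_pV2 ?posrE ?vfun_le_b_n ?c_n_le_vfun//; lra.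
Qed.

End Extremes.

Section Limits.
Variables (R : realType) (r : nat) (beta : forall n, 'I_n -> R).
Arguments beta : clear implicits.
Hypothesis rate_hyp :
  (fun n : nat => (b_n (beta n) ^+ 3 / c_n (beta n))
                   / ((n%:R : R) `^ (6^-1) / ln (n%:R : R))) @ \oo --> (0 : R).

Local Notation rate_n n := (rate n (b_n (beta n)) (c_n (beta n))).
Local Notation rate_ok_n n t := (rate_ok n r (b_n (beta n)) (c_n (beta n)) t).
Local Notation atypical_n n a := (atypical (beta n) r (b_n (beta n)) (c_n (beta n)) a).
Local Notation lap_step s n := (Num.sqrt s%:R * Num.sqrt (2 * b_n (beta n) / n%:R)).
Local Notation edge_n n := (edge_p (beta n)).

Definition regular (w : R) (n : nat) : Prop :=
  [/\ (4 * r.+2 <= n)%N, 1 <= c_n (beta n), 1 <= ln (n%:R : R) &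
      rate_n n <= w].

Lemma eventually_regular (w : R) : 0 < w -> \forall n \near \oo, regular w n.
Proof.
move=> w0.
have d0 : 0 < Num.min 1 w by rewrite lt_min ltr01.
have /cvgrPdist_lt/(_ _ d0) cvd := rate_hyp.
near=> n.
have n4 : (4 * r.+2 <= n)%N by near: n; exact: nbhs_infty_ge.
have ne : expR 1 < n%:R :> R by near: n; exact: nbhs_infty_gtr.
have nR : 0 < n%:R :> R by apply: lt_trans ne; exact: expR_gt0.
have l1 : 1 <= ln (n%:R : R).
  by rewrite -[leLHS]expRK ler_ln ?posrE ?expR_gt0// (ltW ne).
split=> //; first by rewrite c_n_ge1//; clear -n4; lia.
have : `|0 - (b_n (beta n) ^+ 3 / c_n (beta n)) / ((n%:R : R) `^ (6^-1) / ln (n%:R : R))| < Num.min 1 w.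
  by near: n.
rewrite sub0r normrN lt_min => /andP[/ltW h1 /ltW].
(* [rate] is the sixth power of the assumed ratio, whose modulus is at most 1, so this power is at
   most the modulus itself, hence at most [w]. *)
apply: le_trans; apply: le_trans (ler_piMr (normr_ge0 _) (exprn_ile1 5 (normr_ge0 _) h1)).
rewrite -exprS -normrX; apply: le_trans (ler_norm _).
apply: le_of_eq; rewrite /rate.
have q6 : ((n%:R : R) `^ (6^-1)) ^+ 6 = n%:R.
  by rewrite -powR_mulrn ?powR_ge0// -powRrM mulVf// powRr1.
set l := ln _ in l1 *; rewrite -[in LHS]q6; set q := _ `^ _.
have q0 : q != 0 by rewrite gt_eqF// powR_gt0.
have c0 : c_n (beta n) != 0.
  by rewrite gt_eqF// (lt_le_trans ltr01)// c_n_ge1//; clear -n4; lia.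
by field; rewrite q0 c0 gt_eqF//; apply: lt_le_trans l1.
Unshelve. all: by end_near. Qed.

Let regular_facts w n : regular w n ->
  [/\ (0 < n)%N, 0 < b_n (beta n), 0 < c_n (beta n) &
      forall i j : 'I_n, j != i ->
        (b_n (beta n))^-1 <= logistic_var (beta n i + beta n j) <= (c_n (beta n))^-1].
Proof.
move=> [n4 c1 _ _]; have n1 : (1 < n)%N by clear -n4; lia.
split; [exact: ltnW| | |exact: logistic_var_bounds].
  exact: lt_le_trans (le_trans c1 (c_n_le_b_n _)).
exact: lt_le_trans c1.
Qed.

Lemma eventually_rate_ok (t : R) : 0 < t ->
  \forall n \near \oo, rate_ok_n n t.
Proof.
move=> t0.
pose k1 := radius_const R r; pose k2 := error_const R r; pose k3 : R := 4 * r%:R.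
pose k4 := (1 + t^-1) * (r%:R * (4 * k2 + 16 * r%:R ^+ 2)).
have ev (k u : R) : 0 < u -> \forall n \near \oo, k * rate_n n <= u.
  move=> u0; have d0 : 0 < u / (`|k| + 1) by rewrite divr_gt0// ltr_wpDl.
  apply: filterS (eventually_regular d0) => n rg; have [n0 b0 c0 _] := regular_facts rg.
  case: rg => _ c1 l1 h.
  have r0 := rate_gt0 n0 c1 (c_n_le_b_n _) l1.
  apply: (@le_trans _ _ ((`|k| + 1) * rate_n n)).
    by rewrite ler_wpM2r ?(ltW r0)//; have := ler_norm k; lra.
  by rewrite mulrC -ler_pdivlMr// ltr_wpDl.
have e1 : \forall n \near \oo, k1 * rate_n n <= (t / 96) ^+ 2.
  by apply: ev; rewrite exprn_gt0// divr_gt0.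
have e2 : \forall n \near \oo, k2 * rate_n n <= 1 by exact: ev.
have e3 : \forall n \near \oo, k3 * rate_n n <= t / 4.
  by apply: ev; rewrite divr_gt0.
have e4 : \forall n \near \oo, k4 * rate_n n <= 2 * t.
  by apply: ev; rewrite mulr_gt0.
near=> n; split.
- by near: n.
- by near: n.
- by near: n.
- rewrite (_ : _ * _ = k4 * rate_n n); first by near: n.
  by rewrite /k4 /k2; ring.
Unshelve. all: by end_near. Qed.

Lemma eventually_typical (eps : R) : 0 < eps -> \forall n \near \oo,
  expect (edge_n n)
    (fun a => (atypical_n n a)%:R) <= eps.
Proof.
move=> eps0; near=> n.
have rg : regular 1 n by near: n; exact: eventually_regular.
have [n0 b0 c0 vb] := regular_facts rg; have [n4 _ _ _] := rg.
apply: (le_trans (atypical_prob n0 b0 c0 n4 vb)).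
have : 6 / eps < n%:R by near: n; exact: nbhs_infty_gtr.
rewrite ltr_pdivrMr// => h; rewrite ler_pdivrMr ?ltr0n//; lra.
Unshelve. all: by end_near. Qed.

(* The Laplace error is [O(n c^3)] with [c^2 = 2 b_n / n], that is, at most
   a constant times [sqrt rate]. *)
Lemma eventually_laplace_error (K eps : R) (m s : nat) : 0 <= K -> 0 < eps ->
  \forall n \near \oo,
    m%:R * (lap_step s n) <= 2^-1 /\
    n%:R * (K * (m%:R * (lap_step s n)) ^+ 3) <= eps.
Proof.
move=> K0 eps0; set S : R := Num.sqrt s%:R; have S0 : 0 <= S by exact: sqrtr_ge0.
pose k1 : R := m%:R * S; have k10 : 0 <= k1 by rewrite mulr_ge0.
pose k2 : R := K * k1 ^+ 3; have k20 : 0 <= k2 by rewrite mulr_ge0// exprn_ge0.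
pose d1 := 2^-1 / (k1 + 1); have d10 : 0 < d1 by rewrite divr_gt0// ltr_wpDl.
pose d2 := eps / (k2 + 1); have d20 : 0 < d2 by rewrite divr_gt0// ltr_wpDl.
have w10 : 0 < d1 ^+ 2 / 2 by rewrite divr_gt0// exprn_gt0.
have w20 : 0 < d2 ^+ 2 / 8 by rewrite divr_gt0// exprn_gt0.
near=> n.
have rg1 : regular (d1 ^+ 2 / 2) n by near: n; exact: eventually_regular.
have rg2 : regular (d2 ^+ 2 / 8) n by near: n; exact: eventually_regular.
have [n0 b0 c0 vb] := regular_facts rg1; have [_ c1 l1 r1] := rg1; have [_ _ _ r2] := rg2.
set B := b_n (beta n) in b0 *; set C := c_n (beta n) in c0 c1 *.
have nR : 0 < n%:R :> R by rewrite ltr0n.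
have CB : C <= B by exact: c_n_le_b_n.
set c := Num.sqrt (2 * B / n%:R); have cc0 : 0 <= c by exact: sqrtr_ge0.
have c2 : c ^+ 2 = 2 * B / n%:R by rewrite sqr_sqrtr// divr_ge0 ?mulr_ge0// ltW.
have hc : c <= d1.
  rewrite -(@ler_pXn2r _ 2) ?nnegrE ?(ltW d10)// c2.
  have := @rate_ge R n B C n0 c1 CB l1 1 0 0 isT isT.
  rewrite expr1 !expr0 divr1 mulr1 -mulrA => h; move: h r1; rewrite -/B -/C; lra.
have hn : n%:R * c ^+ 3 <= d2.
  rewrite -(@ler_pXn2r _ 2) ?nnegrE ?(ltW d20) ?mulr_ge0 ?exprn_ge0//.
  have -> : (n%:R * c ^+ 3) ^+ 2 = 8 * (B ^+ 3 / C ^+ 0 * ln n%:R ^+ 0 / n%:R).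
    rewrite exprMn -exprM mulnC exprM c2 !expr0; field; exact: lt0r_neq0.
  have := @rate_ge R n B C n0 c1 CB l1 3 0 0 isT isT.
  move=> h; move: h r2; rewrite -/B -/C; lra.
split.
  rewrite mulrA -/k1; apply: (@le_trans _ _ ((k1 + 1) * d1)).
    by apply: ler_pM => //; lra.
  by rewrite mulrC divfK// gt_eqF// ltr_wpDl.
have -> : n%:R * (K * (m%:R * (S * c)) ^+ 3) = k2 * (n%:R * c ^+ 3).
  by rewrite /k2 /k1; ring.
apply: (@le_trans _ _ ((k2 + 1) * d2)).
  by apply: ler_pM => //; [rewrite mulr_ge0// exprn_ge0|lra].
by rewrite mulrC divfK// gt_eqF// ltr_wpDl.
Unshelve. all: by end_near. Qed.

Section GenericLimit.
Variables (k m : nat) (K A : R) (k0 : (0 < k)%N).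
Variable Q : forall n, {ffun 'I_n * 'I_n -> bool} -> R.
Variable Theta : forall n, set ('I_n -> R).
Arguments Q : clear implicits.
Arguments Theta : clear implicits.
Hypotheses (K0 : 0 <= K) (A0 : 0 <= A).
Hypothesis Q0 : forall n a, 0 <= Q n a.
Hypothesis Theta_beta : forall n, Theta n (beta n).
Hypothesis laplace : forall (s n : nat), regular 1 n -> m%:R * lap_step s n <= 2^-1 ->
  `|expect (edge_n n) (fun a => expR (- (s%:R * Q n a))) -
    expR (- (k%:R / 2 * ln (1 + 2 * s%:R)))| <=
  A * (n%:R * (K * (m%:R * lap_step s n) ^+ 3)).
Hypothesis close : forall (t : R) n a, 0 < t -> t <= 2^-1 -> regular 1 n -> rate_ok_n n t ->
  ~~ atypical_n n a ->
    LRT (Theta n) (sym_graph a) <= (1 + 4 * t) * Q n a + 4 * t /\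
    Q n a <= (1 + 4 * t) * LRT (Theta n) (sym_graph a) + 4 * t.

(** The common end of both nulls: [k] is the number of degrees of freedom, [m] the size of a
    replacement block and [A] the number of independent blocks. The simple null takes [m = 1] and
    [A = r], the homogeneous one [m = r] and [A = 1]. *)
Lemma lrt_limit : conv_in_dist beta (fun n => LRT (Theta n)) (@chisq_cdf R k).
Proof.
move=> x cx.
have T0 n a : 0 <= LRT (Theta n) (sym_graph a).
  by apply: LRT_ge0; [exact: sym_graph_adj|exists (beta n); exact: Theta_beta].
have cl eps : 0 < eps ->
    \forall n \near \oo, forall a, ~~ atypical_n n a ->
    LRT (Theta n) (sym_graph a) <= (1 + eps) * Q n a + eps /\
    Q n a <= (1 + eps) * LRT (Theta n) (sym_graph a) + eps.
  move=> eps0; pose t := Num.min (2^-1) (eps / 4).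
  have t0 : 0 < t by rewrite lt_min invr_gt0 ltr0n divr_gt0.
  have t2 : t <= 2^-1 by rewrite ge_min lexx.
  have t4 : 4 * t <= eps.
    have : t <= eps / 4 by rewrite ge_min lexx orbT.
    lra.
  near=> n => a ta.
  have rg : regular 1 n by near: n; exact: eventually_regular.
  have ok : rate_ok_n n t by near: n; exact: eventually_rate_ok.
  have [h1 h2] := close t0 t2 rg ok ta.
  have q0 := Q0 a; have tt0 := T0 n a.
  by split; [apply: (le_trans h1)|apply: (le_trans h2)];
    rewrite lerD// ler_wpM2r// lerD2l.
have lap (s : nat) : (fun n => expect (edge_n n) (fun a => expR (- (s%:R * Q n a)))) @ \oo -->
    expR (- (k%:R / 2 * ln (1 + 2 * s%:R))).
  apply/cvgrPdist_le => eps eps0.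
  have e0 : 0 < eps / (A + 1) by rewrite divr_gt0// ltr_wpDl.
  near=> n.
  have rg : regular 1 n by near: n; exact: eventually_regular.
  have [h1 h2] : m%:R * lap_step s n <= 2^-1 /\
    n%:R * (K * (m%:R * lap_step s n) ^+ 3) <= eps / (A + 1).
    by near: n; exact: eventually_laplace_error.
  rewrite distrC (le_trans (laplace rg h1))//.
  have := ler_wpM2l A0 h2; have : A * (eps / (A + 1)) <= eps.
    by rewrite mulrA ler_pdivrMr ?ltr_wpDl// mulrC ler_wpM2l ?(ltW eps0)// lerDl.
  lra.
have := @chisq_limit R k k0 (fun n => ('I_n * 'I_n)%type : finType) (fun n => edge_n n) Q
  (fun n => edge_p01 (beta n)) Q0 lap (fun n a => LRT (Theta n) (sym_graph a))
  (fun _ n a => atypical_n n a) T0 eventually_typical cl x cx.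
rewrite (_ : (fun n => prob_le _ _ _) = (fun n => expect (edge_n n)
  (fun a => (LRT (Theta n) (sym_graph a) <= x)%R%:R)))//.
by apply/funext => n; rewrite prob_leE graph_expectE.
Unshelve. all: by end_near. Qed.

End GenericLimit.

Lemma lrt_simple_limit (Theta : forall n, set ('I_n -> R)) : (0 < r)%N ->
  (forall n b, Theta n b <-> forall i : 'I_n, (i < r)%N -> b i = beta n i) ->
  conv_in_dist beta (fun n => LRT (Theta n)) (@chisq_cdf R r).
Proof.
move=> r0 ThetaE.
apply: (@lrt_limit r 1 (step_const R 1) r%:R r0 (fun n => simple_stat r (beta n))).
- exact: step_const_ge0.
- exact: ler0n.
- by move=> n a; exact: simple_stat_ge0.
- by move=> n; apply/ThetaE.
- move=> s n rg; have [n0 b0 c0 vb] := regular_facts rg; have [n4 _ _ _] := rg.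
  by rewrite !mul1r; exact: laplace_simple b0 n4 vb _ (ler0n _ _).
- move=> t n a t0 t2 rg ok; have [n0 b0 c0 vb] := regular_facts rg; have [n4 c1 l1 _] := rg.
  by move=> ty; exact: (lrt_simple_close n0 c1 (c_n_le_b_n _) l1 t0 t2 ok n4 vb ty (ThetaE n)).
Qed.

Lemma lrt_tied_limit (Theta : forall n, set ('I_n -> R)) : (1 < r)%N ->
  (forall n (i j : 'I_n), (i < r)%N -> (j < r)%N -> beta n i = beta n j) ->
  (forall n b, Theta n b <-> forall i j : 'I_n, (i < r)%N -> (j < r)%N -> b i = b j) ->
  conv_in_dist beta (fun n => LRT (Theta n)) (@chisq_cdf R r.-1).
Proof.
move=> r1 tied ThetaE; have r0 : (0 < r)%N by exact: ltnW.
apply: (@lrt_limit r.-1 r (step_const R r) 1 _ (fun n => tied_stat r (beta n))).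
- by rewrite -subn1 subn_gt0.
- exact: step_const_ge0.
- exact: ler01.
- by move=> n a; exact: tied_stat_ge0.
- by move=> n; apply/ThetaE => i j; exact: tied.
- move=> s n rg; have [n0 b0 c0 vb] := regular_facts rg; have [n4 _ _ _] := rg.
  by rewrite mul1r; apply: (laplace_tied b0 n4 vb _ r0 (tied n)).
- move=> t n a t0 t2 rg ok; have [n0 b0 c0 vb] := regular_facts rg; have [n4 c1 l1 _] := rg.
  by move=> ty; exact: (lrt_tied_close n0 c1 (c_n_le_b_n _) l1 t0 t2 ok n4 vb ty r0 (tied n) (ThetaE n)).
Qed.

End Limits.

Lemma LRT_setT (R : realType) n (g : {ffun 'I_n * 'I_n -> bool}) : LRT (setT : set ('I_n -> R)) g = 0.
Proof. by rewrite /LRT subrr mulr0. Qed.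

(** The degenerate case: the ratio is identically 0, and [chisq_cdf] with 0 degrees of freedom is
    the distribution function of the point mass at 0. *)
Lemma conv_in_dist_LRT_setT (R : realType) (beta : forall n, 'I_n -> R) :
  conv_in_dist beta (fun n => LRT (setT : set ('I_n -> R))) (@chisq_cdf R 0).
Proof.
move=> x _; rewrite (_ : (fun n => _) = fun=> @chisq_cdf R 0 x); first exact: cvg_cst.
apply/funext => n; rewrite prob_leE graph_expectE.
rewrite (@eq_expect _ _ _ _ (fun=> (0 <= x)%R%:R)); last by move=> a /=; rewrite LRT_setT.
by rewrite expect_cst /chisq_cdf eqxx; case: (0 <= x).
Qed.

Theorem theorem2 (R : realType) (r : nat) (r_pos : (0 < r)%N) :
  (* (a) simple null H_0 : beta_i = beta0_i, i = 1..r *)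
  (forall (beta0 : 'I_r -> R) (beta : forall n : nat, 'I_n -> R),
     (fun n : nat => (b_n (beta n) ^+ 3 / c_n (beta n))
                      / ((n%:R : R) `^ (6^-1) / ln (n%:R : R))) @ \oo --> (0 : R) ->
     (forall n (i : 'I_n) (Hi : (i < r)%N), beta n i = beta0 (Ordinal Hi)) ->
     conv_in_dist beta (fun n => LRT (@Theta0_simple R r n beta0)) (@chisq_cdf R r)) /\
  (* (b) homogeneous null H_0 : beta_1 = ... = beta_r *)
  (forall (beta : forall n : nat, 'I_n -> R),
     (fun n : nat => (b_n (beta n) ^+ 3 / c_n (beta n))
                      / ((n%:R : R) `^ (6^-1) / ln (n%:R : R))) @ \oo --> (0 : R) ->
     (forall n (i j : 'I_n), (i < r)%N -> (j < r)%N -> beta n i = beta n j) ->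
     conv_in_dist beta (fun n => LRT (@Theta0_homog R r n)) (@chisq_cdf R r.-1)).
Proof.
split=> [beta0 beta hrate null|beta hrate null].
  apply: lrt_simple_limit => // n b; split=> h i Hi; first by rewrite h null.
  by rewrite h// null.
(* For [r = 1] the homogeneous null imposes nothing, so the null set is the whole space and the
   limit is the point mass at 0. *)
have [r1|r1] := ltnP 1 r; first exact: lrt_tied_limit.
have -> : r = 1%N by apply/eqP; rewrite eqn_leq r1.
rewrite (_ : (fun n => LRT (@Theta0_homog R 1 n)) = (fun n => LRT (setT : set ('I_n -> R)))).
  exact: conv_in_dist_LRT_setT.
apply: functional_extensionality_dep => n; congr LRT; apply/seteqP; split=> // b _ i j.
by rewrite !ltnS !leqn0 => /eqP i0 /eqP j0; congr b; apply/val_inj; rewrite /= i0 j0.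
Qed.
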